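(* Let $\mu_1,\mu_2$ be complex Borel measures on $\mathbb{R}$, and let $F\colon\mathbb{R}\times\mathbb{R}\to\mathbb{R}\times\mathbb{R}$ be $F(x_1,x_2) := (x_1+x_2,x_1-x_2)$. Then the pushforward measure $F_*(\mu_1\times\mu_2)$ is the product measure of two complex measures on $\mathbb{R}$ if and only if at least one of the following conditions holds: (1) $\mu_1=0$. (2) $\mu_2=0$. (3) There exist $c_1,c_2,c_3,c_4,c_5\in\mathbb{C}$ with $\operatorname{Re}c_1<0$ such that $\mu_1 = e^{c_1x^2+c_2x+c_3}\,dx$ and $\mu_2 = e^{c_1x^2+c_4x+c_5}\,dx$, where $dx$ is the Lebesgue measure on $\mathbb{R}$. (4) There exist $c_1,c_2\in\mathbb{C}$ and $t_1,t_2\in\mathbb{R}$ such that $\mu_1=c_1\delta_{t_1}$ and $\mu_2=c_2\delta_{t_2}$.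
   Context: $\delta_t$ denotes the Dirac measure at $t$. *)

(* Defs.v *)
From HB Require Import structures.
From mathcomp Require Import all_boot all_order all_algebra.
From mathcomp Require Import all_classical all_reals all_analysis.
From mathcomp Require Import complex ring.

Set Implicit Arguments.
Unset Strict Implicit.
Unset Printing Implicit Defensive.

Import Order.TTheory GRing.Theory Num.Theory.
Import numFieldNormedType.Exports.

Local Open Scope classical_set_scope.
Local Open Scope ring_scope.
Local Open Scope complex_scope.
Local Notation Re := complex.Re.
Local Notation Im := complex.Im.

Reserved Notation "{ 'complex_measure' 'set' T '->' R [i] }"
  (at level 36, T, R at level 0,
   format "{ 'complex_measure'  'set'  T  '->'  R [i] }").
Reserved Notation "m1 '\xC' m2" (at level 40, left associativity).

(* Convergence is taken in the norm topology of R[i]; as for the measures and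
   charges of the library, only the values on measurable sets are meaningful. *)
HB.mixin Record isComplexMeasure d (T : measurableType d) (R : realType)
    (mu : set T -> R[i]) := {
  cmeasure0 : mu set0 = 0 ;
  cmeasure_sigma_additive : forall F : (set T)^nat,
    (forall n, measurable (F n)) -> trivIset setT F ->
    (fun n => \sum_(0 <= i < n) mu (F i) : R[i]^o) @ \oo -->
      (mu (\bigcup_n F n) : R[i]^o) }.

#[short(type=complex_measure)]
HB.structure Definition ComplexMeasure d (T : measurableType d) (R : realType)
  := { mu of isComplexMeasure d T R mu }.

Notation "{ 'complex_measure' 'set' T '->' R [i] }" :=
  (complex_measure T R) : ring_scope.

Section complex_convergence.
Variable R : realType.
Implicit Types (u : nat -> R[i]) (z : R[i]).

Lemma normc_ge_Im z : `|Im z|%:C <= `|z|.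
Proof.
by case: z => a b; rewrite normc_def /= lecR -sqrtr_sqr ler_wsqrtr// lerDr sqr_ge0.
Qed.

Lemma cvg_Re u z : (u : nat -> R[i]^o) @ \oo --> (z : R[i]^o) ->
  (fun n => Re (u n)) @ \oo --> Re z.
Proof.
move=> /cvgrPdist_lt uz; apply/cvgrPdist_lt => e e0.
have eC : 0 < e%:C :> R[i] by rewrite ltcR.
apply: filterS (uz _ eC) => n h.
rewrite -ltcR; apply: le_lt_trans h.
by rewrite -raddfB; exact: normc_ge_Re.
Qed.

Lemma cvg_Im u z : (u : nat -> R[i]^o) @ \oo --> (z : R[i]^o) ->
  (fun n => Im (u n)) @ \oo --> Im z.
Proof.
move=> /cvgrPdist_lt uz; apply/cvgrPdist_lt => e e0.
have eC : 0 < e%:C :> R[i] by rewrite ltcR.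
apply: filterS (uz _ eC) => n h.
rewrite -ltcR; apply: le_lt_trans h.
by rewrite -raddfB; exact: normc_ge_Im.
Qed.

Lemma cvg_complex (a b : nat -> R) (x y : R) : a @ \oo --> x -> b @ \oo --> y ->
  (fun n => a n +i* b n : R[i]^o) @ \oo --> (x +i* y : R[i]^o).
Proof.
move=> /cvgrPdist_lt ax /cvgrPdist_lt yb; apply/cvgrPdist_lt => -[e e'].
rewrite ltcE/= => /andP[/eqP-> e0].
have e20 : 0 < e / 2 by rewrite divr_gt0.
apply: filterS2 (ax _ e20) (yb _ e20) => n h1 h2.
have -> : (x +i* y : R[i]) - (a n +i* b n) =
    ((x - a n) +i* 0) + (0 +i* (y - b n)).
  by apply/eqP; rewrite eq_complex/= addr0 add0r !eqxx.
apply: (le_lt_trans (ler_normD _ _)).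
rewrite !normc_def/= expr0n/= addr0 add0r !sqrtr_sqr -rmorphD/= ltcR.
by rewrite [ltRHS](splitr e) ltrD.
Qed.

End complex_convergence.

Section real_imaginary_parts.
Context d (T : measurableType d) (R : realType).
Variable mu : {complex_measure set T -> R[i]}.

Definition charge_Re : set T -> \bar R := fun A => (Re (mu A))%:E.
Definition charge_Im : set T -> \bar R := fun A => (Im (mu A))%:E.

Let charge_Re0 : charge_Re set0 = 0%E.
Proof. by rewrite /charge_Re cmeasure0. Qed.

Let charge_Re_fin A : measurable A -> charge_Re A \is a fin_num.
Proof. by []. Qed.

Let charge_Re_sigma_additive : measure_function.semi_sigma_additive charge_Re.
Proof.
move=> F mF tF _; rewrite /charge_Re.
under eq_fun do rewrite sumEFin -raddf_sum.
apply: cvg_EFin; first exact: nearW.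
exact: cvg_Re (cmeasure_sigma_additive _ mF tF).
Qed.

HB.instance Definition _ := isCharge.Build _ _ _ charge_Re
  charge_Re0 charge_Re_fin charge_Re_sigma_additive.

Let charge_Im0 : charge_Im set0 = 0%E.
Proof. by rewrite /charge_Im cmeasure0. Qed.

Let charge_Im_fin A : measurable A -> charge_Im A \is a fin_num.
Proof. by []. Qed.

Let charge_Im_sigma_additive : measure_function.semi_sigma_additive charge_Im.
Proof.
move=> F mF tF _; rewrite /charge_Im.
under eq_fun do rewrite sumEFin -raddf_sum.
apply: cvg_EFin; first exact: nearW.
exact: cvg_Im (cmeasure_sigma_additive _ mF tF).
Qed.

HB.instance Definition _ := isCharge.Build _ _ _ charge_Im
  charge_Im0 charge_Im_fin charge_Im_sigma_additive.

End real_imaginary_parts.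

Section complex_measure_of_charges.
Context d (T : measurableType d) (R : realType).
Variables a b : {charge set T -> \bar R}.

Definition cmeasure_of_charges : set T -> R[i] :=
  fun A => fine (a A) +i* fine (b A).

Let cmeasure_of_charges0 : cmeasure_of_charges set0 = 0.
Proof. by rewrite /cmeasure_of_charges !charge0. Qed.

Let fine_charge_sigma_additive (c : {charge set T -> \bar R}) (F : (set T)^nat) :
  (forall n, measurable (F n)) -> trivIset setT F ->
  (fun n => \sum_(0 <= i < n) fine (c (F i))) @ \oo -->
    fine (c (\bigcup_n F n)).
Proof.
move=> mF tF; have mUF : measurable (\bigcup_n F n) by exact: bigcup_measurable.
have sF n : (\sum_(0 <= i < n) fine (c (F i)))%:E = \sum_(0 <= i < n) c (F i).
  by rewrite -sumEFin; apply: eq_bigr => i _; rewrite fineK ?fin_num_measure.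
have : (fun n => \sum_(0 <= i < n) c (F i)) @ \oo --> (fine (c (\bigcup_n F n)))%:E.
  by rewrite fineK ?fin_num_measure//; exact: charge_semi_sigma_additive.
by under eq_fun do rewrite -sF; move/fine_cvg.
Qed.

Let cmeasure_of_charges_sigma_additive (F : (set T)^nat) :
  (forall n, measurable (F n)) -> trivIset setT F ->
  (fun n => \sum_(0 <= i < n) cmeasure_of_charges (F i) : R[i]^o) @ \oo -->
    (cmeasure_of_charges (\bigcup_n F n) : R[i]^o).
Proof.
move=> mF tF.
rewrite [X in X @ _ --> _](_ : _ = fun n => (\sum_(0 <= i < n) fine (a (F i))) +i*
    (\sum_(0 <= i < n) fine (b (F i)))).
  apply: cvg_complex; exact: fine_charge_sigma_additive.
apply/funext => n; apply/eqP.
by rewrite eq_complex !raddf_sum/= !eqxx.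
Qed.

HB.instance Definition _ := isComplexMeasure.Build _ _ _ cmeasure_of_charges
  cmeasure_of_charges0 cmeasure_of_charges_sigma_additive.

End complex_measure_of_charges.

(* The Hahn decomposition is obtained by choice; on measurable sets the two
   parts below do not depend on it. *)
Section charge_parts.
Context d (T : measurableType d) (R : realType).
Variable nu : {charge set T -> \bar R}.

Let hahn : {PN : set T * set T | hahn_decomposition nu PN.1 PN.2}.
Proof.
apply: cid; have [P [N nuPN]] := Hahn_decomposition nu.
by exists (P, N).
Qed.

Definition charge_pos : {finite_measure set T -> \bar R} :=
  jordan_pos (svalP hahn).
Definition charge_neg : {finite_measure set T -> \bar R} :=
  jordan_neg (svalP hahn).

Lemma charge_posneg A : measurable A -> nu A = (charge_pos A - charge_neg A)%E.
Proof.
move=> mA; rewrite (jordan_decomp (svalP hahn) mA) /cadd/= /cscale mulN1e.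
by [].
Qed.

End charge_parts.

Section product_of_finite_measures.
Local Open Scope ereal_scope.
Context d1 d2 (T1 : measurableType d1) (T2 : measurableType d2) (R : realType).
Variables (m1 : {finite_measure set T1 -> \bar R})
          (m2 : {finite_measure set T2 -> \bar R}).

Definition product_finite : set (T1 * T2) -> \bar R := m1 \x m2.

Let product_finite0 : product_finite set0 = 0.
Proof. exact: (measure0 (m1 \x m2)%E). Qed.

Let product_finite_fin A : measurable A -> product_finite A \is a fin_num.
Proof.
move=> mA; rewrite ge0_fin_numE ?(measure_ge0 (m1 \x m2)%E)//.
apply: (@le_lt_trans _ _ ((m1 \x m2)%E setT)).
  by apply: le_measure; rewrite ?inE.
rewrite -setXTT product_measure1E//.
by rewrite -ge0_fin_numE ?mule_ge0// fin_numM// fin_num_measure.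
Qed.

Let product_finite_sigma_additive :
  measure_function.semi_sigma_additive product_finite.
Proof. exact: (@measure_semi_sigma_additive _ _ _ (m1 \x m2)%E). Qed.

HB.instance Definition _ := isCharge.Build _ _ _ product_finite
  product_finite0 product_finite_fin product_finite_sigma_additive.

Lemma product_finiteE A B : measurable A -> measurable B ->
  product_finite (A `*` B) = m1 A * m2 B.
Proof. exact: product_measure1E. Qed.

End product_of_finite_measures.

Section product_charge.
Local Open Scope ereal_scope.
Context d1 d2 (T1 : measurableType d1) (T2 : measurableType d2) (R : realType).
Variables (n1 : {charge set T1 -> \bar R}) (n2 : {charge set T2 -> \bar R}).

Definition product_charge : set (T1 * T2) -> \bar R :=
  cadd
    (cadd (product_finite (charge_pos n1) (charge_pos n2))
          (product_finite (charge_neg n1) (charge_neg n2)))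
    (copp
      (cadd (product_finite (charge_pos n1) (charge_neg n2))
            (product_finite (charge_neg n1) (charge_pos n2)))).

HB.instance Definition _ := Charge.on product_charge.

Lemma product_chargeE A B : measurable A -> measurable B ->
  product_charge (A `*` B) = n1 A * n2 B.
Proof.
move=> mA mB; rewrite -[LHS]/(
  product_finite (charge_pos n1) (charge_pos n2) (A `*` B) +
  product_finite (charge_neg n1) (charge_neg n2) (A `*` B) -
  (product_finite (charge_pos n1) (charge_neg n2) (A `*` B) +
   product_finite (charge_neg n1) (charge_pos n2) (A `*` B))).
rewrite !product_finiteE// (charge_posneg n1)// (charge_posneg n2)//.
move: (fin_num_measure (charge_pos n1) A mA)
  (fin_num_measure (charge_neg n1) A mA)
  (fin_num_measure (charge_pos n2) B mB)
  (fin_num_measure (charge_neg n2) B mB) => /fineK<- /fineK<- /fineK<- /fineK<-.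
rewrite -!(EFinM,EFinD,EFinN); congr EFin; ring.
Qed.

End product_charge.

(* (a + ib) x (a' + ib') = (a x a' - b x b') + i(a x b' + b x a'), each product
   of charges being obtained from the Jordan decompositions of its factors.
   Measurable rectangles being a pi-system, product_cmeasureE determines the
   product on all measurable sets. *)
Section product_complex_measure.
Context d1 d2 (T1 : measurableType d1) (T2 : measurableType d2) (R : realType).
Variables (m1 : {complex_measure set T1 -> R[i]})
          (m2 : {complex_measure set T2 -> R[i]}).

Definition product_cmeasure : set (T1 * T2) -> R[i] :=
  cmeasure_of_charges
    (cadd (product_charge (charge_Re m1) (charge_Re m2))
          (copp (product_charge (charge_Im m1) (charge_Im m2))))
    (cadd (product_charge (charge_Re m1) (charge_Im m2))
          (product_charge (charge_Im m1) (charge_Re m2))).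

HB.instance Definition _ := ComplexMeasure.on product_cmeasure.

Lemma product_cmeasureE A B : measurable A -> measurable B ->
  product_cmeasure (A `*` B) = m1 A * m2 B.
Proof.
move=> mA mB; rewrite /product_cmeasure /cmeasure_of_charges.
rewrite -[X in fine X +i* _]/(
  (product_charge (charge_Re m1) (charge_Re m2) (A `*` B) -
   product_charge (charge_Im m1) (charge_Im m2) (A `*` B))%E).
rewrite -[X in _ +i* fine X]/(
  (product_charge (charge_Re m1) (charge_Im m2) (A `*` B) +
   product_charge (charge_Im m1) (charge_Re m2) (A `*` B))%E).
rewrite !product_chargeE// /charge_Re /charge_Im.
have mulE (x y : R[i]) : (Re x * Re y - Im x * Im y) +i*
  (Re x * Im y + Im x * Re y) = x * y by case: x => a b; case: y.
exact: mulE.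
Qed.

End product_complex_measure.

Notation "m1 '\xC' m2" := (product_cmeasure m1 m2) : ring_scope.

Definition cpushforward d1 d2 (T1 : measurableType d1) (T2 : measurableType d2)
    (R : realType) (m : set T1 -> R[i]) (f : T1 -> T2) : set T2 -> R[i] :=
  fun A => m (f @^-1` A).

(* e^(a + ib) = e^a (cos b + i sin b) *)
Definition cexp (R : realType) (z : R[i]) : R[i] :=
  (expR (Re z) * cos (Im z)) +i* (expR (Re z) * sin (Im z)).

Definition cRintegral d (T : measurableType d) (R : realType)
    (mu : {measure set T -> \bar R}) (D : set T) (f : T -> R[i]) : R[i] :=
  (\int[mu]_(x in D) Re (f x)) +i* (\int[mu]_(x in D) Im (f x)).

Definition density_measure d (T : measurableType d) (R : realType)
    (mu : {measure set T -> \bar R}) (f : T -> R[i]) : set T -> R[i] :=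
  fun A => cRintegral mu A f.

(* equality as measures: the values on non-measurable sets are junk *)
Definition eq_on_measurable d (T : measurableType d) (C : Type)
    (m m' : set T -> C) : Prop :=
  forall A, measurable A -> m A = m' A.

(* Main.v *)
Require Import Defs.
From mathcomp Require Import finmap.
From mathcomp Require Import all_boot all_order all_algebra.
From mathcomp Require Import all_classical all_reals all_analysis.
From mathcomp Require Import complex.
From mathcomp Require Import measurable_realfun simple_functions.
From mathcomp Require Import ring lra.
Import Order.TTheory GRing.Theory Num.Theory.
Import numFieldNormedType.Exports.
Local Open Scope classical_set_scope.
Local Open Scope ring_scope.
Local Open Scope complex_scope.

Set Implicit Arguments.
Unset Strict Implicit.
Unset Printing Implicit Defensive.

(** A centred Gaussian on the plane is rotation invariant, so it is a product
    both in the coordinates [(x, y)] and in the coordinates [(x + y, x - y)]: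
    [e^(-s x^2) e^(-s y^2) = e^(-(s/2) (x+y)^2) e^(-(s/2) (x-y)^2)].  Averaging
    the measures against these weights therefore turns an identity between
    measures, where the image of [mu1 x mu2] under
    [(x, y) |-> (x + y, x - y)] is [nu1 x nu2], into one between smooth
    functions: with [h_i] the convolution of [mu_i] with [e^(-s x^2)] and [k_i]
    that of [nu_i] with [e^(-(s/2) x^2)],
    [h1 x * h2 y = k1 (x + y) * k2 (x - y)] ([gconv_splits]).

    This functional equation is solved without assuming that the functions are
    positive.  A factor that is not identically zero vanishes nowhere
    ([splits_neq0]).  Comparing the equation at four points, [k1] and [k2] drop
    out, and two differentiations show that the logarithmic derivatives of [h1]
    and [h2] are affine with the same slope: [h_i' = (K z + b_i) h_i]
    ([splits_log_affine]).

    Then [s] tends to infinity.  The renormalised averages converge weakly to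
    the measures ([cvg_gconv]), but [K] and [b_i], which depend on [s], need not
    converge.  Paired with a test function and integrated by parts, the
    differential equation is one linear equation for [(K, b_i)] whose
    coefficients converge, so two test functions give a linear system.  If some
    limit determinant is nonzero, Cramer's rule makes [K] and [b_i] converge.
    Otherwise [x mu_i] is a multiple of [mu_i], which is then carried by one
    point ([dirac_or_cvg]).

    In the first case [mu_i] has density [e^(K z^2 / 2 + b_i z + c)] for the
    limits, and [Re K < 0] because the total variation of a complex measure is
    finite ([gaussian_of_convergent]).  In the second case the average of
    [c delta_t] is [c e^(-s (z - t)^2)], so that [K = - 2 s] diverges
    ([concentrated_slope], [linear_slope_diverges]).  As [K] is common to [mu1]
    and [mu2], both measures fall in the same case, and two Gaussian densities
    have the same quadratic coefficient ([product_image_necessary]).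

    Conversely, the image of a product of two Gaussian densities with the same
    quadratic coefficient is computed by the change of variables
    ([integral_sum_difference]) and splits again into two such factors
    ([gaussian_sum_difference]); the image of a product of two Dirac measures is
    a multiple of a Dirac measure of the plane, which is the product of two
    Dirac measures up to that factor, and a product with a zero factor is zero. *)

Local Notation Re := complex.Re.
Local Notation Im := complex.Im.

(** * Bounded measurable functions and monotone classes *)

Import HBSimple HBNNSimple.

Section bounded_measurable.
Context d (T : measurableType d) (R : realType).
Implicit Types (f g : T -> R) (A : set T).

Definition bounded_measurable f :=
  measurable_fun setT f /\ exists M, forall x, `|f x| <= M.

Lemma bounded_measurable_cst (c : R) : bounded_measurable (fun=> c).
Proof. by split; [exact: measurable_cst | exists `|c|]. Qed.

Lemma bounded_measurable_lin (a : R) f g :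
  bounded_measurable f -> bounded_measurable g ->
  bounded_measurable (fun x => a * f x + g x).
Proof.
move=> [mf [M fM]] [mg [N gN]]; split.
  by apply: measurable_funD => //; exact: measurable_funM.
exists (`|a| * M + N) => x; apply: (le_trans (ler_normD _ _)).
by rewrite lerD// normrM ler_wpM2l.
Qed.

Lemma bounded_measurableM f g :
  bounded_measurable f -> bounded_measurable g ->
  bounded_measurable (fun x => f x * g x).
Proof.
move=> [mf [M fM]] [mg [N gN]]; split; first exact: measurable_funM.
by exists (M * N) => x; rewrite normrM ler_pM.
Qed.

Lemma bounded_measurable_indic A : measurable A ->
  bounded_measurable (\1_A : T -> R).
Proof.
move=> mA; split; first exact: measurable_indic.
by exists 1 => x; rewrite indicE; case: (_ \in _); rewrite /= ?normr0 ?normr1.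
Qed.

Lemma bounded_measurable_integrable (m : {finite_measure set T -> \bar R}) f :
  bounded_measurable f -> m.-integrable setT (EFin \o f).
Proof.
move=> [mf [M fM]]; apply: measurable_bounded_integrable => //.
  by rewrite -ge0_fin_numE// fin_num_measure.
exists M; split; first exact: num_real.
by move=> x Mx y _; exact: (le_trans (fM y) (ltW Mx)).
Qed.

Section induction.
Variables (G : set (set T)) (P : (T -> R) -> Prop).
Hypothesis GE : @measurable _ T = <<s G >>.
Hypothesis GI : setI_closed G.
Hypothesis P1 : P (fun=> 1).
Hypothesis PG : forall A, G A -> P \1_A.
Hypothesis Plin : forall (a : R) f g, bounded_measurable f ->
  bounded_measurable g -> P f -> P g -> P (fun x => a * f x + g x).
Hypothesis Plim : forall (f_ : nat -> T -> R) f (M : R),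
  (forall n, measurable_fun setT (f_ n)) -> (forall n x, `|f_ n x| <= M) ->
  (forall n, P (f_ n)) -> (forall x, f_ n x @[n --> \oo] --> f x) -> P f.

Let P0 : P (fun=> 0).
Proof.
have -> : (fun=> 0) = (fun x : T => (-1) * 1 + 1) :> (T -> R).
  by apply/funext => x; rewrite mulN1r addNr.
by apply: (@Plin (-1) (fun=> 1) (fun=> 1)) => //; exact: bounded_measurable_cst.
Qed.

Let Psum n (c : nat -> R) (f_ : nat -> T -> R) :
  (forall i, (i < n)%N -> bounded_measurable (f_ i)) ->
  (forall i, (i < n)%N -> P (f_ i)) ->
  bounded_measurable (fun x => \sum_(i < n) c i * f_ i x) /\
  P (fun x => \sum_(i < n) c i * f_ i x).
Proof.
elim: n => [|n IH] bf Pf.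
  under eq_fun do rewrite big_ord0.
  by split => //; exact: bounded_measurable_cst.
have [b1 p1] := IH (fun i h => bf i (ltnW h)) (fun i h => Pf i (ltnW h)).
under eq_fun do rewrite big_ord_recr/= addrC.
split; first by apply: bounded_measurable_lin => //; exact: bf.
by apply: Plin => //; [exact: bf | exact: Pf].
Qed.

Let Pindic A : measurable A -> P \1_A.
Proof.
rewrite GE; move: A.
apply: (dynkin_induction GE GI) => [|A GA|A mA PA|F mF tF PF].
- by rewrite indicT.
- exact: PG.
- have -> : \1_(~` A) = (fun x : T => (-1) * \1_A x + 1) :> (T -> R).
    apply/funext => x; rewrite !indicE in_setC mulN1r.
    by case: (_ \in _); rewrite /= ?addNr// oppr0 add0r.
  apply: (@Plin (-1) \1_A (fun=> 1)) => //; first exact: bounded_measurable_indic.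
  exact: bounded_measurable_cst.
- have ps n := @Psum n (fun=> 1) (fun i => \1_(F i))
    (fun i _ => bounded_measurable_indic (mF i)) (fun i _ => PF i).
  have sE n : (fun x => \sum_(i < n) 1 * (\1_(F i) x : R)) =
      \1_(\big[setU/set0]_(i < n) F i).
    apply/funext => x; elim: n {ps} => [|n IH].
      by rewrite !big_ord0 indicE in_set0.
    rewrite !big_ord_recr/= IH mul1r !indicE in_setU.
    have [xn|_] := boolP (x \in F n); last by rewrite orbF addr0.
    suff -> : (x \in \big[setU/set0]_(i < n) F i) = false by rewrite add0r.
    apply/negbTE; apply/negP; rewrite inE -bigcup_mkord => -[i/= ni Fix].
    move: xn; rewrite inE => Fnx.
    have /trivIsetP/(_ i n I I) := tF; rewrite (ltn_eqF ni) => /(_ isT) /seteqP[+ _].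
    by move=> /(_ x (conj Fix Fnx)).
  apply: (@Plim (fun n => \1_(\big[setU/set0]_(i < n) F i)) _ 1).
  + by move=> n; apply: measurable_indic; exact: bigsetU_measurable.
  + by move=> n x; rewrite indicE; case: (_ \in _); rewrite /= ?normr0 ?normr1.
  + by move=> n; rewrite -sE; exact: (ps n).2.
  + move=> x; apply: cvg_near_cst.
    have [[k _ Fkx]|nFx] := pselect ((\bigcup_k F k) x).
      exists k.+1 => // n/= kn; rewrite !indicE !mem_set//; first by exists k.
      by rewrite -bigcup_mkord; exists k.
    apply: nearW => n; rewrite !indicE !memNset//.
    by rewrite -bigcup_mkord => -[i _ Fix]; apply: nFx; exists i.
Qed.

(** A functional monotone class theorem: bounded measurable functions are
    uniformly bounded pointwise limits of simple functions, and the indicators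
    of measurable sets are reached from those of a pi-system by Dynkin's
    theorem.  Every identity between integrals below is obtained by checking it
    on indicators of simple sets. *)
Lemma bounded_measurable_ind f : bounded_measurable f -> P f.
Proof.
move=> [mf [M fM]].
pose g x := M + f x.
have g0 x : 0 <= g x.
  by rewrite /g -lerBlDl sub0r; have := fM x; rewrite ler_norml => /andP[].
have gM x : g x <= M + M.
  by rewrite lerD2l; have := fM x; rewrite ler_norml => /andP[].
have mg : measurable_fun setT (EFin \o g).
  by apply/measurable_EFinP; exact: measurable_funD.
have bg : bounded_measurable g.
  by split; [exact/measurable_EFinP | exists (M + M) => x; rewrite ger0_norm].
pose h := nnsfun_approx measurableT mg.
suff Pg : P g.
  have -> : f = (fun x => (- M) * 1 + g x).
    by apply/funext => x; rewrite /g mulr1 addKr.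
  by apply: (@Plin (- M) (fun=> 1) g) => //; exact: bounded_measurable_cst.
have hg n x : h n x <= g x.
  rewrite -lee_fin /h nnsfun_approxE.
  by apply: (@le_approx _ _ _ setT (EFin \o g)) => // y _; rewrite lee_fin.
apply: (@Plim (fun n => h n) _ (M + M)) => //.
- by move=> n x; rewrite ger0_norm ?fun_ge0// (le_trans (hg n x)).
- move=> n; set s := fset_set (range (h n)).
  have -> : (h n : T -> R) =
      (fun x => \sum_(i < #|`s|) s`_i * \1_(h n @^-1` [set s`_i]) x).
    by apply/funext => x; rewrite [LHS]fimfunEord.
  have [i _|i _|_ Ps] :=
    @Psum #|`s| (fun i => s`_i) (fun i => \1_(h n @^-1` [set s`_i])).
  + exact: bounded_measurable_indic.
  + exact: Pindic.
  + exact: Ps.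
- move=> x.
  have g0' y : setT y -> (0 <= (EFin \o g) y)%E by rewrite lee_fin.
  exact: fine_cvg (cvg_nnsfun_approx measurableT mg g0' I).
Qed.

End induction.

End bounded_measurable.

(** * Integration of bounded real functions against a complex measure *)

Lemma complex_cvg_unique (R : realType) (u : nat -> R[i]) (a b : R[i]) :
  (u : nat -> R[i]^o) @ \oo --> (a : R[i]^o) ->
  (u : nat -> R[i]^o) @ \oo --> (b : R[i]^o) -> a = b.
Proof.
by move=> ua ub; apply: (@cvg_unique R[i]^o _ _ _ _ _ ua ub); exact: norm_hausdorff.
Qed.

Section integral_finite_measure.
Context d (T : measurableType d) (R : realType).
Variable m : {finite_measure set T -> \bar R}.
Implicit Types f g : T -> R.

Lemma bounded_Rintegral_lin (a : R) f g :
  bounded_measurable f -> bounded_measurable g ->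
  \int[m]_x (a * f x + g x) = a * \int[m]_x f x + \int[m]_x g x.
Proof.
move=> bf bg; rewrite RintegralD//; last 2 first.
- apply: bounded_measurable_integrable.
  have := bounded_measurable_lin a bf (@bounded_measurable_cst _ T R 0).
  by under eq_fun do rewrite addr0.
- exact: bounded_measurable_integrable.
by rewrite RintegralZl//; exact: bounded_measurable_integrable.
Qed.

Lemma bounded_Rintegral_cvg (f_ : nat -> T -> R) f (M : R) :
  (forall n, measurable_fun setT (f_ n)) -> (forall n x, `|f_ n x| <= M) ->
  (forall x, f_ n x @[n --> \oo] --> f x) ->
  \int[m]_x f_ n x @[n --> \oo] --> \int[m]_x f x.
Proof.
move=> mf fM ff.
have mlim : measurable_fun setT f.
  by apply: (@measurable_fun_cvg _ _ _ _ f_) => // x _; exact: ff.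
have iM : m.-integrable setT (EFin \o (fun=> M)).
  by apply: bounded_measurable_integrable; exact: bounded_measurable_cst.
have bf : bounded_measurable f.
  split => //; exists M => x.
  have /cvg_norm nf := ff x.
  rewrite -(cvg_lim _ nf)//; apply: limr_le; first exact: cvgP nf.
  by apply: nearW => n; exact: fM.
apply: fine_cvg; rewrite fineK; last first.
  by apply: integrable_fin_num => //; exact: bounded_measurable_integrable.
apply: (@dominated_cvg _ _ _ m setT _ (fun n x => (f_ n x)%:E) _ (EFin \o (fun=> M))) => //.
- by move=> n; exact/measurable_EFinP.
- by move=> x _; apply: cvg_EFin; [exact: nearW | exact: ff].
- by move=> n x _; rewrite lee_fin.
Qed.

End integral_finite_measure.

Section integral_complex_measure.
Context d (T : measurableType d) (R : realType).
Implicit Types f g : T -> R.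

(** The difference of the integrals against the two Jordan parts.  Real
    integrands suffice throughout: Gaussian weights, test functions and
    indicators are all real. *)
Definition charge_integral (nu : {charge set T -> \bar R}) f : R :=
  \int[charge_pos nu]_x f x - \int[charge_neg nu]_x f x.

Lemma charge_integral_lin nu (a : R) f g :
  bounded_measurable f -> bounded_measurable g ->
  charge_integral nu (fun x => a * f x + g x) =
  a * charge_integral nu f + charge_integral nu g.
Proof.
by move=> bf bg; rewrite /charge_integral !bounded_Rintegral_lin//; ring.
Qed.

Lemma charge_integral_indic nu A : measurable A ->
  charge_integral nu \1_A = fine (nu A).
Proof.
move=> mA; rewrite /charge_integral charge_posneg//.
rewrite /Rintegral !integral_indic// !setIT fineB//; exact: fin_num_measure.
Qed.

Lemma charge_integral_cvg nu (f_ : nat -> T -> R) f (M : R) :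
  (forall n, measurable_fun setT (f_ n)) -> (forall n x, `|f_ n x| <= M) ->
  (forall x, f_ n x @[n --> \oo] --> f x) ->
  charge_integral nu (f_ n) @[n --> \oo] --> charge_integral nu f.
Proof.
by move=> mf fM ff; apply: cvgB; apply: bounded_Rintegral_cvg ff => //; exact: fM.
Qed.

Variable m : {complex_measure set T -> R[i]}.

Definition cint f : R[i] :=
  charge_integral (charge_Re m) f +i* charge_integral (charge_Im m) f.

Lemma cint_lin (a : R) f g :
  bounded_measurable f -> bounded_measurable g ->
  cint (fun x => a * f x + g x) = a%:C * cint f + cint g.
Proof.
move=> bf bg; rewrite /cint !charge_integral_lin//.
by apply/eqP; rewrite eq_complex/=; apply/andP; split; apply/eqP; ring.
Qed.

Lemma cint_indic A : measurable A -> cint \1_A = m A.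
Proof.
move=> mA; rewrite /cint !charge_integral_indic// /charge_Re /charge_Im/=.
by case: (m A).
Qed.

Lemma cint_cst1 : cint (fun=> 1) = m setT.
Proof. by rewrite -cint_indic// indicT. Qed.

Lemma cint_cvg (f_ : nat -> T -> R) f (M : R) :
  (forall n, measurable_fun setT (f_ n)) -> (forall n x, `|f_ n x| <= M) ->
  (forall x, f_ n x @[n --> \oo] --> f x) ->
  (fun n => cint (f_ n) : R[i]^o) @ \oo --> (cint f : R[i]^o).
Proof.
by move=> mf fM ff; apply: cvg_complex; apply: charge_integral_cvg ff => //; exact: fM.
Qed.

End integral_complex_measure.

Section uniqueness.
Context d (T : measurableType d) (R : realType).
Implicit Types (m : {complex_measure set T -> R[i]}).

(** Complex measures agreeing on a generating pi-system integrate alike.  Going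
    through integrals rather than sets lets the monotone class theorem for
    functions replace a separate Dynkin argument for complex measures. *)
Lemma cint_unique (G : set (set T)) m m' :
  @measurable _ T = <<s G >> -> setI_closed G ->
  (forall A, G A -> m A = m' A) -> m setT = m' setT ->
  forall f, bounded_measurable f -> cint m f = cint m' f.
Proof.
move=> GE GI mG mT f bf; pattern f.
apply: (bounded_measurable_ind GE GI _ _ _ _ bf).
- by rewrite !cint_cst1.
- move=> A GA; rewrite !cint_indic ?mG//; rewrite GE; exact: sub_gen_smallest.
- by move=> a g h bg bh g1 h1; rewrite !cint_lin// g1 h1.
- move=> f_ g M mf fM ff fg; apply: (@complex_cvg_unique _ (fun n => cint m (f_ n))).
    by apply: cint_cvg fg => //; exact: fM.
  under eq_fun do rewrite ff.
  by apply: cint_cvg fg => //; exact: fM.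
Qed.

Lemma complex_measure_unique (G : set (set T)) m m' :
  @measurable _ T = <<s G >> -> setI_closed G ->
  (forall A, G A -> m A = m' A) -> m setT = m' setT -> eq_on_measurable m m'.
Proof.
move=> GE GI mG mT A mA; rewrite -!cint_indic//.
by apply: cint_unique GE GI mG mT _ _; exact: bounded_measurable_indic.
Qed.

End uniqueness.

Lemma bounded_measurable_comp d1 d2 (T1 : measurableType d1)
    (T2 : measurableType d2) (R : realType) (phi : T1 -> T2) (f : T2 -> R) :
  measurable_fun setT phi -> bounded_measurable f -> bounded_measurable (f \o phi).
Proof.
by move=> mphi [mf [M fM]]; split; [exact: measurableT_comp | exists M => x; exact: fM].
Qed.

Section image_and_product.
Context d1 d2 (T1 : measurableType d1) (T2 : measurableType d2) (R : realType).

Lemma cint_cpushforward (m : {complex_measure set T1 -> R[i]})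
    (n : {complex_measure set T2 -> R[i]}) (phi : T1 -> T2) :
  measurable_fun setT phi -> eq_on_measurable (cpushforward m phi) n ->
  forall f, bounded_measurable f -> cint n f = cint m (f \o phi).
Proof.
move=> mphi mn f bf; pattern f.
apply: (@bounded_measurable_ind _ _ _ measurable _ _ _ _ _ _ _ _ bf).
- by rewrite sigma_algebra_id//; exact: sigma_algebra_measurable.
- exact: measurableI.
- by rewrite cint_cst1 -mn// /cpushforward preimage_setT -cint_cst1.
- move=> A mA; rewrite cint_indic// -mn// /cpushforward -cint_indic//.
  by rewrite -[X in measurable X]setTI; exact: mphi.
- move=> a g h bg bh g1 h1; rewrite cint_lin// g1 h1 -cint_lin//;
    exact: bounded_measurable_comp.
- move=> f_ g M mf fM ff fg; apply: (@complex_cvg_unique _ (fun n0 => cint n (f_ n0))).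
    by apply: cint_cvg fg => //; exact: fM.
  under eq_fun do rewrite ff.
  apply: (@cint_cvg _ _ _ _ _ _ M).
  + by move=> k; exact: measurableT_comp.
  + by move=> k x; exact: fM.
  + by move=> x; exact: fg.
Qed.

(** Fubini for product integrands, by the monotone class theorem in each variable
    in turn: the product measure is only known through its values on
    rectangles, which are the integrals of products of indicators. *)
Lemma cint_product (m1 : {complex_measure set T1 -> R[i]})
    (m2 : {complex_measure set T2 -> R[i]}) (f : T1 -> R) (g : T2 -> R) :
  bounded_measurable f -> bounded_measurable g ->
  cint (m1 \xC m2) (fun p => f p.1 * g p.2) = cint m1 f * cint m2 g.
Proof.
have b1 (h : T1 -> R) : bounded_measurable h ->
    bounded_measurable (fun p : T1 * T2 => h p.1).
  by move=> bh; apply: (@bounded_measurable_comp _ _ _ _ _ fst h).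
have b2 (h : T2 -> R) : bounded_measurable h ->
    bounded_measurable (fun p : T1 * T2 => h p.2).
  by move=> bh; apply: (@bounded_measurable_comp _ _ _ _ _ snd h).
have gT : @measurable _ T1 = <<s measurable >>.
  by rewrite sigma_algebra_id//; exact: sigma_algebra_measurable.
have gT' : @measurable _ T2 = <<s measurable >>.
  by rewrite sigma_algebra_id//; exact: sigma_algebra_measurable.
have step1 A : measurable A -> forall g, bounded_measurable g ->
    cint (m1 \xC m2) (fun p => \1_A p.1 * g p.2) = m1 A * cint m2 g.
  move=> mA {f}{}g bg.
  have bA := b1 _ (bounded_measurable_indic R mA).
  have indic B : measurable B ->
      cint (m1 \xC m2) (fun p => \1_A p.1 * \1_B p.2) = m1 A * cint m2 \1_B.
    move=> mB; rewrite cint_indic// -product_cmeasureE//.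
    rewrite -cint_indic; last exact: measurableX.
    by congr cint; apply/funext => -[x y]; rewrite /= !indicE in_setX -natrM mulnb.
  pattern g; apply: (bounded_measurable_ind gT' _ _ _ _ _ bg).
  - exact: measurableI.
  - by have := indic setT measurableT; rewrite indicT.
  - exact: indic.
  - move=> a h k bh bk hE kE; rewrite cint_lin//.
    have -> : (fun p : T1 * T2 => \1_A p.1 * (a * h p.2 + k p.2)) =
        (fun p => a * (\1_A p.1 * h p.2) + \1_A p.1 * k p.2).
      by apply/funext => p; ring.
    by rewrite cint_lin ?hE ?kE//; [ring | | ];
      apply: bounded_measurableM => //; exact: b2.
  - move=> h k M mh hM hE hk.
    apply: (@complex_cvg_unique _
      (fun n => cint (m1 \xC m2) (fun p => \1_A p.1 * h n p.2))).
      apply: (@cint_cvg _ _ _ _ _ _ M).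
      + by move=> n; apply: measurable_funM; [exact: bA.1 | exact: measurableT_comp].
      + move=> n x; rewrite normrM indicE.
        by case: (_ \in _); rewrite /= ?normr1 ?mul1r ?normr0 ?mul0r// (le_trans _ (hM n x.2)).
      + by move=> x; apply: cvgMr.
    under eq_fun do rewrite hE.
    apply: cvgMr; apply: cint_cvg hk => //; exact: hM.
move=> bf bg; pattern f; apply: (bounded_measurable_ind gT _ _ _ _ _ bf).
- exact: measurableI.
- by rewrite cint_cst1 -step1//; congr cint; apply/funext => p; rewrite indicT.
- by move=> A mA; rewrite cint_indic// step1.
- move=> a h k bh bk hE kE; rewrite cint_lin//.
  have -> : (fun p : T1 * T2 => (a * h p.1 + k p.1) * g p.2) =
      (fun p => a * (h p.1 * g p.2) + k p.1 * g p.2).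
    by apply/funext => p; ring.
  have := b2 _ bg => b2g.
  by rewrite cint_lin ?hE ?kE//; [ring | |];
    apply: bounded_measurableM => //; exact: b1.
- move=> h k M mh hM hE hk; have [mg [N gN]] := bg.
  apply: (@complex_cvg_unique _
    (fun n => cint (m1 \xC m2) (fun p => h n p.1 * g p.2))).
    apply: (@cint_cvg _ _ _ _ _ _ (M * N)).
    + move=> n; apply: measurable_funM.
        exact: (measurableT_comp (mh n) measurable_fst).
      exact: (measurableT_comp mg measurable_snd).
    + by move=> n x; rewrite normrM ler_pM.
    + by move=> x; apply: cvgMl; exact: hk.
  under eq_fun do rewrite hE.
  by apply: cvgMl; apply: cint_cvg hk => //; exact: hM.
Qed.

End image_and_product.

(** * Affine changes of variable *)

Section affine_change_of_variable.
Context (R : realType).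
Local Notation RR := (measurableTypeR R).
Local Notation leb := (@lebesgue_measure R).

Lemma measurable_affine (a c : R) :
  measurable_fun setT ((fun x : R => a + c * x) : RR -> RR).
Proof. by apply: measurable_funD => //; exact: measurable_funM. Qed.

(** The image of Lebesgue measure, multiplied by [|c|], gives half-open intervals
    their length; uniqueness of Lebesgue measure does the rest. *)
Lemma lebesgue_measure_affine (a c : R) : c != 0 -> forall A : set RR,
  measurable A ->
  leb ((fun x : R => a + c * x) @^-1` A) = (`|c|^-1%:E * leb A)%E.
Proof.
move=> c0 A mA; have cp : 0 < `|c| by rewrite normr_gt0.
have cn : 0 <= `|c| by [].
pose nu_ : {measure set RR -> \bar R} :=
  mscale (NngNum cn) (pushforward leb ((fun x : R => a + c * x) : RR -> RR)).
pose nu := nu_ (measurable_affine a c).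
suff -> : leb A = nu A.
  rewrite /nu /nu_ /mscale/= /pushforward muleA -EFinM mulVf ?mul1e//.
  by rewrite gt_eqF.
apply: lebesgue_measure_unique => //= _ [[u v]] _ <-.
rewrite /mscale/= /pushforward.
have [c_gt0|c_lt0|/eqP] := ltrgtP 0 c; last by rewrite eq_sym (negbTE c0).
  have -> : (fun x : R => a + c * x) @^-1` `]u, v] = `](u - a) / c, (v - a) / c]%classic.
    apply/seteqP; split => x; rewrite /= !in_itv/= ltr_pdivrMr// ler_pdivlMr//;
    by rewrite ltrBlDl lerBrDl mulrC.
  rewrite !lebesgue_measure_itv/= !lte_fin ltr_pM2r ?invr_gt0// ltrD2r.
  case: ifPn => _; last by rewrite mule0.
  rewrite -!EFinB -EFinM gtr0_norm//; congr EFin; field.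
  by rewrite gt_eqF.
have -> : (fun x : R => a + c * x) @^-1` `]u, v] = `[(v - a) / c, (u - a) / c[%classic.
  apply/seteqP; split => x; rewrite /= !in_itv/= ltr_ndivlMr// ler_ndivrMr//;
  by rewrite ltrBlDl lerBrDl mulrC andbC.
rewrite !lebesgue_measure_itv/= !lte_fin ltr_nM2r ?invr_lt0// ltrD2r.
case: ifPn => _; last by rewrite mule0.
rewrite -!EFinB -EFinM ltr0_norm//; congr EFin; field.
by rewrite lt_eqF.
Qed.

Lemma ge0_integral_affine (a c : R) (f : RR -> \bar R) : c != 0 ->
  measurable_fun setT f -> (forall x, 0 <= f x)%E ->
  (\int[leb]_x f (a + c * x)%R = `|c|^-1%:E * \int[leb]_x f x)%E.
Proof.
move=> c0 mf f0; have cn : 0 <= `|c|^-1 by rewrite invr_ge0.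
have := @ge0_integral_pushforward _ _ _ _ R _ (measurable_affine a c) leb setT f
  measurableT mf (fun y _ => f0 y).
rewrite preimage_setT => <-.
rewrite (@eq_measure_integral _ _ _ _ (mscale (NngNum cn) leb)).
  by rewrite ge0_integral_mscale.
  exact: measurable_affine.
by move=> ? A mA _; rewrite /= /pushforward /mscale/= lebesgue_measure_affine.
Qed.

Lemma integral_affine (a c : R) (f : RR -> R) : c != 0 ->
  leb.-integrable setT (EFin \o f) ->
  \int[leb]_x f (a + c * x) = `|c|^-1 * \int[leb]_x f x.
Proof.
move=> c0 intf; have cV : `|c|^-1 != 0 by rewrite invr_neq0// normr_eq0.
rewrite /Rintegral integralE [in RHS]integralE.
have mf' : measurable_fun setT (EFin \o f) := measurable_int _ intf.
under eq_integral do rewrite -/((EFin \o f) _).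
have -> : (\int[leb]_x ((fun x0 : R => (f (a + c * x0))%:E)^\+ x) =
    `|c|^-1%:E * \int[leb]_x ((fun x0 => (f x0)%:E)^\+ x))%E.
  rewrite -(@ge0_integral_affine a c)//; last exact: measurable_funepos.
  by apply: eq_integral => x _; rewrite
    -[in LHS]/((EFin \o f) \o (fun x => a + c * x)) funepos_comp.
have -> : (\int[leb]_x ((fun x0 : R => (f (a + c * x0))%:E)^\- x) =
    `|c|^-1%:E * \int[leb]_x ((fun x0 => (f x0)%:E)^\- x))%E.
  rewrite -(@ge0_integral_affine a c)//; last exact: measurable_funeneg.
  by apply: eq_integral => x _; rewrite
    -[in LHS]/((EFin \o f) \o (fun x => a + c * x)) funeneg_comp.
have ifp := integrable_fin_num measurableT (integrable_funepos measurableT intf).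
have ifn := integrable_fin_num measurableT (integrable_funeneg measurableT intf).
by rewrite -(fineK ifp) -(fineK ifn) -!EFinM -!EFinB /= mulrBr.
Qed.

End affine_change_of_variable.

(** * Regularity of Gaussian averages *)

Section pointwise_derivatives.
Context (R : realType).
Implicit Types (f g : R -> R) (x a b c : R).
Local Notation is_der x f a := (is_derive x (1 : R) (f : R -> R) a).

Lemma is_derive1_eq x f a b : is_der x f a -> a = b -> is_der x f b.
Proof. by move=> fa <-. Qed.

Lemma is_derive1_cst x c : is_der x (fun=> c) 0.
Proof. exact: is_derive_cst. Qed.

Lemma is_derive1_id x : is_der x (fun t => t) 1.
Proof. exact: is_derive_id. Qed.

Lemma is_derive1D x f g a b : is_der x f a -> is_der x g b ->
  is_der x (fun t => f t + g t) (a + b).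
Proof. by move=> fa gb; exact: (@is_deriveD _ _ _ f g). Qed.

Lemma is_derive1B x f g a b : is_der x f a -> is_der x g b ->
  is_der x (fun t => f t - g t) (a - b).
Proof. by move=> fa gb; exact: (@is_deriveB _ _ _ f g). Qed.

Lemma is_derive1M x f g a b : is_der x f a -> is_der x g b ->
  is_der x (fun t => f t * g t) (a * g x + f x * b).
Proof.
move=> fa gb; apply: is_derive1_eq (@is_deriveM _ _ f g _ _ _ _ fa gb) _.
by rewrite /GRing.scale/= addrC mulrC.
Qed.

Lemma is_derive1_comp' x (h : R -> R) f a b : is_der x f b -> is_der (f x) h a ->
  is_der x (fun t => h (f t)) (a * b).
Proof. by move=> fb ha; exact: is_derive1_comp ha fb. Qed.

Lemma is_derive1V x f a : f x != 0 -> is_der x f a ->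
  is_der x (fun t => (f t)^-1) (- a / f x ^+ 2).
Proof.
move=> f0 fa; apply: is_derive1_eq (is_deriveV f0 fa) _.
by rewrite /GRing.scale/= mulNr mulrC mulNr.
Qed.

Lemma is_derive1_expR x f a : is_der x f a ->
  is_der x (fun t => expR (f t)) (expR (f x) * a).
Proof. by move=> fa; exact: (is_derive1_comp' fa (is_derive_expR (f x))). Qed.

Lemma is_derive1N x f a : is_der x f a -> is_der x (fun t => - f t) (- a).
Proof. by move=> fa; exact: (@is_deriveN _ _ _ f). Qed.

Lemma is_derive1_continuous f (f' : R -> R) :
  (forall x, is_der x f (f' x)) -> continuous f.
Proof.
move=> df x; apply: differentiable_continuous; apply/derivable1_diffP.
by case: (df x).
Qed.

End pointwise_derivatives.

Section translates.
Context (R : realType).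
Local Notation RR := (measurableTypeR R).
Implicit Types (g : R -> R).

Lemma bounded_measurable_translate g (M z : R) : continuous g ->
  (forall x, `|g x| <= M) ->
  bounded_measurable ((fun y => g (z - y)) : RR -> R).
Proof.
move=> cg gM; split; last by exists M.
have mg : measurable_fun setT (g : RR -> R) := continuous_measurable_fun cg.
have mz : measurable_fun setT ((fun y : R => z - y) : RR -> RR) by exact: measurable_funB.
exact: (measurableT_comp mg mz).
Qed.

Lemma is_derive_translate g (g' : R -> R) (y z : R) :
  (forall x : R, is_derive x (1 : R) g (g' x)) ->
  is_derive z (1 : R) (fun x : R => g (x - y)) (g' (z - y)).
Proof.
move=> dg.
have dt := is_derive1B (is_derive1_id z) (is_derive1_cst z y).
by apply: is_derive1_eq (is_derive1_comp' dt (dg (z - y))) _; rewrite subr0 mulr1.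
Qed.

Section finite.
Variable m : {finite_measure set RR -> \bar R}.

(** Differentiation under the integral sign: the constants [M] and [M'] are
    integrable because the measure is finite. *)
Lemma is_derive_Rintegral_translate g (g' : R -> R) (M M' : R) :
  (forall x : R, is_derive x (1 : R) g (g' x)) ->
  (forall x, `|g x| <= M) -> (forall x, `|g' x| <= M') ->
  forall z, is_derive z (1 : R) (fun z : R => \int[m]_y g (z - y)) (\int[m]_y g' (z - y)).
Proof.
move=> dg gM g'M z.
have cg := is_derive1_continuous dg.
have intf x : (`]z - 1, z + 1[%classic : set R) x ->
    m.-integrable setT (EFin \o (fun y : RR => g (x - y))).
  by move=> _; apply: bounded_measurable_integrable; exact: bounded_measurable_translate gM.
have Iz : (`]z - 1, z + 1[%classic : set R) z.
  by rewrite /= in_itv/=; apply/andP; split; lra.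
have der (x : R) (y : RR) : is_derive x (1 : R) ((fun x y : R => g (x - y)) ^~ y) (g' (x - y)).
  exact: is_derive_translate.
have derf x (y : RR) : (`]z - 1, z + 1[%classic : set R) x -> setT y ->
    derivable ((fun x y : R => g (x - y)) ^~ y) x 1.
  by move=> _ _; case: (der x y).
have intG : m.-integrable setT (EFin \o (fun=> M')).
  by apply: bounded_measurable_integrable; exact: bounded_measurable_cst.
have G0 (y : RR) : 0 <= M' by apply: le_trans (g'M 0).
have d1E x (y : RR) : partial1of2 (fun x y : R => g (x - y)) x y = g' (x - y).
  by rewrite partial1of2E; case: (der x y).
have Gub x (y : RR) : (`]z - 1, z + 1[%classic : set R) x -> setT y ->
    `|partial1of2 (fun x y : R => g (x - y)) x y| <= M'.
  by move=> _ _; rewrite d1E.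
split.
  exact: (@derivable_under_integral _ _ _ m (fun x (y : RR) => g (x - y)) _
    measurableT _ _ _ Iz intf derf _ G0 intG Gub).
rewrite -derive1E.
rewrite (@differentiation_under_integral _ _ _ m (fun x (y : RR) => g (x - y)) _
    measurableT _ _ _ Iz intf derf _ G0 intG Gub).
by apply: eq_Rintegral => y _; exact: d1E.
Qed.

End finite.

Lemma is_derive_charge_integral_translate (nu : {charge set RR -> \bar R})
    g (g' : R -> R) (M M' : R) :
  (forall x : R, is_derive x (1 : R) g (g' x)) ->
  (forall x, `|g x| <= M) -> (forall x, `|g' x| <= M') ->
  forall z, is_derive z (1 : R) (fun z : R => charge_integral nu (fun y => g (z - y)))
    (charge_integral nu (fun y => g' (z - y))).
Proof.
by move=> dg gM g'M z; apply: is_deriveB;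
  exact: is_derive_Rintegral_translate dg gM g'M z.
Qed.

End translates.

Section gaussian.
Context (R : realType).
Local Notation RR := (measurableTypeR R).
Variable s : R.
Hypothesis s_gt0 : 0 < s.

Definition gauss (x : R) := expR (- (s * x ^+ 2)).
Definition dgauss (x : R) := - (2 * s) * x * gauss x.
Definition ddgauss (x : R) := ((2 * s * x) ^+ 2 - 2 * s) * gauss x.

Lemma gauss_gt0 x : 0 < gauss x. Proof. exact: expR_gt0. Qed.

Lemma gauss_le1 x : gauss x <= 1.
Proof. by rewrite /gauss -expR0 ler_expR oppr_le0 mulr_ge0 ?sqr_ge0// ltW. Qed.

Lemma norm_gauss x : `|gauss x| <= 1.
Proof. by rewrite gtr0_norm ?gauss_gt0// gauss_le1. Qed.

Lemma sqr_gauss_le x : s * x ^+ 2 * gauss x <= 1.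
Proof.
rewrite /gauss expRN ler_pdivrMr ?expR_gt0// mul1r.
by apply: le_trans (expR_ge1Dx _); rewrite lerDr.
Qed.

Let is_derive_sqr (x : R) : is_derive x (1 : R) (fun t : R => t ^+ 2) (2 * x).
Proof.
apply: is_derive1_eq (is_derive1M (is_derive1_id x) (is_derive1_id x)) _.
by rewrite mul1r mulr1 mulr2n mulrDl mul1r.
Qed.

Lemma is_derive_gauss (x : R) : is_derive x (1 : R) gauss (dgauss x).
Proof.
have d2 := is_derive1M (is_derive1_cst x s) (is_derive_sqr x).
apply: is_derive1_eq (is_derive1_expR (is_derive1N d2)) _.
by rewrite /dgauss /gauss; ring.
Qed.

Lemma is_derive_dgauss (x : R) : is_derive x (1 : R) dgauss (ddgauss x).
Proof.
have d1 := is_derive1M (is_derive1_cst x (- (2 * s))) (is_derive1_id x).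
apply: is_derive1_eq (is_derive1M d1 (is_derive_gauss x)) _.
by rewrite /ddgauss /dgauss; ring.
Qed.

Lemma norm_dgauss x : `|dgauss x| <= s + 1.
Proof.
have s2 : 0 < 2 * s by rewrite mulr_gt0.
rewrite /dgauss !normrM (gtr0_norm (gauss_gt0 x)) normrN (gtr0_norm s2).
have h := sqr_gauss_le x; have g1 := gauss_le1 x; have g0 := gauss_gt0 x.
have x2 : 2 * `|x| <= 1 + x ^+ 2.
  by rewrite -subr_ge0 -(real_normK (num_real x)); have := sqr_ge0 (1 - `|x|); nra.
have sg0 : 0 <= s * gauss x by rewrite mulr_ge0// ltW.
have := ler_wpM2l sg0 x2; have := ler_wpM2l (ltW s_gt0) g1.
by rewrite mulr1; lra.
Qed.

Lemma norm_ddgauss x : `|ddgauss x| <= 6 * s.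
Proof.
have h := sqr_gauss_le x; have g1 := gauss_le1 x; have g0 := gauss_gt0 x.
have h0 : 0 <= s * x ^+ 2 * gauss x := mulr_ge0 (mulr_ge0 (ltW s_gt0) (sqr_ge0 x)) (ltW g0).
have -> : ddgauss x = 4 * s * (s * x ^+ 2 * gauss x) - 2 * s * gauss x.
  by rewrite /ddgauss; ring.
have := ler_wpM2l (ltW s_gt0) h; have := ler_wpM2l (ltW s_gt0) g1.
have := mulr_ge0 (ltW s_gt0) (ltW g0); have := mulr_ge0 (ltW s_gt0) h0.
by rewrite !mulr1 => ? ? ? ?; rewrite ler_norml; apply/andP; split; lra.
Qed.

End gaussian.

(** * Gaussian averages converge weakly *)

Section weak_convergence.
Context (R : realType).
Local Notation RR := (measurableTypeR R).
Local Notation leb := (@lebesgue_measure R).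
Implicit Types (phi : R -> R).

Definition compactly_supported phi := exists N : R, forall x, N < `|x| -> phi x = 0.

Lemma compactly_supported_bounded phi : continuous phi ->
  compactly_supported phi -> exists M, forall x, `|phi x| <= M.
Proof.
move=> cphi [N phiN].
have /compact_bounded[M [_ hM]] : compact (phi @` `[- N, N]).
  apply: continuous_compact; last exact: segment_compact.
  exact: continuous_subspaceT.
exists (Num.max M 0 + 1) => x; have [xN|Nx] := leP `|x| N; last first.
  by rewrite phiN// normr0 addr_ge0// le_max lexx orbT.
apply: hM; first by rewrite ltr_pwDr// le_max lexx.
by exists x => //=; rewrite in_itv/= -ler_norml.
Qed.

Lemma compactly_supported_integrable phi : continuous phi ->
  compactly_supported phi -> leb.-integrable setT (EFin \o phi).
Proof.
move=> cphi [N phiN].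
have -> : EFin \o phi = (EFin \o phi) \_ `[- N, N]%classic.
  apply/funext => x; rewrite patchE; case: ifPn => //.
  rewrite notin_setE /= in_itv/= -ler_norml => /negP; rewrite -ltNge => Nx.
  by rewrite phiN.
apply: (iffLR (integrable_mkcond _ _)) => //.
apply: (@continuous_compact_integrable R phi `[- N, N]%classic); first exact: segment_compact.
exact: continuous_subspaceT.
Qed.

Lemma compactly_supportedM phi (psi : R -> R) : compactly_supported phi ->
  compactly_supported (fun x => phi x * psi x).
Proof. by move=> [N h]; exists N => x /h ->; rewrite mul0r. Qed.

Lemma continuous_gauss (s : R) : continuous (gauss s).
Proof. exact: is_derive1_continuous (is_derive_gauss s). Qed.

Section finite.
Variable m : {finite_measure set RR -> \bar R}.

Section fubini.
Variables (s : R) (phi : R -> R).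
Hypotheses (s_gt0 : 0 < s) (cphi : continuous phi) (sphi : compactly_supported phi).

Let f (p : RR * RR) : R := phi p.1 * gauss s (p.1 - p.2).

Let mf : measurable_fun setT f.
Proof.
apply: measurable_funM.
  exact: (measurableT_comp (continuous_measurable_fun cphi) measurable_fst).
apply: (measurableT_comp (continuous_measurable_fun (@continuous_gauss s))).
by apply: measurable_funB.
Qed.

Let bounded_gauss_translate (z : R) :
  bounded_measurable ((fun y => gauss s (z - y)) : RR -> R).
Proof. exact: bounded_measurable_translate (@continuous_gauss s) (norm_gauss s_gt0). Qed.

Let gauss_translate_integrable (y : R) :
  leb.-integrable setT (EFin \o (fun z => phi z * gauss s (z - y))).
Proof.
apply: compactly_supported_integrable; last exact: compactly_supportedM.
move=> z; apply: cvgM; first exact: cphi.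
exact: is_derive1_continuous (fun z => is_derive_translate y z (is_derive_gauss s)) z.
Qed.

Let intf : (leb \x m)%E.-integrable setT (EFin \o f).
Proof.
apply/integrable12ltyP; first exact/measurable_EFinP.
have intphi := compactly_supported_integrable cphi sphi.
have := integrableZl measurableT (fine (m setT)) intphi.
case/integrableP => _; apply: le_lt_trans.
have mabs : measurable_fun setT (abse \o (EFin \o f)).
  by apply: measurableT_comp => //; exact/measurable_EFinP.
apply: ge0_le_integral => //.
- by move=> x _; apply: integral_ge0.
- by apply: (measurable_fun_fubini_tonelli_F (abse \o (EFin \o f))) => //= p; exact: abse_ge0.
- apply: measurableT_comp => //; apply: emeasurable_funM => //.
  exact: (measurable_int _ intphi).
move=> x _; apply: (@le_trans _ _ (\int[m]_(y in setT) `|phi x|%:E)%E).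
  apply: ge0_le_integral => //.
  - apply: measurableT_comp => //; apply/measurable_EFinP.
    rewrite /f/=; apply: measurable_funM; first exact: measurable_cst.
    exact: (bounded_gauss_translate x).1.
  - move=> y _; rewrite lee_fin normrM ler_piMr//; exact: norm_gauss.
rewrite integral_cst// -[X in (_ * X <= _)%E]fineK ?fin_num_measure//.
by rewrite -EFinM lee_fin normrM mulrC ler_wpM2r ?ler_norm.
Qed.

(** Exchanging the integrals moves the smoothing from the measure to the test
    function; compact support makes the integrand integrable on the plane. *)
Lemma Fubini_gauss :
  \int[leb]_z (phi z * \int[m]_y gauss s (z - y)) =
  \int[m]_y \int[leb]_z (phi z * gauss s (z - y)).
Proof.
have /(congr1 fine) := Fubini intf.
rewrite /Rintegral => h; apply: etrans (etrans h _); congr fine;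
  apply: eq_integral => x _.
- have bx := bounded_gauss_translate x.
  have ix : m.-integrable setT (EFin \o (fun y : RR => phi x * gauss s (x - y))).
    apply: bounded_measurable_integrable; apply: bounded_measurableM bx.
    exact: bounded_measurable_cst.
  rewrite -(fineK (integrable_fin_num measurableT ix)); congr EFin.
  by rewrite -[RHS]/(\int[m]_y (phi x * gauss s (x - y))) RintegralZl//;
    exact: bounded_measurable_integrable.
- by rewrite fineK// integrable_fin_num//; exact: gauss_translate_integrable.
Qed.

Lemma measurable_gauss_average :
  measurable_fun setT (fun y : RR => \int[leb]_z (phi z * gauss s (z - y))).
Proof.
apply/measurable_EFinP; rewrite (_ : _ \o _ = fubini_G leb (EFin \o f)).
  exact: measurable_fubini_G intf.
apply/funext => y; rewrite /= fineK//.
by apply: integrable_fin_num => //; exact: gauss_translate_integrable.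
Qed.

Lemma gauss_average_rescale (y : R) :
  Num.sqrt s * \int[leb]_z (phi z * gauss s (z - y)) =
  \int[leb]_w (phi (y + (Num.sqrt s)^-1 * w) * gauss_fun w).
Proof.
have q0 : 0 < Num.sqrt s by rewrite sqrtr_gt0.
have c0 : (Num.sqrt s)^-1 != 0 by rewrite invr_neq0// gt_eqF.
have int := gauss_translate_integrable y.
have := @integral_affine R y _ _ c0 int.
rewrite gtr0_norm ?invr_gt0// invrK => <-.
apply: eq_Rintegral => w _; congr (_ * _).
rewrite addrAC subrr add0r /gauss /gauss_fun exprMn exprVn sqr_sqrtr ?ltW//.
by rewrite mulrA divff ?gt_eqF// mul1r.
Qed.

End fubini.

(** After rescaling, the average of [phi] against the kernel centred at [y]
    integrates [phi (y + w / sqrt s)] against a fixed Gaussian, hence converges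
    to [sqrt pi * phi y] by dominated convergence. *)
Lemma cvg_gauss_average (phi : R -> R) (M y : R) : continuous phi ->
  (forall x, `|phi x| <= M) ->
  \int[leb]_w (phi (y + (Num.sqrt n.+1%:R)^-1 * w) * gauss_fun w) @[n --> \oo] -->
  phi y * Num.sqrt pi.
Proof.
move=> cphi phiM.
have gphi0 n : measurable_fun setT
    ((fun w : R => phi (y + (Num.sqrt n.+1%:R)^-1 * w) * gauss_fun w) : RR -> R).
  apply: measurable_funM; last exact: measurable_gauss_fun.
  exact: (measurableT_comp (continuous_measurable_fun cphi) (measurable_affine _ _)).
have -> : phi y * Num.sqrt pi = \int[leb]_w (phi y * gauss_fun w).
  rewrite RintegralZl//; last exact: integrableT_gauss.
  by rewrite /Rintegral integralT_gauss.
have cw (w : R) : phi (y + (Num.sqrt n.+1%:R)^-1 * w) * gauss_fun w @[n --> \oo] -->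
    phi y * gauss_fun w.
  apply: cvgM; last exact: cvg_cst.
  have h0 : (Num.sqrt n.+1%:R)^-1 @[n --> \oo] --> (0 : R).
    have -> : (fun n => (Num.sqrt n.+1%:R)^-1) = Num.sqrt \o (@harmonic R).
      by apply/funext => n /=; rewrite sqrtrV.
    rewrite -(@sqrtr0 R); apply: continuous_cvg; first exact: sqrt_continuous.
    exact: cvg_harmonic.
  have h1 : y + (Num.sqrt n.+1%:R)^-1 * w @[n --> \oo] --> y.
    rewrite -[X in _ --> X]addr0 -[X in _ + X](mul0r w).
    by apply: cvgD; [exact: cvg_cst | apply: cvgMl].
  exact: (continuous_cvg _ (cphi y) h1).
have intg : leb.-integrable setT (EFin \o (fun w => M * gauss_fun w)).
  by have := integrableZl measurableT M integrableT_gauss.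
apply: fine_cvg; rewrite fineK; last first.
  apply: integrable_fin_num => //.
  by have := integrableZl measurableT (phi y) integrableT_gauss.
apply: (@dominated_cvg _ _ _ leb setT _
    (fun n w => (phi (y + (Num.sqrt n.+1%:R)^-1 * w) * gauss_fun w)%:E) _
    (EFin \o (fun w => M * gauss_fun w))) => //.
- by move=> n; apply/measurable_EFinP; exact: gphi0.
- by move=> x _; apply: cvg_EFin; [exact: nearW | exact: cw].
- move=> n x _; rewrite lee_fin normrM (ger0_norm (gauss_fun_ge0 x)).
  by rewrite ler_wpM2r// gauss_fun_ge0.
Qed.

Lemma gauss_average_bound (phi : R -> R) (M y c : R) : continuous phi ->
  (forall x, `|phi x| <= M) ->
  `|\int[leb]_w (phi (y + c * w) * gauss_fun w)| <= M * Num.sqrt pi.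
Proof.
move=> cphi phiM.
have intg : leb.-integrable setT (EFin \o (fun w => M * gauss_fun w)).
  by have := integrableZl measurableT M integrableT_gauss.
have int : leb.-integrable setT (EFin \o (fun w => phi (y + c * w) * gauss_fun w)).
  apply: le_integrable intg => //.
    apply/measurable_EFinP; apply: measurable_funM; last exact: measurable_gauss_fun.
    exact: (measurableT_comp (continuous_measurable_fun cphi) (measurable_affine _ _)).
  move=> w _; rewrite lee_fin !normrM ler_wpM2r//.
  by rewrite (le_trans (phiM _))// ler_norm.
apply: (le_trans (le_normr_Rintegral _ int)) => //.
have -> : M * Num.sqrt pi = \int[leb]_w (M * gauss_fun w).
  rewrite RintegralZl//; last exact: integrableT_gauss.
  by rewrite /Rintegral integralT_gauss.
apply: le_Rintegral => //.
  by have := integrable_norm int.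
move=> w _; rewrite normrM (ger0_norm (gauss_fun_ge0 w)).
by rewrite ler_wpM2r// gauss_fun_ge0.
Qed.

Lemma cvg_Rintegral_gauss_average (phi : R -> R) : continuous phi ->
  compactly_supported phi ->
  Num.sqrt n.+1%:R * \int[leb]_z (phi z * \int[m]_y gauss n.+1%:R (z - y))
    @[n --> \oo] --> \int[m]_y phi y * Num.sqrt pi.
Proof.
move=> cphi sphi; have [M phiM] := compactly_supported_bounded cphi sphi.
have s0 n : 0 < n.+1%:R :> R by rewrite ltr0n.
have bphi : bounded_measurable (phi : RR -> R).
  by split; [exact: continuous_measurable_fun | exists M].
have ia n : m.-integrable setT
    (EFin \o (fun y => \int[leb]_z (phi z * gauss n.+1%:R (z - y)))).
  apply: bounded_measurable_integrable; split; first exact: measurable_gauss_average.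
  have q0 : Num.sqrt n.+1%:R != 0 :> R by rewrite gt_eqF// sqrtr_gt0.
  exists ((Num.sqrt n.+1%:R)^-1 * (M * Num.sqrt pi)) => y.
  rewrite -[X in `|X|](mulKf q0) normrM gauss_average_rescale// ger0_norm.
    by rewrite ler_wpM2l// gauss_average_bound.
  by rewrite invr_ge0.
rewrite -RintegralZr//; last exact: bounded_measurable_integrable.
have -> : (fun n => Num.sqrt n.+1%:R *
      \int[leb]_z (phi z * \int[m]_y gauss n.+1%:R (z - y))) =
    (fun n => \int[m]_y
      \int[leb]_w (phi (y + (Num.sqrt n.+1%:R)^-1 * w) * gauss_fun w)).
  apply/funext => n; rewrite Fubini_gauss// -RintegralZl//.
  by apply: eq_Rintegral => y _; exact: gauss_average_rescale.
apply: (@bounded_Rintegral_cvg _ _ _ m _ _ (M * Num.sqrt pi)).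
- move=> n; under eq_fun do rewrite -gauss_average_rescale//.
  by apply: measurable_funM => //; exact: measurable_gauss_average.
- by move=> n x; exact: gauss_average_bound.
- by move=> x; exact: (@cvg_gauss_average _ M).
Qed.

End finite.
End weak_convergence.

(** * Calculus of complex-valued functions of a real variable *)

Section complex_derivative.
Context (R : realType).
Implicit Types (f g : R -> R[i]) (x : R) (a b c : R[i]).

(** Differentiability of a complex function of a real variable, through its two
    real components, so that the real calculus applies. *)
Definition is_cderive x f a :=
  is_derive x (1 : R) (fun t : R => Re (f t)) (Re a) /\
  is_derive x (1 : R) (fun t : R => Im (f t)) (Im a).

Lemma is_cderive_eq x f a b : is_cderive x f a -> a = b -> is_cderive x f b.
Proof. by move=> fa <-. Qed.

Lemma is_cderive_unique x f a b : is_cderive x f a -> is_cderive x f b -> a = b.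
Proof.
move=> [ra ia] [rb ib]; apply/eqP; rewrite eq_complex; apply/andP; split; apply/eqP.
  by rewrite -(@derive_val _ _ _ _ _ _ _ ra) -(@derive_val _ _ _ _ _ _ _ rb).
by rewrite -(@derive_val _ _ _ _ _ _ _ ia) -(@derive_val _ _ _ _ _ _ _ ib).
Qed.

Lemma is_cderive_cst x c : is_cderive x (fun=> c) 0.
Proof. by split; exact: is_derive1_cst. Qed.

Lemma is_cderive_real x (f : R -> R) (a : R) : is_derive x (1 : R) f a ->
  is_cderive x (fun t => (f t)%:C) a%:C.
Proof. by move=> fa; split => //=; exact: is_derive1_cst. Qed.

Lemma ReD a b : Re (a + b) = Re a + Re b.
Proof. by case: a => ? ?; case: b. Qed.

Lemma ImD a b : Im (a + b) = Im a + Im b.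
Proof. by case: a => ? ?; case: b. Qed.

Lemma ReM a b : Re (a * b) = Re a * Re b - Im a * Im b.
Proof. by case: a => ? ?; case: b. Qed.

Lemma ImM a b : Im (a * b) = Re a * Im b + Im a * Re b.
Proof. by case: a => ? ?; case: b. Qed.

Lemma is_cderiveD x f g a b : is_cderive x f a -> is_cderive x g b ->
  is_cderive x (fun t => f t + g t) (a + b).
Proof.
move=> [fa1 fa2] [gb1 gb2]; split.
  rewrite (_ : (fun t => _) = fun t => Re (f t) + Re (g t)).
    by rewrite ReD; exact: is_derive1D.
  by apply/funext => t; rewrite ReD.
rewrite (_ : (fun t => _) = fun t => Im (f t) + Im (g t)).
  by rewrite ImD; exact: is_derive1D.
by apply/funext => t; rewrite ImD.
Qed.

Lemma is_cderiveM x f g a b : is_cderive x f a -> is_cderive x g b ->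
  is_cderive x (fun t => f t * g t) (a * g x + f x * b).
Proof.
move=> [fa1 fa2] [gb1 gb2]; split.
  rewrite (_ : (fun t => _) = fun t => Re (f t) * Re (g t) - Im (f t) * Im (g t)).
    apply: is_derive1_eq (is_derive1B (is_derive1M fa1 gb1) (is_derive1M fa2 gb2)) _.
    by rewrite ReD !ReM; ring.
  by apply/funext => t; rewrite ReM.
rewrite (_ : (fun t => _) = fun t => Re (f t) * Im (g t) + Im (f t) * Re (g t)).
  apply: is_derive1_eq (is_derive1D (is_derive1M fa1 gb2) (is_derive1M fa2 gb1)) _.
  by rewrite ImD !ImM; ring.
by apply/funext => t; rewrite ImM.
Qed.

Lemma is_cderiveZ x c f a : is_cderive x f a -> is_cderive x (fun t => c * f t) (c * a).
Proof.
move=> fa; apply: is_cderive_eq (is_cderiveM (is_cderive_cst x c) fa) _.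
by rewrite mul0r add0r.
Qed.

Lemma is_cderiveB x f g a b : is_cderive x f a -> is_cderive x g b ->
  is_cderive x (fun t => f t - g t) (a - b).
Proof.
move=> fa gb; have := is_cderiveD fa (is_cderiveZ (-1) gb).
by rewrite mulN1r; under eq_fun do rewrite mulN1r.
Qed.

Lemma is_cderive_comp x (h : R -> R) f (b : R) a : is_derive x (1 : R) h b ->
  is_cderive (h x) f a -> is_cderive x (fun t => f (h t)) (a * b%:C).
Proof.
move=> hb [fa1 fa2]; split.
  apply: is_derive1_eq (is_derive1_comp' hb fa1) _.
  by rewrite ReM /= mulr0 subr0.
apply: is_derive1_eq (is_derive1_comp' hb fa2) _.
by rewrite ImM /= mulr0 add0r.
Qed.

Lemma is_cderive_shift x (d : R) f a : is_cderive (x + d) f a ->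
  is_cderive x (fun t => f (t + d)) a.
Proof.
move=> fa; have hd := is_derive1D (is_derive1_id x) (is_derive1_cst x d).
by apply: is_cderive_eq (is_cderive_comp hd fa) _; rewrite addr0 mulr1.
Qed.

Lemma is_cderiveV x f a : f x != 0 -> is_cderive x f a ->
  is_cderive x (fun t => (f t)^-1) (- a / f x ^+ 2).
Proof.
move=> f0 [fa1 fa2].
pose n t := Re (f t) ^+ 2 + Im (f t) ^+ 2.
have n0 : n x != 0.
  apply: contraNneq f0 => /eqP; rewrite /n paddr_eq0 ?sqr_ge0// !sqrf_eq0.
  by rewrite eq_complex.
have dn : is_derive x (1 : R) n (2 * (Re (f x) * Re a + Im (f x) * Im a)).
  apply: is_derive1_eq (is_derive1D (is_derive1M fa1 fa1) (is_derive1M fa2 fa2)) _.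
  by ring.
have dnV := is_derive1V n0 dn.
have fE t : (f t)^-1 = (Re (f t) * (n t)^-1) +i* (- Im (f t) * (n t)^-1).
  by rewrite /n; case: (f t) => u v; rewrite /GRing.inv/= mulNr.
have key : - a / f x ^+ 2 =
    (Re a * (n x)^-1 + Re (f x) * (- (2 * (Re (f x) * Re a + Im (f x) * Im a)) / n x ^+ 2)) +i*
    (- Im a * (n x)^-1 + - Im (f x) * (- (2 * (Re (f x) * Re a + Im (f x) * Im a)) / n x ^+ 2)).
  have f20 : f x ^+ 2 != 0 by rewrite expf_neq0.
  apply: (mulIf f20); rewrite mulfVK//; move: n0; rewrite /n.
  case: (f x) => u v /= n0; case: a {fa1 fa2 dn dnV} => p q.
  apply/eqP; rewrite eq_complex /= ; apply/andP; split; apply/eqP; field; exact: n0.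
rewrite key; split => /=.
  under eq_fun do rewrite fE /=.
  exact: is_derive1M.
under eq_fun do rewrite fE /=.
by apply: is_derive1M => //; exact: is_derive1N.
Qed.

Lemma cderive0_cst f : (forall x, is_cderive x f 0) -> forall x y, f x = f y.
Proof.
move=> f0 x y; apply/eqP; rewrite eq_complex; apply/andP; split; apply/eqP.
  by apply: (@is_derive_0_is_cst R (fun t => Re (f t))) => t; exact: (f0 t).1.
by apply: (@is_derive_0_is_cst R (fun t => Im (f t))) => t; exact: (f0 t).2.
Qed.

Lemma is_cderive_cexp x f a : is_cderive x f a ->
  is_cderive x (fun t => cexp (f t)) (a * cexp (f x)).
Proof.
move=> [fa1 fa2]; have dE := is_derive1_expR fa1.
have dc := is_derive1_comp' fa2 (is_derive_cos _).
have ds := is_derive1_comp' fa2 (is_derive_sin _).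
split.
  by apply: is_derive1_eq (is_derive1M dE dc) _; rewrite ReM /cexp/=; ring.
by apply: is_derive1_eq (is_derive1M dE ds) _; rewrite ImM /cexp/=; ring.
Qed.

Lemma cexpD a b : cexp (a + b) = cexp a * cexp b.
Proof.
apply/eqP; rewrite eq_complex /cexp !ReD !ImD/= expRD cosD sinD.
by apply/andP; split; apply/eqP; ring.
Qed.

Lemma is_cderive_continuous f (f' : R -> R[i]) :
  (forall x, is_cderive x f (f' x)) ->
  continuous (fun t => Re (f t)) /\ continuous (fun t => Im (f t)).
Proof.
by move=> df; split;
  [exact: is_derive1_continuous (fun x => (df x).1) |
   exact: is_derive1_continuous (fun x => (df x).2)].
Qed.

End complex_derivative.

(** * The functional equation *)

Section functional_equation.
Context (R : realType).
Implicit Types h k : R -> R[i].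

Definition splits_along_diagonals h1 h2 k1 k2 :=
  forall x y : R, h1 x * h2 y = k1 (x + y) * k2 (x - y).

Lemma splits_sym h1 h2 k1 k2 : splits_along_diagonals h1 h2 k1 k2 ->
  splits_along_diagonals h2 h1 k1 (fun v => k2 (- v)).
Proof. by move=> e x y; rewrite mulrC e (addrC x y) opprB. Qed.

(** The points [(x, y)], [(x + d + e, y + d - e)] have the same sums and
    differences, up to the pairing, as [(x + e, y - e)], [(x + d, y + d)]. *)
Lemma splits_four_points h1 h2 k1 k2 : splits_along_diagonals h1 h2 k1 k2 ->
  forall x y d e, h1 x * h2 y * (h1 (x + d + e) * h2 (y + d - e)) =
    h1 (x + e) * h2 (y - e) * (h1 (x + d) * h2 (y + d)).
Proof.
move=> eqn x y d e; rewrite !eqn.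
have -> : x + d + e + (y + d - e) = x + d + (y + d) by ring.
have -> : x + d + e - (y + d - e) = x + e - (y - e) by ring.
have -> : x + e + (y - e) = x + y by ring.
have -> : x + d - (y + d) = x - y by ring.
by ring.
Qed.

(** The set where [h1] does not vanish is invariant under the translations by
    half the differences of two points where [h2] does not vanish; by continuity
    of [h2] these translations fill a neighbourhood of 0, and finitely many small
    steps lead from [a] to any [x]. *)
Lemma splits_neq0 h1 h2 k1 k2 : splits_along_diagonals h1 h2 k1 k2 ->
  continuous (fun t => Re (h2 t)) -> continuous (fun t => Im (h2 t)) ->
  forall a b, h1 a != 0 -> h2 b != 0 -> forall x, h1 x != 0.
Proof.
move=> eqn cRe cIm a b h1a h2b x.
have shift p y y' : h1 p != 0 -> h2 y != 0 -> h2 y' != 0 ->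
    h1 (p + (y - y') / 2) != 0.
  move=> hp hy hy'.
  have : k1 (p + y) * k2 (p - y') != 0.
    have : h1 p * h2 y != 0 by rewrite mulf_neq0.
    rewrite eqn mulf_eq0 => /norP[k1n _].
    have : h1 p * h2 y' != 0 by rewrite mulf_neq0.
    by rewrite eqn mulf_eq0 => /norP[_ k2n]; rewrite mulf_neq0.
  have := eqn (p + (y - y') / 2) ((y + y') / 2).
  have -> : p + (y - y') / 2 + (y + y') / 2 = p + y by field.
  have -> : p + (y - y') / 2 - (y + y') / 2 = p - y' by field.
  by move=> <-; rewrite mulf_eq0 => /norP[].
pose n t := Re (h2 t) ^+ 2 + Im (h2 t) ^+ 2.
have nE t : (n t != 0) = (h2 t != 0).
  by rewrite /n paddr_eq0 ?sqr_ge0// !sqrf_eq0 eq_complex.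
have cn : continuous n.
  by move=> t; apply: cvgD; rewrite expr2; apply: cvgM; (exact: cRe || exact: cIm).
have n0 : n b != 0 by rewrite nE.
have np : 0 < n b by rewrite lt_neqAle eq_sym n0 addr_ge0 ?sqr_ge0.
have /cvgrPdist_lt/(_ _ np)[e /= e0 he] := cn b.
have h2n t : `|b - t| < e -> h2 t != 0.
  move=> /he; rewrite -nE => hbt; apply: contraTneq hbt => ->.
  by rewrite subr0 gtr0_norm// ltxx.
have step p dl : h1 p != 0 -> `|dl| < e -> h1 (p + dl) != 0.
  move=> hp de; have := shift p (b + dl) (b - dl) hp.
  have -> : (b + dl - (b - dl)) / 2 = dl by field.
  by apply; apply: h2n; rewrite opprD ?opprK addNKr ?normrN.
(* [N.+1] steps of length less than [e] lead from [a] to [x]. *)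
have [N hN] : exists N : nat, `|x - a| / e < N.+1%:R.
  by exists (Num.truncn (`|x - a| / e)); rewrite truncnS_gt.
have iter_ (j : nat) : h1 (a + j%:R * ((x - a) / N.+1%:R)) != 0.
  elim: j => [|j IH]; first by rewrite mul0r addr0.
  rewrite -natr1 mulrDl mul1r addrA; apply: step => //.
  rewrite normrM normfV (ger0_norm (ler0n _ _)) ltr_pdivrMr ?ltr0n//.
  by move: hN; rewrite ltr_pdivrMr// mulrC.
have := iter_ N.+1; rewrite mulrCA divff ?mulr1 ?pnatr_eq0//.
by rewrite addrC subrK.
Qed.

Section logarithmic_derivatives.
Variables (h1 h2 k1 k2 h1' h2' h1'' h2'' : R -> R[i]).
Hypothesis eqn : splits_along_diagonals h1 h2 k1 k2.
Hypothesis dh1 : forall x, is_cderive x h1 (h1' x).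
Hypothesis dh2 : forall x, is_cderive x h2 (h2' x).
Hypothesis ddh1 : forall x, is_cderive x h1' (h1'' x).
Hypothesis ddh2 : forall x, is_cderive x h2' (h2'' x).
Hypothesis h1n0 : forall x, h1 x != 0.
Hypothesis h2n0 : forall x, h2 x != 0.

Let l1 x := h1' x * (h1 x)^-1.
Let l2 x := h2' x * (h2 x)^-1.

(** The derivative of [splits_four_points] with respect to [e] at [e = 0],
    divided by its nonzero value there. *)
Let logarithmic_increments x y d : l1 (x + d) - l2 (y + d) = l1 x - l2 y.
Proof.
have d0 : is_derive (0 : R) (1 : R) (fun t : R => - t) (- 1).
  exact: is_derive1N (is_derive1_id 0).
have sh1 p : is_cderive (0 : R) (fun e => h1 (p + e)) (h1' p).
  have := dh1 (0 + p) => D; have := is_cderive_shift D.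
  by rewrite add0r; under eq_fun do rewrite addrC.
have sh2 p : is_cderive (0 : R) (fun e => h2 (p - e)) (- h2' p).
  have D : is_cderive (- 0 : R) (fun t => h2 (p + t)) (h2' p).
    rewrite oppr0; have := dh2 (0 + p) => D; have := is_cderive_shift D.
    by rewrite add0r; under eq_fun do rewrite addrC.
  apply: is_cderive_eq (is_cderive_comp d0 D) _.
  by rewrite rmorphN1 mulrN1.
have L := is_cderiveZ (h1 x * h2 y) (is_cderiveM (sh1 (x + d)) (sh2 (y + d))).
have R_ := is_cderiveM (is_cderiveM (sh1 x) (sh2 y))
  (is_cderive_cst 0 (h1 (x + d) * h2 (y + d))).
have E := splits_four_points eqn x y d.
rewrite (_ : (fun t => h1 (x + t) * h2 (y - t) * _) =
    (fun e => h1 x * h2 y * (h1 (x + d + e) * h2 (y + d - e)))) in R_; last first.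
  by apply/funext => e; rewrite E.
have {L R_} := is_cderive_unique L R_.
rewrite /l1 /l2 !subr0 !addr0 => {}E.
have := (h1n0 x, h1n0 (x + d), h2n0 y, h2n0 (y + d)) => -[[[a1 a2] a3] a4].
have nz : h1 x * h2 y * (h1 (x + d) * h2 (y + d)) != 0 by rewrite !mulf_neq0.
apply: (mulIf nz).
transitivity (h1 x * h2 y * (h1' (x + d) * h2 (y + d) + h1 (x + d) * - h2' (y + d))).
  by field; rewrite a2 a4.
by rewrite E; field; rewrite a1 a3.
Qed.

Let d_log (h h' h'' : R -> R[i]) x : h x != 0 -> is_cderive x h (h' x) ->
  is_cderive x h' (h'' x) ->
  is_cderive x (fun t => h' t * (h t)^-1) (h'' x * (h x)^-1 + h' x * (- h' x / h x ^+ 2)).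
Proof. by move=> hn dh ddh; apply: is_cderiveM => //; exact: is_cderiveV. Qed.

(** The logarithmic derivatives have the same constant derivative, so both
    factors are exponentials of quadratic polynomials with the same leading
    coefficient. *)
Lemma splits_log_affine : exists K b1 b2 : R[i], forall x,
  h1' x = (K * x%:C + b1) * h1 x /\ h2' x = (K * x%:C + b2) * h2 x.
Proof.
pose l1' x := h1'' x * (h1 x)^-1 + h1' x * (- h1' x / h1 x ^+ 2).
pose l2' x := h2'' x * (h2 x)^-1 + h2' x * (- h2' x / h2 x ^+ 2).
have dl1 x : is_cderive x l1 (l1' x) by exact: d_log.
have dl2 x : is_cderive x l2 (l2' x) by exact: d_log.
have l12 x y : l1' x = l2' y.
  have D : is_cderive 0 (fun d => l1 (d + x) - l2 (d + y)) (l1' x - l2' y).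
    by apply: is_cderiveB; apply: is_cderive_shift; rewrite add0r.
  have D0 : is_cderive 0 (fun d => l1 (d + x) - l2 (d + y)) 0.
    under eq_fun => d do rewrite (addrC d x) (addrC d y) logarithmic_increments.
    exact: is_cderive_cst.
  by apply/eqP; rewrite -subr_eq0; apply/eqP; exact: is_cderive_unique D D0.
have aff (l l' : R -> R[i]) : (forall x, is_cderive x l (l' x)) ->
    (forall x, l' x = l1' 0) -> forall x, l x = l1' 0 * x%:C + l 0.
  move=> dl lK x.
  have D t : is_cderive t (fun t => l t - l1' 0 * t%:C) 0.
    apply: is_cderive_eq (is_cderiveB (dl t)
      (is_cderiveZ (l1' 0) (is_cderive_real (is_derive1_id t)))) _.
    by rewrite lK mulr1 subrr.
  have := cderive0_cst D x 0; rewrite mulr0 subr0 => <-.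
  by rewrite addrC subrK.
exists (l1' 0), (l1 0), (l2 0) => x.
have l1c y : l1' y = l1' 0 by rewrite (l12 y 0) -(l12 0 0).
have l2c y : l2' y = l1' 0 by rewrite -(l12 0 y).
rewrite -(aff l1 l1' dl1 l1c) -(aff l2 l2' dl2 l2c).
by split; rewrite mulfVK.
Qed.

End logarithmic_derivatives.

End functional_equation.

Section gaussian_average.
Context (R : realType).
Local Notation RR := (measurableTypeR R).
Implicit Types m : {complex_measure set RR -> R[i]}.

(** Convolution with an unnormalised Gaussian kernel: a constant factor does not
    affect the functional equation nor the logarithmic derivatives. *)
Definition gconv m (s z : R) : R[i] := cint m (fun y => gauss s (z - y)).

Lemma gconv_derive m (s : R) : 0 < s ->
  (forall z, is_cderive z (gconv m s) (cint m (fun y => dgauss s (z - y)))) /\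
  (forall z, is_cderive z (fun z => cint m (fun y => dgauss s (z - y)))
     (cint m (fun y => ddgauss s (z - y)))).
Proof.
move=> s0; split => z; split; apply: is_derive_charge_integral_translate.
- exact: is_derive_gauss.
- exact: norm_gauss.
- exact: norm_dgauss.
- exact: is_derive_gauss.
- exact: norm_gauss.
- exact: norm_dgauss.
- exact: is_derive_dgauss.
- exact: norm_dgauss.
- exact: norm_ddgauss.
- exact: is_derive_dgauss.
- exact: norm_dgauss.
- exact: norm_ddgauss.
Qed.

(** Since [s a^2 + s b^2 = (s/2) ((a + b)^2 + (a - b)^2)], the product kernel
    centred at [(x, y)] is the pullback of the product kernel of parameter
    [s / 2] centred at [(x + y, x - y)]. *)
Lemma gconv_splits (mu1 mu2 nu1 nu2 : {complex_measure set RR -> R[i]})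
    (F : RR * RR -> RR * RR) (s : R) : 0 < s ->
  (forall x1 x2 : R, F (x1, x2) = (x1 + x2, x1 - x2)) ->
  eq_on_measurable (cpushforward (mu1 \xC mu2) F) (nu1 \xC nu2) ->
  splits_along_diagonals (gconv mu1 s) (gconv mu2 s)
    (gconv nu1 (s / 2)) (gconv nu2 (s / 2)).
Proof.
move=> s0 hF eqF x y; have s20 : 0 < s / 2 by rewrite divr_gt0.
have bg (r z : R) : 0 < r -> bounded_measurable ((fun y => gauss r (z - y)) : RR -> R).
  by move=> r0; apply: bounded_measurable_translate (@continuous_gauss R r) (norm_gauss r0).
rewrite /gconv -!cint_product; try exact: bg.
have mF : measurable_fun setT F.
  have -> : F = fun p => (p.1 + p.2, p.1 - p.2) by apply/funext => -[a b]; rewrite hF.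
  by apply: measurable_fun_pair; [exact: measurable_funD | exact: measurable_funB].
rewrite (cint_cpushforward mF eqF); last first.
  apply: bounded_measurableM.
    exact: (bounded_measurable_comp measurable_fst (bg _ _ s20)).
  exact: (bounded_measurable_comp measurable_snd (bg _ _ s20)).
congr cint; apply/funext => -[a b]; rewrite /= hF /= /gauss -!expRD; congr expR.
by field.
Qed.

End gaussian_average.

(** * Test functions *)

Section test_functions.
Context (R : realType).
Local Notation RR := (measurableTypeR R).
Local Notation leb := (@lebesgue_measure R).
Implicit Types (phi : R -> R) (h : R -> R[i]).

Definition lebesgue_pairing phi h : R[i] :=
  (\int[leb]_z (phi z * Re (h z))) +i* (\int[leb]_z (phi z * Im (h z))).

Lemma continuous_cs_integrableM phi (u : R -> R) : continuous phi ->
  compactly_supported phi -> continuous u ->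
  leb.-integrable setT (EFin \o (fun z => phi z * u z)).
Proof.
move=> cphi sphi cu; apply: compactly_supported_integrable.
  by move=> z; apply: cvgM; [exact: cphi | exact: cu].
exact: compactly_supportedM.
Qed.

Lemma continuous_Rintegral_gauss (m : {finite_measure set RR -> \bar R}) (s : R) :
  0 < s -> continuous (fun z : R => \int[m]_y gauss s (z - y)).
Proof.
move=> s0; exact: is_derive1_continuous (is_derive_Rintegral_translate m
  (is_derive_gauss s) (norm_gauss s0) (norm_dgauss s0)).
Qed.

Lemma cvg_charge_gauss_average (nu : {charge set RR -> \bar R}) phi :
  continuous phi -> compactly_supported phi ->
  Num.sqrt n.+1%:R * \int[leb]_z (phi z * charge_integral nu (fun y => gauss n.+1%:R (z - y)))
    @[n --> \oo] --> charge_integral nu phi * Num.sqrt pi.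
Proof.
move=> cphi sphi; have s0 n : 0 < n.+1%:R :> R by rewrite ltr0n.
have ia (m : {finite_measure set RR -> \bar R}) n : leb.-integrable setT
    (EFin \o (fun z : R => phi z * \int[m]_y gauss n.+1%:R (z - y))).
  by apply: continuous_cs_integrableM => //; exact: continuous_Rintegral_gauss.
rewrite /charge_integral mulrBl.
have -> : (fun n => Num.sqrt n.+1%:R * \int[leb]_z (phi z *
      (\int[charge_pos nu]_y gauss n.+1%:R (z - y) -
       \int[charge_neg nu]_y gauss n.+1%:R (z - y)))) =
    (fun n => Num.sqrt n.+1%:R *
       \int[leb]_z (phi z * \int[charge_pos nu]_y gauss n.+1%:R (z - y)) -
     Num.sqrt n.+1%:R *
       \int[leb]_z (phi z * \int[charge_neg nu]_y gauss n.+1%:R (z - y))).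
  apply/funext => n; under eq_Rintegral do rewrite mulrBr.
  by rewrite RintegralB// mulrBr.
by apply: cvgB; exact: cvg_Rintegral_gauss_average.
Qed.

(** The factor [sqrt n] compensates the total mass [sqrt (pi / s)] of the kernel
    of parameter [s = n.+1], up to [sqrt pi]. *)
Lemma cvg_gconv (m : {complex_measure set RR -> R[i]}) phi :
  continuous phi -> compactly_supported phi ->
  (fun n => (Num.sqrt n.+1%:R)%:C * lebesgue_pairing phi (gconv m n.+1%:R) : R[i]^o)
    @ \oo --> (cint m phi * (Num.sqrt pi)%:C : R[i]^o).
Proof.
move=> cphi sphi.
have cE (a b r : R) : r%:C * (a +i* b) = (r * a) +i* (r * b).
  by apply/eqP; rewrite eq_complex/= !mul0r subr0 addr0 !eqxx.
have -> : cint m phi * (Num.sqrt pi)%:C =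
    (charge_integral (charge_Re m) phi * Num.sqrt pi) +i*
    (charge_integral (charge_Im m) phi * Num.sqrt pi).
  by rewrite mulrC /cint cE (mulrC (Num.sqrt pi)) (mulrC (Num.sqrt pi)).
under eq_fun do rewrite /lebesgue_pairing cE.
by apply: cvg_complex; exact: cvg_charge_gauss_average.
Qed.

(** One continuous derivative is enough: the equation is integrated by parts
    once.  The derivative is carried along so that it can itself be tested
    against the averages. *)
Definition test_function phi (phi' : R -> R) :=
  [/\ forall x : R, is_derive x (1 : R) phi (phi' x), continuous phi',
      compactly_supported phi & compactly_supported phi'].

Lemma test_function_continuous phi phi' : test_function phi phi' -> continuous phi.
Proof. by case=> dphi _ _ _; exact: is_derive1_continuous dphi. Qed.

Lemma Rintegral_compactly_supported (u : R -> R) (N : R) :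
  (forall x, N <= `|x| -> u x = 0) ->
  \int[leb]_z u z = \int[leb]_(z in `[- N, N]) u z.
Proof.
move=> u0; rewrite [RHS]Rintegral_mkcond; apply: eq_Rintegral => x _.
rewrite patchE; case: ifPn => //.
rewrite notin_setE /= in_itv/= -ler_norml => /negP; rewrite -ltNge => Nx.
by rewrite u0// ltW.
Qed.

Lemma test_function_by_parts phi phi' (u u' : R -> R) : test_function phi phi' ->
  (forall x : R, is_derive x (1 : R) u (u' x)) -> continuous u' ->
  \int[leb]_z (phi' z * u z) = - \int[leb]_z (phi z * u' z).
Proof.
move=> tphi du cu'; have cphi := test_function_continuous tphi.
case: tphi => dphi cphi' [N1 sphi] [N2 sphi'].
pose N := `|N1| + `|N2| + 1.
have N1N x : N <= `|x| -> N1 < `|x|.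
  by apply: lt_le_trans; rewrite /N; have := ler_norm N1; have := normr_ge0 N2; lra.
have N2N x : N <= `|x| -> N2 < `|x|.
  by apply: lt_le_trans; rewrite /N; have := ler_norm N2; have := normr_ge0 N1; lra.
have N0 : 0 < N by rewrite /N; have := normr_ge0 N2; have := normr_ge0 N1; lra.
rewrite (@Rintegral_compactly_supported (fun z => phi' z * u z) N); last first.
  by move=> x /N2N/sphi' ->; rewrite mul0r.
rewrite (@Rintegral_compactly_supported (fun z => phi z * u' z) N); last first.
  by move=> x /N1N/sphi ->; rewrite mul0r.
have LR (f f' : R -> R) : (forall x : R, is_derive x (1 : R) f (f' x)) ->
    derivable_oo_LRcontinuous f (- N) N.
  move=> df; have cf := is_derive1_continuous df; split.
  - by move=> x _; case: (df x).
  - by apply: cvg_at_right_filter; exact: cf.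
  - by apply: cvg_at_left_filter; exact: cf.
have NN : - N < N by lra.
have := @Rintegration_by_parts R phi u phi' u' (- N) N NN
  (continuous_subspaceT cphi') (LR _ _ dphi) _ (continuous_subspaceT cu') (LR _ _ du) _.
rewrite !sphi; [ | by apply: N1N; rewrite ?normrN gtr0_norm..].
rewrite !mul0r subrr sub0r => ->; first by rewrite opprK.
- by move=> x _; rewrite derive1E; case: (dphi x).
- by move=> x _; rewrite derive1E; case: (du x).
Qed.

Lemma lebesgue_pairing_by_parts phi phi' h h' : test_function phi phi' ->
  (forall x, is_cderive x h (h' x)) ->
  continuous (fun t => Re (h' t)) -> continuous (fun t => Im (h' t)) ->
  lebesgue_pairing phi' h = - lebesgue_pairing phi h'.
Proof.
move=> tphi dh cr ci; rewrite /lebesgue_pairing.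
rewrite (test_function_by_parts tphi (fun x => (dh x).1) cr).
by rewrite (test_function_by_parts tphi (fun x => (dh x).2) ci).
Qed.

Lemma lebesgue_pairing_affine phi h (K b : R[i]) : continuous phi ->
  compactly_supported phi ->
  continuous (fun t => Re (h t)) -> continuous (fun t => Im (h t)) ->
  lebesgue_pairing phi (fun z => (K * z%:C + b) * h z) =
  K * lebesgue_pairing (fun z : R => z * phi z) h + b * lebesgue_pairing phi h.
Proof.
move=> cphi sphi cr ci.
have czphi : continuous (fun z : R => z * phi z).
  by move=> z; apply: cvgM; [exact: cvg_id | exact: cphi].
have szphi : compactly_supported (fun z : R => z * phi z).
  by have [N hN] := sphi; exists N => x /hN ->; rewrite mulr0.
have i1 := continuous_cs_integrableM cphi sphi cr.
have i2 := continuous_cs_integrableM cphi sphi ci.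
have i3 := continuous_cs_integrableM czphi szphi cr.
have i4 := continuous_cs_integrableM czphi szphi ci.
have lin (a1 a2 a3 a4 : R) : \int[leb]_z
    (a1 * (z * phi z * Re (h z)) + a2 * (z * phi z * Im (h z)) +
    (a3 * (phi z * Re (h z)) + a4 * (phi z * Im (h z)))) =
    a1 * \int[leb]_z (z * phi z * Re (h z)) + a2 * \int[leb]_z (z * phi z * Im (h z)) +
    (a3 * \int[leb]_z (phi z * Re (h z)) + a4 * \int[leb]_z (phi z * Im (h z))).
  have j1 := integrableZl measurableT a1 i3.
  have j2 := integrableZl measurableT a2 i4.
  have j3 := integrableZl measurableT a3 i1.
  have j4 := integrableZl measurableT a4 i2.
  rewrite RintegralD//; [|exact: (integrableD measurableT j1 j2)|
    exact: (integrableD measurableT j3 j4)].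
  by rewrite !RintegralD// !RintegralZl.
rewrite /lebesgue_pairing; apply/eqP; rewrite eq_complex/=; apply/andP; split; apply/eqP.
  transitivity (\int[leb]_z (Re K * (z * phi z * Re (h z)) +
      (- Im K) * (z * phi z * Im (h z)) + (Re b * (phi z * Re (h z)) +
      (- Im b) * (phi z * Im (h z))))).
    by apply: eq_Rintegral => z _; rewrite ReM !ReD !ImD ReM ImM/=; ring.
  by rewrite lin ReD !ReM/=; ring.
transitivity (\int[leb]_z (Im K * (z * phi z * Re (h z)) +
    Re K * (z * phi z * Im (h z)) + (Im b * (phi z * Re (h z)) +
    Re b * (phi z * Im (h z))))).
  by apply: eq_Rintegral => z _; rewrite ImM !ReD !ImD ReM ImM/=; ring.
by rewrite lin ImD !ImM/=; ring.
Qed.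

End test_functions.

Section bumps.
Context (R : realType).
Local Notation RR := (measurableTypeR R).

(** For the square of the positive part: at 0, no rule of differentiation applies
    to it. *)
Lemma is_derive_quadratic_remainder (f : R -> R) (x a C : R) :
  (forall h, `|f (x + h) - f x - a * h| <= C * h ^+ 2) ->
  is_derive x (1 : R) f a.
Proof.
move=> fa.
have cv : h^-1 *: (f (h *: (1 : R) + x) - f x) @[h --> 0^'] --> a.
  apply/cvgrPdist_le => e e0; near=> h.
  have h0 : h != 0 by near: h; exact: nbhs_dnbhs_neq.
  have hs : `|h| <= e / (`|C| + 1).
    by near: h; apply: dnbhs0_le; rewrite divr_gt0// ltr_wpDl.
  have -> : a - h^-1 *: (f (h *: (1 : R) + x) - f x) =
      - (h^-1 * (f (x + h) - f x - a * h)).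
    by rewrite /GRing.scale/= mulr1 (addrC h); field.
  rewrite normrN normrM normfV ler_pdivrMl ?normr_gt0//.
  apply: (le_trans (fa h)); apply: (le_trans (ler_norm _)).
  rewrite normrM normrX expr2 mulrCA ler_wpM2l//.
  move: hs; rewrite ler_pdivlMr ?ltr_wpDl//; apply: le_trans.
  by rewrite mulrC ler_wpM2l// lerDl.
split; first by apply/cvg_ex; exists a.
exact: cvg_lim cv.
Unshelve. all: by end_near. Qed.

Lemma is_derive_sqr_pos (t : R) :
  is_derive t (1 : R) (fun t : R => Num.max 0 t ^+ 2) (2 * Num.max 0 t).
Proof.
apply: (@is_derive_quadratic_remainder _ _ _ 1) => h; rewrite mul1r.
have [t0|t0] := leP 0 t; have [h0|h0] := leP 0 (t + h).
- by rewrite (_ : _ - _ = h ^+ 2) ?ger0_norm ?sqr_ge0//; ring.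
- by rewrite ler_norml; apply/andP; split; nra.
- by rewrite ler_norml; apply/andP; split; nra.
- by rewrite ler_norml; apply/andP; split; nra.
Qed.

(** The bump [1 - e^(- k w^2)], with [w] the positive part of
    [(z - u) * (v - z)], is continuously differentiable, is supported in [u, v]
    and increases to the indicator of the open interval. *)
Lemma test_function_indic_itvoo (u v : R) : u < v ->
  exists phi phi' : nat -> R -> R, [/\ forall k, test_function (phi k) (phi' k),
    forall k z, `|phi k z| <= 1,
    forall k z, z \notin `]u, v[ -> phi k z = 0 &
    forall z, phi k z @[k --> \oo] --> (\1_(`]u, v[%classic) z : R)].
Proof.
move=> uv.
pose q (z : R) := (z - u) * (v - z); pose W (z : R) := Num.max 0 (q z) ^+ 2.
pose W' (z : R) := 2 * Num.max 0 (q z) * (u + v - 2 * z).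
have dq (z : R) : is_derive z (1 : R) q (u + v - 2 * z).
  have d1 := is_derive1B (is_derive1_id z) (is_derive1_cst z u).
  have d2 := is_derive1B (is_derive1_cst z v) (is_derive1_id z).
  by apply: is_derive1_eq (is_derive1M d1 d2) _; ring.
have dW (z : R) : is_derive z (1 : R) W (W' z).
  exact: is_derive1_comp' (dq z) (is_derive_sqr_pos (q z)).
have cW' : continuous W'.
  move=> z; apply: cvgM.
    apply: cvgM; first exact: cvg_cst.
    have cmax : continuous (fun t : R => Num.max 0 t).
      by move=> t; apply: continuous_max; [exact: cvg_cst | exact: cvg_id].
    have cq : continuous q := is_derive1_continuous dq.
    exact: (@continuous_comp _ _ _ q (fun t => Num.max 0 t) z (cq z) (cmax (q z))).
  by apply: cvgB; [exact: cvg_cst | apply: cvgM; [exact: cvg_cst | exact: cvg_id]].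
have q0 z : z \notin `]u, v[ -> q z <= 0.
  by rewrite in_itv/= negb_and -!leNgt /q => /orP[] zu; nra.
have W0 z : z \notin `]u, v[ -> W z = 0.
  by move=> /q0 qz; rewrite /W max_l// expr0n.
pose phi (k : nat) (z : R) := 1 - expR (- (k%:R * W z)).
pose phi' (k : nat) (z : R) := expR (- (k%:R * W z)) * (k%:R * W' z).
have dphi k (z : R) : is_derive z (1 : R) (phi k) (phi' k z).
  have dk := is_derive1M (is_derive1_cst z (k%:R : R)) (dW z).
  apply: is_derive1_eq (is_derive1B (is_derive1_cst z 1) (is_derive1_expR (is_derive1N dk))) _.
  by rewrite /phi'; ring.
have cW : continuous W := is_derive1_continuous dW.
have out (z : R) : `|u| + `|v| < `|z| -> z \notin `]u, v[.
  apply: contraTN; rewrite in_itv/= -leNgt => /andP[uz zv].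
  rewrite ler_norml; have := ler_norm v; have := ler_norm (- u).
  rewrite normrN; have := normr_ge0 u; have := normr_ge0 v.
  by move=> *; apply/andP; split; lra.
have Wge0 z : 0 <= W z by exact: sqr_ge0.
exists phi, phi'; split.
- move=> k; split.
  + exact: dphi.
  + move=> z; apply: cvgM; last by apply: cvgM; [exact: cvg_cst | exact: cW'].
    have cl : continuous (fun z => - (k%:R * W z)).
      by move=> t; apply: cvgN; apply: cvgM; [exact: cvg_cst | exact: cW].
    exact: (@continuous_comp _ _ _ _ expR z (cl z) (@continuous_expR R _)).
  + exists (`|u| + `|v|) => z /out /W0 Wz.
    by rewrite /phi Wz mulr0 oppr0 expR0 subrr.
  + exists (`|u| + `|v|) => z /out /q0 qz.
    by rewrite /phi' /W' max_l// mulr0 mul0r !mulr0.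
- move=> k z; have e0 := expR_gt0 (- (k%:R * W z)).
  have e1 : expR (- (k%:R * W z)) <= 1.
    by rewrite -expR0 ler_expR oppr_le0 mulr_ge0.
  by rewrite ler_norml /phi; apply/andP; split; lra.
- by move=> k z /W0 Wz; rewrite /phi Wz mulr0 oppr0 expR0 subrr.
- move=> z; rewrite indicE; have [zuv|zuv] := boolP (z \in `]u, v[%classic).
    have Wz : 0 < W z.
      move: zuv; rewrite inE/= in_itv/= => /andP[uz zv].
      by rewrite /W exprn_gt0// lt_max /q mulr_gt0 ?orbT ?subr_gt0.
    rewrite -[X in _ --> X]subr0; apply: cvgB; first exact: cvg_cst.
    have -> : (fun k => expR (- (k%:R * W z))) = (fun k => expR (- W z) ^+ k).
      by apply/funext => k; rewrite -expRM_natl mulrN.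
    apply: cvg_expr; rewrite ger0_norm ?expR_ge0//.
    by rewrite -expR0 ltr_expR oppr_lt0.
  have zuv' : z \notin `]u, v[ by move: zuv; rewrite notin_setE/= => /negP.
  by rewrite /phi (W0 _ zuv'); under eq_fun do rewrite mulr0 oppr0 expR0 subrr;
    exact: cvg_cst.
Qed.

End bumps.

(** * Either a Dirac measure or convergence of the exponents *)

Section intervals.
Context (R : realType).
Local Notation RR := (measurableTypeR R).

Lemma setI_itvoo (u v u' v' : R) :
  `]u, v[%classic `&` `]u', v'[%classic = `]Num.max u u', Num.min v v'[%classic.
Proof.
apply/seteqP; split => x; rewrite /= !in_itv/= gt_max lt_min.
  by move=> [/andP[-> ->] /andP[-> ->]].
by move=> /andP[/andP[-> ->] /andP[-> ->]].
Qed.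

Lemma measurable_itvoo (u v : R) : measurable (`]u, v[%classic : set RR).
Proof. exact: measurable_itv. Qed.

Lemma cvg_indic_itvoo (x : R) :
  (\1_(`](- n.+1%:R), n.+1%:R[%classic) x : R) @[n --> \oo] --> (1 : R).
Proof.
apply: cvg_near_cst; exists (Num.truncn `|x|) => // n /= xn.
rewrite indicE mem_set//= in_itv/= -ltr_norml.
by apply: (lt_le_trans (truncnS_gt _)); rewrite ler_nat.
Qed.

Lemma norm_indic (A : set RR) (x : R) : `|\1_A x : R| <= 1.
Proof. by rewrite indicE; case: (_ \in _); rewrite ?normr0 ?normr1. Qed.

(** Bounded open intervals form a generating pi-system, and the whole line is an
    increasing limit of them. *)
Lemma bounded_measurable_itvoo_ind (P : (RR -> R) -> Prop) :
  (forall u v, u < v -> P \1_(`]u, v[%classic)) ->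
  (forall (a : R) f g, bounded_measurable f -> bounded_measurable g ->
    P f -> P g -> P (fun x => a * f x + g x)) ->
  (forall (f_ : nat -> RR -> R) f (M : R), (forall n, measurable_fun setT (f_ n)) ->
    (forall n x, `|f_ n x| <= M) -> (forall n, P (f_ n)) ->
    (forall x, f_ n x @[n --> \oo] --> f x) -> P f) ->
  forall f, bounded_measurable f -> P f.
Proof.
move=> Pitv Plin Plim.
have bitv (u v : R) : bounded_measurable (\1_(`]u, v[%classic) : RR -> R).
  by apply: bounded_measurable_indic; exact: measurable_itvoo.
have P0 : P (fun=> 0).
  have := Plin (-1) _ _ (bitv 0 1) (bitv 0 1) (Pitv _ _ ltr01) (Pitv _ _ ltr01).
  by under eq_fun do rewrite mulN1r addNr.
apply: (@bounded_measurable_ind _ RR R (@RGenOpens.G R)) => //.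
- exact: RGenOpens.measurableE.
- by move=> _ _ [u [v ->]] [u' [v' ->]]; rewrite setI_itvoo; exists (Num.max u u'), (Num.min v v').
- apply: (Plim (fun n => \1_(`](- n.+1%:R), n.+1%:R[%classic)) _ 1).
  + by move=> n; apply: measurable_indic; exact: measurable_itvoo.
  + by move=> n x; exact: norm_indic.
  + by move=> n; apply: Pitv; have := ltr0Sn R n; lra.
  + exact: cvg_indic_itvoo.
- move=> _ [u [v ->]]; have [uv|vu] := ltP u v; first exact: Pitv.
  rewrite (_ : \1_ _ = fun=> 0)//; apply/funext => x.
  by rewrite set_itv_ge ?indic0// bnd_simp -leNgt.
Qed.

End intervals.

Section concentration.
Context (R : realType).
Local Notation RR := (measurableTypeR R).
Variable m : {complex_measure set RR -> R[i]}.

Lemma cint0 : cint m (fun=> 0) = 0.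
Proof. by have := cint_indic m measurable0; rewrite indic0 cmeasure0. Qed.

Lemma cvg_cint_test (u v : R) : u < v ->
  exists phi phi' : nat -> R -> R, [/\ forall k, test_function (phi k) (phi' k),
    (fun k => cint m (phi k) : R[i]^o) @ \oo --> (cint m \1_(`]u, v[%classic) : R[i]^o) &
    (fun k => cint m (fun z : R => z * phi k z) : R[i]^o) @ \oo -->
      (cint m (fun z : R => z * \1_(`]u, v[%classic) z) : R[i]^o)].
Proof.
move=> /test_function_indic_itvoo[phi [phi' [tphi phi1 phi0 phiE]]].
exists phi, phi'; split => //.
  apply: (@cint_cvg _ _ _ _ _ _ 1) => // k.
  exact: continuous_measurable_fun (test_function_continuous (tphi k)).
apply: (@cint_cvg _ _ _ _ _ _ (`|u| + `|v|)).
- move=> k; apply: measurable_funM => //.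
  exact: continuous_measurable_fun (test_function_continuous (tphi k)).
- move=> k x; have [xuv|xuv] := boolP (x \in `]u, v[); last first.
    by rewrite phi0// mulr0 normr0 addr_ge0.
  rewrite normrM; apply: (@le_trans _ _ `|x|); first by rewrite ler_piMr.
  move: xuv; rewrite in_itv/= => /andP[ux xv]; rewrite ler_norml.
  have := ler_norm v; have := ler_norm (- u); rewrite normrN.
  have := normr_ge0 u; have := normr_ge0 v.
  by move=> *; apply/andP; split; lra.
- by move=> x; apply: cvgM; [exact: cvg_cst | exact: phiE].
Qed.

Lemma null_of_test_functions :
  (forall phi phi', test_function phi phi' -> cint m phi = 0) ->
  forall A, measurable A -> m A = 0.
Proof.
move=> I0 A mA; rewrite -cint_indic//.
have : bounded_measurable (\1_A : RR -> R) by exact: bounded_measurable_indic.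
move: (\1_A) => f bf; pattern f; apply: bounded_measurable_itvoo_ind bf => {f}.
- move=> u v /cvg_cint_test[phi [phi' [tphi cphi _]]].
  apply: (complex_cvg_unique cphi); under eq_fun => k do rewrite (I0 _ _ (tphi k)).
  exact: cvg_cst.
- by move=> a f g bf bg f0 g0; rewrite cint_lin// f0 g0 mulr0 addr0.
- move=> f_ f M mf fM f0 ff; have := cint_cvg (m := m) mf fM ff.
  under eq_fun do rewrite f0.
  by move=> /complex_cvg_unique; apply; exact: cvg_cst.
Qed.

(** If [x * m = c * m] then [m] is carried by [Re c]: for [z] real,
    [(z - Re c)^2 + (Im c)^2 = (z - c) (z - conj c)] is a multiple of [z - c], so
    that its product with [m] is zero, and it vanishes at no point other than
    [Re c]. *)
Lemma concentrated_of_test_functions (c : R[i]) :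
  (forall phi phi', test_function phi phi' ->
    cint m (fun z : R => z * phi z) = c * cint m phi) ->
  forall A, measurable A -> ~ A (Re c) -> m A = 0.
Proof.
move=> Zc.
have Zitv (u v : R) : cint m (fun z : R => z * \1_(`]u, v[%classic) z) =
    c * cint m \1_(`]u, v[%classic).
  have [/cvg_cint_test[phi [phi' [tphi cphi czphi]]]|vu] := ltP u v.
    apply: (complex_cvg_unique czphi); under eq_fun => k do rewrite (Zc _ _ (tphi k)).
    by apply: cvgM; [exact: cvg_cst | exact: cphi].
  have -> : `]u, v[%classic = set0 by rewrite set_itv_ge// bnd_simp -leNgt.
  rewrite indic0; under eq_fun do rewrite mulr0.
  by rewrite [X in _ = _ * X]cint0 cint0 mulr0.
move=> A mA ncA.
(* The cut-off [w n] keeps [z * f z] bounded; it is removed at the end. *)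
pose w (n : nat) : RR -> R := \1_(`](- n.+1%:R), n.+1%:R[%classic).
have bw n : bounded_measurable (w n).
  by apply: bounded_measurable_indic; exact: measurable_itvoo.
have bzw n : bounded_measurable (fun z : R => z * w n z).
  split; first by apply: measurable_funM => //; exact: (bw n).1.
  exists n.+1%:R => z; rewrite /w indicE; have [|_] := boolP (z \in _); last first.
    by rewrite mulr0 normr0.
  by rewrite inE/= in_itv/= -ltr_norml mulr1 => /ltW.
have ww n z : w n z * w n z = w n z.
  by rewrite /w indicE; case: (_ \in _); rewrite ?mulr1 ?mulr0.
have bM1 n h : bounded_measurable h ->
  bounded_measurable (fun z : R => z * w n z * h z) := bounded_measurableM (bzw n).
have bM0 n h : bounded_measurable h ->
  bounded_measurable (fun z : R => w n z * h z) := bounded_measurableM (bw n).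
have Zw n f : bounded_measurable f ->
    cint m (fun z : R => z * w n z * f z) = c * cint m (fun z => w n z * f z).
  move=> bf; pattern f; apply: bounded_measurable_itvoo_ind bf => {f}.
  - move=> u v _; have wE : (fun z => w n z * \1_(`]u, v[%classic) z) =
        \1_(`]Num.max (- n.+1%:R) u, Num.min n.+1%:R v[%classic) :> (RR -> R).
      by apply/funext => z; rewrite -setI_itvoo indicI.
    rewrite wE -Zitv -wE; congr cint; apply/funext => z; by rewrite mulrA.
  - move=> a f g bf bg fE gE.
    have -> : (fun z : R => z * w n z * (a * f z + g z)) =
      (fun z => a * (z * w n z * f z) + z * w n z * g z) by apply/funext => z; ring.
    have -> : (fun z => w n z * (a * f z + g z)) =
      (fun z => a * (w n z * f z) + w n z * g z) by apply/funext => z; ring.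
    rewrite !cint_lin ?fE ?gE; [ring | exact: bM0 | exact: bM0 | exact: bM1 | exact: bM1].
  - move=> f_ f M mf fM fE ff; have [mzw [B hB]] := bzw n; have [mw [B' hB']] := bw n.
    apply: (@complex_cvg_unique _ (fun k => cint m (fun z : R => z * w n z * f_ k z))).
      apply: (@cint_cvg _ _ _ _ _ _ (B * M)).
      + by move=> k; exact: measurable_funM.
      + by move=> k x; rewrite normrM ler_pM.
      + by move=> x; apply: cvgM; [exact: cvg_cst | exact: ff].
    under eq_fun do rewrite fE.
    apply: cvgM; first exact: cvg_cst.
    apply: (@cint_cvg _ _ _ _ _ _ (B' * M)).
    + by move=> k; exact: measurable_funM.
    + by move=> k x; rewrite normrM ler_pM.
    + by move=> x; apply: cvgM; [exact: cvg_cst | exact: ff].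
(* Multiplying twice by [z] expresses the integral of [q * f] by that of [f],
   with coefficient [c^2 - 2 (Re c) c + |c|^2 = 0]. *)
pose q (z : R) := (z - Re c) ^+ 2 + Im c ^+ 2.
have q0 z : 0 <= q z by rewrite addr_ge0 ?sqr_ge0.
have Qw n f : bounded_measurable f -> cint m (fun z => w n z * (q z * f z)) = 0.
  move=> bf; have bf1 := bM1 n _ bf; have bf0 := bM0 n _ bf.
  have E1 := Zw n _ bf; have E2 := Zw n _ bf1.
  have bf2 := bM1 n _ bf1.
  have E3 : cint m (fun z => w n z * (z * w n z * f z)) = cint m (fun z : R => z * w n z * f z).
    by congr cint; apply/funext => z; rewrite -[in RHS]ww; ring.
  have -> : (fun z => w n z * (q z * f z)) =
      (fun z => 1 * (z * w n z * (z * w n z * f z)) +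
        ((- 2 * Re c) * (z * w n z * f z) +
        ((Re c ^+ 2 + Im c ^+ 2) * (w n z * f z) + 0))).
    apply/funext => z.
    rewrite (_ : z * w n z * (z * w n z * f z) = z ^+ 2 * (w n z * w n z) * f z); last by ring.
    by rewrite ww /q; ring.
  have b0 : bounded_measurable ((fun=> 0) : RR -> R) by exact: bounded_measurable_cst.
  have bl := bounded_measurable_lin (Re c ^+ 2 + Im c ^+ 2) bf0 b0.
  rewrite !cint_lin//; last exact: bounded_measurable_lin.
  rewrite cint0 E2 E3 E1 addr0.
  rewrite -[RHS](mul0r (cint m (fun z => w n z * f z))) !mulrA -!mulrDl; congr (_ * _).
  case: (c) => x y; apply/eqP; rewrite eq_complex/=; apply/andP; split; apply/eqP; ring.
(* [1 / q] may be unbounded near [Re c], even on [A]; the regularised [q * g k]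
   stays between 0 and 1 and tends to 1 on [A], where [q] does not vanish. *)
pose g (k : nat) (z : R) := \1_A z * (q z + k.+1%:R^-1)^-1.
have qk z (k : nat) : 0 < q z + k.+1%:R^-1 by rewrite ltr_wpDl// invr_gt0 ltr0n.
have cq : continuous q.
  by move=> z; apply: cvgD; last exact: cvg_cst; rewrite expr2; apply: cvgM;
    (apply: cvgB; [exact: cvg_id | exact: cvg_cst]).
have mq : measurable_fun setT (q : RR -> R) := continuous_measurable_fun cq.
have bg k : bounded_measurable (g k : RR -> R).
  split.
    apply: measurable_funM; first exact: measurable_indic.
    apply: continuous_measurable_fun => z; apply: cvgV; first by rewrite gt_eqF.
    by apply: cvgD; [exact: cq | exact: cvg_cst].
  exists k.+1%:R => z; rewrite normrM -[leRHS]mul1r ler_pM//; first exact: norm_indic.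
  rewrite ger0_norm ?invr_ge0 ?(ltW (qk z k))// invf_ple ?posrE// ?ltr0n//.
  by rewrite lerDr.
have Aw n : cint m (fun z => w n z * \1_A z) = 0.
  apply: (@complex_cvg_unique _ (fun k => cint m (fun z => w n z * (q z * g k z)))); last first.
    by under eq_fun do rewrite Qw//; exact: cvg_cst.
  apply: (@cint_cvg _ _ _ _ _ _ 1).
  - move=> k; apply: measurable_funM; first exact: (bw n).1.
    by apply: measurable_funM => //; exact: (bg k).1.
  - move=> k z; rewrite normrM -[leRHS]mul1r ler_pM//; first exact: norm_indic.
    rewrite /g mulrCA normrM -[leRHS]mul1r ler_pM//; first exact: norm_indic.
    rewrite ger0_norm ?divr_ge0 ?(ltW (qk _ _))// ler_pdivrMr// mul1r.
    by rewrite lerDl invr_ge0.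
  - move=> z; apply: cvgM; first exact: cvg_cst.
    rewrite /g; have [zA|zA] := boolP (z \in A); last first.
      rewrite indicE (negbTE zA); under eq_fun do rewrite mul0r mulr0; exact: cvg_cst.
    rewrite indicE zA; under eq_fun do rewrite mul1r.
    have qz : q z != 0.
      rewrite /q paddr_eq0 ?sqr_ge0// !sqrf_eq0 negb_and subr_eq0.
      by apply/orP; left; apply: contraPneq ncA => <-; move: zA; rewrite inE => ? /(_ _).
    suff : q z / (q z + k.+1%:R^-1) @[k --> \oo] --> q z / q z by rewrite divff.
    apply: cvgM; first exact: cvg_cst.
    apply: cvgV => //; rewrite -[X in _ --> X]addr0; apply: cvgD; first exact: cvg_cst.
    exact: cvg_harmonic.
rewrite -cint_indic//.
apply: (@complex_cvg_unique _ (fun n => cint m (fun z => w n z * \1_A z))); last first.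
  by under eq_fun do rewrite Aw; exact: cvg_cst.
apply: (@cint_cvg _ _ _ _ _ _ 1).
- by move=> n; apply: measurable_funM; [exact: (bw n).1 | exact: measurable_indic].
- by move=> n z; rewrite normrM -[leRHS]mul1r ler_pM//; exact: norm_indic.
- move=> z; rewrite -[X in _ --> X]mul1r; apply: cvgM; last exact: cvg_cst.
  exact: cvg_indic_itvoo.
Qed.

End concentration.

Section dichotomy.
Context (R : realType).
Local Notation RR := (measurableTypeR R).
Variable m : {complex_measure set RR -> R[i]}.
Variables (K b : nat -> R[i]) (N : nat).
Hypothesis gauss_ode : forall n, (N <= n)%N -> forall z : R,
  cint m (fun y => dgauss n.+1%:R (z - y)) = (K n * z%:C + b n) * gconv m n.+1%:R z.

Let h n := gconv m n.+1%:R.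

Let s0 n : 0 < n.+1%:R :> R. Proof. by rewrite ltr0n. Qed.

Lemma gconv_by_parts phi phi' n : test_function phi phi' -> (N <= n)%N ->
  lebesgue_pairing phi' (h n) =
  - (K n * lebesgue_pairing (fun z : R => z * phi z) (h n) + b n * lebesgue_pairing phi (h n)).
Proof.
move=> tphi Nn; have [dh ddh] := gconv_derive m (s0 n).
have [cr ci] := is_cderive_continuous ddh; have [cr0 ci0] := is_cderive_continuous dh.
rewrite (lebesgue_pairing_by_parts tphi dh cr ci); congr (- _).
rewrite -lebesgue_pairing_affine//; last 2 first.
- exact: test_function_continuous tphi.
- by case: tphi.
by congr lebesgue_pairing; apply/funext => z; rewrite gauss_ode.
Qed.

(** Pairing the equation with two test functions gives a linear system for the
    coefficients [K n] and [b n], whose determinant and right-hand sides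
    converge as the averages converge to [m].  If the limit determinant vanishes
    for all test functions, then [x * m] is proportional to [m]. *)
Lemma dirac_or_cvg :
  (exists t : R, forall A, measurable A -> ~ A t -> m A = 0) \/
  (exists K0 b0 : R[i], (K : nat -> R[i]^o) @ \oo --> (K0 : R[i]^o) /\
                        (b : nat -> R[i]^o) @ \oo --> (b0 : R[i]^o)).
Proof.
pose I phi := cint m phi; pose Z (phi : R -> R) := cint m (fun z : R => z * phi z).
have [[f1 [f1' [f2 [f2' [t1 t2 d0]]]]]|nodet] := pselect (exists f1 f1' f2 f2',
    [/\ test_function f1 f1', test_function f2 f2' & Z f1 * I f2 - Z f2 * I f1 != 0]);
    last first.
  left; have [[f0 [f0' [t0 I0]]]|noI] := pselect (exists f f', test_function f f' /\ I f != 0);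
      last first.
    exists 0 => A mA _; apply: null_of_test_functions mA => f f' tf.
    by apply/eqP/negPn/negP => If; apply: noI; exists f, f'.
  exists (Re (Z f0 / I f0)); apply: concentrated_of_test_functions => f f' tf.
  have /eqP : Z f * I f0 - Z f0 * I f == 0.
    by apply/negPn/negP => d; apply: nodet; exists f, f', f0, f0'.
  move=> /subr0_eq e; apply: (mulIf I0); rewrite -/(Z f) e.
  by rewrite -/(I f) mulrAC divfK.
(* Cramer's rule, for the system given by [f1] and [f2]. *)
right.
pose q n : R[i] := (Num.sqrt n.+1%:R)%:C.
pose In f n : R[i] := q n * lebesgue_pairing f (h n).
pose Zn f := In (fun z : R => z * f z).
pose C : R[i] := (Num.sqrt pi)%:C.
have C0 : C != 0 by rewrite /C eq_complex/= gt_eqF ?sqrtr_gt0 ?pi_gt0.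
have cI f f' : test_function f f' -> (In f : nat -> R[i]^o) @ \oo --> (I f * C : R[i]^o).
  by move=> tf; apply: cvg_gconv; [exact: test_function_continuous tf | case: tf].
have cD f f' : test_function f f' -> (In f' : nat -> R[i]^o) @ \oo --> (I f' * C : R[i]^o).
  by move=> tf; apply: cvg_gconv; case: tf.
have cZ f f' : test_function f f' -> (Zn f : nat -> R[i]^o) @ \oo --> (Z f * C : R[i]^o).
  move=> tf; have cf := test_function_continuous tf; apply: cvg_gconv.
    by move=> z; apply: cvgM; [exact: cvg_id | exact: cf].
  by case: tf => _ _ [B hB] _; exists B => x /hB ->; rewrite mulr0.
have sys f f' n : test_function f f' -> (N <= n)%N ->
    In f' n = - (K n * Zn f n + b n * In f n).
  by move=> tf Nn; rewrite /Zn /In (gconv_by_parts tf Nn); ring.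
pose dt n := Zn f1 n * In f2 n - Zn f2 n * In f1 n.
pose dt0 := Z f1 * C * (I f2 * C) - Z f2 * C * (I f1 * C).
have cdt : (dt : nat -> R[i]^o) @ \oo --> (dt0 : R[i]^o).
  exact: (cvgB (cvgM (cZ _ _ t1) (cI _ _ t2)) (cvgM (cZ _ _ t2) (cI _ _ t1))).
have dt00 : dt0 != 0.
  have -> : dt0 = (Z f1 * I f2 - Z f2 * I f1) * (C * C) by rewrite /dt0; ring.
  by rewrite !mulf_neq0.
have ndt : \forall n \near \oo, dt n != 0 by exact: (cvgr_neq0 _ cdt dt00).
have nN : \forall n \near \oo, (N <= n)%N by exists N.
have cV : (fun n => (dt n)^-1 : R[i]^o) @ \oo --> (dt0^-1 : R[i]^o).
  exact: cvgV dt00 cdt.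
pose K0 := - (I f1' * C * (I f2 * C) - I f2' * C * (I f1 * C)) * dt0^-1.
pose b0 := - (I f2' * C * (Z f1 * C) - I f1' * C * (Z f2 * C)) * dt0^-1.
exists K0, b0; split.
- have cK : (fun n => - (In f1' n * In f2 n - In f2' n * In f1 n) * (dt n)^-1 : R[i]^o)
      @ \oo --> (K0 : R[i]^o).
    exact: (cvgM (cvgN (cvgB (cvgM (cD _ _ t1) (cI _ _ t2))
      (cvgM (cD _ _ t2) (cI _ _ t1)))) cV).
  apply: cvg_trans cK; apply: near_eq_cvg.
  apply: filterS2 nN ndt => n Nn dn; apply: (mulIf dn).
  rewrite /= [LHS]divfK// (sys _ _ _ t1 Nn) (sys _ _ _ t2 Nn) /dt.
  by ring.
- have cb : (fun n => - (In f2' n * Zn f1 n - In f1' n * Zn f2 n) * (dt n)^-1 : R[i]^o)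
      @ \oo --> (b0 : R[i]^o).
    exact: (cvgM (cvgN (cvgB (cvgM (cD _ _ t2) (cZ _ _ t1))
      (cvgM (cD _ _ t1) (cZ _ _ t2)))) cV).
  apply: cvg_trans cb; apply: near_eq_cvg.
  apply: filterS2 nN ndt => n Nn dn; apply: (mulIf dn).
  rewrite /= [LHS]divfK// (sys _ _ _ t1 Nn) (sys _ _ _ t2 Nn) /dt.
  by ring.
Qed.

End dichotomy.

Section gaussian_integrability.
Context (R : realType).
Local Notation leb := (@lebesgue_measure R).

(** Half of the negative leading coefficient absorbs the linear term by
    completing the square, and the other half is a dominating Gaussian. *)
Lemma integrable_expR_quadratic (a b c : R) : a < 0 ->
  leb.-integrable setT (EFin \o (fun x => expR (a * x ^+ 2 + b * x + c))).
Proof.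
move=> a0; pose r := Num.sqrt (- a / 2).
have r2 : r ^+ 2 = - a / 2 by rewrite sqr_sqrtr// divr_ge0// oppr_ge0 ltW.
have r0 : r != 0.
  by rewrite gt_eqF// sqrtr_gt0 divr_gt0// oppr_gt0.
pose C := expR (c - b ^+ 2 / (2 * a)).
have cq : continuous (fun x : R => expR (a * x ^+ 2 + b * x + c)).
  have d x := is_derive1_expR (is_derive1D (is_derive1D
    (is_derive1M (is_derive1_cst x a) (is_derive1M (is_derive1_id x) (is_derive1_id x)))
    (is_derive1M (is_derive1_cst x b) (is_derive1_id x))) (is_derive1_cst x c)).
  exact: is_derive1_continuous d.
have mg : measurable_fun setT (fun x : R => gauss_fun (0 + r * x)).
  exact: (measurableT_comp (@measurable_gauss_fun R) (measurable_affine _ _)).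
have ig : leb.-integrable setT (EFin \o (fun x => gauss_fun (0 + r * x))).
  apply/integrableP; split; first exact/measurable_EFinP.
  under eq_integral do rewrite gee0_abs ?lee_fin ?gauss_fun_ge0//.
  rewrite (@ge0_integral_affine R 0 r (EFin \o gauss_fun) r0).
  - by rewrite integralT_gauss -EFinM ltry.
  - by apply/measurable_EFinP; exact: measurable_gauss_fun.
  - by move=> x; rewrite lee_fin gauss_fun_ge0.
have := integrableZl measurableT C ig.
apply: le_integrable => //.
  apply/measurable_EFinP; exact: continuous_measurable_fun.
move=> x _; rewrite lee_fin /= !ger0_norm ?expR_ge0//; last first.
  by rewrite mulr_ge0 ?expR_ge0.
rewrite /C /gauss_fun -expRD ler_expR add0r exprMn r2.
rewrite -subr_ge0.
have -> : c - b ^+ 2 / (2 * a) + - (- a / 2 * x ^+ 2) - (a * x ^+ 2 + b * x + c) =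
    (- (2 * a))^-1 * (a * x + b) ^+ 2.
  by field; rewrite lt_eqF.
by rewrite mulr_ge0 ?sqr_ge0// invr_ge0 oppr_ge0; lra.
Qed.

End gaussian_integrability.

(** A nonzero factor can be absorbed in the constant term of an exponent. *)
Lemma cexp_surjective (R : realType) (z : R[i]) : z != 0 -> exists w, cexp w = z.
Proof.
case: z => x y z0.
have n0 : 0 < x ^+ 2 + y ^+ 2.
  rewrite lt_neqAle addr_ge0 ?sqr_ge0// andbT eq_sym paddr_eq0 ?sqr_ge0//.
  by move: z0; rewrite eq_complex/= !sqrf_eq0.
pose r := Num.sqrt (x ^+ 2 + y ^+ 2).
have r0 : 0 < r by rewrite sqrtr_gt0.
have r2 : r ^+ 2 = x ^+ 2 + y ^+ 2 by rewrite sqr_sqrtr// ltW.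
have xr : -1 <= x / r <= 1.
  rewrite -ler_norml normrM normfV (gtr0_norm r0) ler_pdivrMr// mul1r.
  by rewrite -(@ler_pXn2r _ 2) ?nnegrE ?(ltW r0)// r2 real_normK ?num_real// lerDl sqr_ge0.
have sE : sin (acos (x / r)) = `|y| / r.
  rewrite sin_acos// expr_div_n r2.
  have -> : 1 - x ^+ 2 / (x ^+ 2 + y ^+ 2) = (y / r) ^+ 2.
    by rewrite expr_div_n r2; field; rewrite gt_eqF.
  by rewrite sqrtr_sqr normrM normfV (gtr0_norm r0).
have [y0|y0] := leP 0 y.
  exists (ln r +i* acos (x / r)); rewrite /cexp/= lnK// acosK// sE ger0_norm//.
  by apply/eqP; rewrite eq_complex/=; apply/andP; split; apply/eqP; field; rewrite gt_eqF.
exists (ln r +i* (- acos (x / r))); rewrite /cexp/= lnK// cosN sinN acosK// sE ltr0_norm//.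
by apply/eqP; rewrite eq_complex/=; apply/andP; split; apply/eqP; field; rewrite gt_eqF.
Qed.

(** * Identification of the density *)

Section lebesgue_pairing_facts.
Context (R : realType).
Local Notation RR := (measurableTypeR R).
Local Notation leb := (@lebesgue_measure R).

Lemma Rintegral_dominated_cvg (u_ : nat -> RR -> R) (u g : RR -> R) :
  (forall n, measurable_fun setT (u_ n)) -> leb.-integrable setT (EFin \o g) ->
  (forall n x, `|u_ n x| <= g x) -> (forall x, u_ n x @[n --> \oo] --> u x) ->
  \int[leb]_x u_ n x @[n --> \oo] --> \int[leb]_x u x.
Proof.
move=> mu ig ug uu.
have mlim : measurable_fun setT u.
  by apply: (@measurable_fun_cvg _ _ _ _ u_) => // x _; exact: uu.
have iu : leb.-integrable setT (EFin \o u).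
  apply: le_integrable ig => //; first exact/measurable_EFinP.
  move=> x _; rewrite lee_fin; have /cvg_norm nu := uu x.
  rewrite -(cvg_lim _ nu)//; apply: limr_le; first exact: cvgP nu.
  by apply: nearW => n; apply: (le_trans (ug n x)); exact: ler_norm.
apply: fine_cvg; rewrite fineK; last exact: integrable_fin_num.
apply: (@dominated_cvg _ _ _ leb setT _ (fun n x => (u_ n x)%:E) _ (EFin \o g)) => //.
- by move=> n; exact/measurable_EFinP.
- by move=> x _; apply: cvg_EFin; [exact: nearW | exact: uu].
- by move=> n x _; rewrite lee_fin.
Qed.

Lemma integrable_indic_itvoo (p r : R) (u : R -> R) : continuous u ->
  leb.-integrable setT (EFin \o (fun z => \1_(`]p, r[%classic) z * u z)).
Proof.
move=> cu.
have -> : EFin \o (fun z => \1_(`]p, r[%classic) z * u z) = (EFin \o u) \_ `]p, r[%classic.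
  apply/funext => x; rewrite patchE /= indicE.
  by case: (_ \in _); rewrite ?mul1r ?mul0r.
apply: (iffLR (integrable_mkcond _ _)) => //.
have i1 : leb.-integrable `[p, r]%classic (EFin \o u).
  apply: (@continuous_compact_integrable R u `[p, r]%classic); first exact: segment_compact.
  exact: continuous_subspaceT.
by apply: integrableS i1 => //; exact: subset_itv_oo_cc.
Qed.

Lemma norm_Re_cexp_le (w : R[i]) : `|Re (cexp w)| <= expR (Re w).
Proof.
rewrite /cexp/= normrM ger0_norm ?expR_ge0// ler_piMr ?expR_ge0//.
exact: cos_max.
Qed.

Lemma norm_Im_cexp_le (w : R[i]) : `|Im (cexp w)| <= expR (Re w).
Proof.
rewrite /cexp/= normrM ger0_norm ?expR_ge0// ler_piMr ?expR_ge0//.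
exact: sin_max.
Qed.

Lemma expR_Re_le_cexp (w : R[i]) : expR (Re w) <= `|Re (cexp w)| + `|Im (cexp w)|.
Proof.
rewrite /cexp/= !normrM !(ger0_norm (expR_ge0 _)) -mulrDr ler_peMr ?expR_ge0//.
have := cos2Dsin2 (Im w); have := cos_max (Im w); have := sin_max (Im w).
rewrite -(real_normK (num_real (cos _))) -(real_normK (num_real (sin _))).
by have := normr_ge0 (cos (Im w)); have := normr_ge0 (sin (Im w)); nra.
Qed.

(** The primitive of [K z + b] that vanishes at 0. *)
Definition gaussian_exponent (K b : R[i]) (z : R) : R[i] :=
  K * (z ^+ 2 / 2)%:C + b * z%:C.

Lemma Re_gaussian_exponent K b z :
  Re (gaussian_exponent K b z) = Re K * (z ^+ 2 / 2) + Re b * z.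
Proof. by rewrite /gaussian_exponent ReD !ReM/= !mulr0 !subr0. Qed.

Lemma Im_gaussian_exponent K b z :
  Im (gaussian_exponent K b z) = Im K * (z ^+ 2 / 2) + Im b * z.
Proof. by rewrite /gaussian_exponent ImD !ImM/= !mulr0 !add0r. Qed.

Lemma is_cderive_gaussian_exponent K b (z : R) :
  is_cderive z (gaussian_exponent K b) (K * z%:C + b).
Proof.
have d2 : is_derive z (1 : R) (fun t : R => t ^+ 2 / 2) z.
  apply: is_derive1_eq (is_derive1M (is_derive1M (is_derive1_id z) (is_derive1_id z))
    (is_derive1_cst z 2^-1)) _.
  by field.
apply: is_cderive_eq (is_cderiveD (is_cderiveZ K (is_cderive_real d2))
  (is_cderiveZ b (is_cderive_real (is_derive1_id z)))) _.
by rewrite mulr1.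
Qed.

Lemma continuous_gaussian K b :
  continuous (fun z => Re (cexp (gaussian_exponent K b z))) /\
  continuous (fun z => Im (cexp (gaussian_exponent K b z))).
Proof.
exact: is_cderive_continuous (fun z => is_cderive_cexp (is_cderive_gaussian_exponent K b z)).
Qed.

(** Uniqueness for [h' = (K z + b) h]: the product of [h] with the inverse of the
    exponential is constant. *)
Lemma gaussian_of_ode (h : R -> R[i]) (K b : R[i]) :
  (forall z, is_cderive z h ((K * z%:C + b) * h z)) ->
  forall z, h z = h 0 * cexp (gaussian_exponent K b z).
Proof.
move=> dh z; pose E t := cexp (- 1 * gaussian_exponent K b t).
have D t : is_cderive t (fun t => h t * E t) 0.
  have dE := is_cderive_cexp (is_cderiveZ (- 1) (is_cderive_gaussian_exponent K b t)).
  by apply: is_cderive_eq (is_cderiveM (dh t) dE) _; ring.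
have E0 : E 0 = 1.
  rewrite /E /gaussian_exponent expr0n/= mul0r !mulr0 addr0 mulr0 /cexp/=.
  by rewrite expR0 cos0 sin0 mulr1 mulr0.
have := cderive0_cst D z 0; rewrite E0 mulr1 => <-.
rewrite -mulrA -cexpD mulN1r addNr.
have -> : cexp (0 : R[i]) = 1 by rewrite /cexp/= expR0 cos0 sin0 mulr1 mulr0.
by rewrite mulr1.
Qed.

Lemma lebesgue_pairing_cvg (f_ : nat -> RR -> R) (f g : RR -> R) (h : R -> R[i]) :
  continuous (fun t => Re (h t)) -> continuous (fun t => Im (h t)) ->
  (forall n, measurable_fun setT (f_ n)) -> (forall n x, `|f_ n x| <= g x) ->
  leb.-integrable setT (EFin \o (fun z => g z * `|Re (h z)|)) ->
  leb.-integrable setT (EFin \o (fun z => g z * `|Im (h z)|)) ->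
  (forall x, f_ n x @[n --> \oo] --> f x) ->
  (fun n => lebesgue_pairing (f_ n) h : R[i]^o) @ \oo --> (lebesgue_pairing f h : R[i]^o).
Proof.
move=> cr ci mf fg ir ii ff.
apply: cvg_complex.
  apply: Rintegral_dominated_cvg ir _ _.
  - by move=> n; apply: measurable_funM => //; exact: continuous_measurable_fun.
  - by move=> n x; rewrite normrM ler_wpM2r.
  - by move=> x; apply: cvgM; [exact: ff | exact: cvg_cst].
apply: Rintegral_dominated_cvg ii _ _.
- by move=> n; apply: measurable_funM => //; exact: continuous_measurable_fun.
- by move=> n x; rewrite normrM ler_wpM2r.
- by move=> x; apply: cvgM; [exact: ff | exact: cvg_cst].
Qed.

(** On the support of [phi] the exponents are bounded uniformly in [n], because
    convergent sequences are bounded. *)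
Lemma lebesgue_pairing_gaussian_cvg (K b : nat -> R[i]) (K0 b0 : R[i]) (phi : R -> R) :
  (K : nat -> R[i]^o) @ \oo --> (K0 : R[i]^o) ->
  (b : nat -> R[i]^o) @ \oo --> (b0 : R[i]^o) ->
  continuous phi -> compactly_supported phi ->
  (fun n => lebesgue_pairing phi (fun z => cexp (gaussian_exponent (K n) (b n) z)) : R[i]^o)
   @ \oo --> (lebesgue_pairing phi (fun z => cexp (gaussian_exponent K0 b0 z)) : R[i]^o).
Proof.
move=> KK bb cphi [B phiB].
have rK := cvg_Re KK; have iK := cvg_Im KK; have rb := cvg_Re bb; have ib := cvg_Im bb.
have [C hC] : exists C, forall n, `|Re (K n)| <= C /\ `|Re (b n)| <= C.
  have /cvg_seq_bounded[C1 [_ h1]] : cvgn (fun n => Re (K n)) by exact: cvgP rK.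
  have /cvg_seq_bounded[C2 [_ h2]] : cvgn (fun n => Re (b n)) by exact: cvgP rb.
  exists (Num.max (C1 + 1) (C2 + 1)) => n; rewrite !le_max; split; apply/orP; [left|right].
    by apply: (h1 (C1 + 1)) => //; rewrite ltrDl.
  by apply: (h2 (C2 + 1)) => //; rewrite ltrDl.
have C0 : 0 <= C by have [+ _] := hC 0%N; exact: le_trans.
pose M := expR (C * (B ^+ 2 / 2) + C * B).
have hM n z : `|phi z| * expR (Re (gaussian_exponent (K n) (b n) z)) <= M * `|phi z|.
  have [zB|Bz] := leP `|z| B; last by rewrite phiB// normr0 mulr0 mul0r.
  rewrite mulrC ler_wpM2r// ler_expR Re_gaussian_exponent.
  have [hK hb] := hC n.
  have z2 : z ^+ 2 <= B ^+ 2.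
    by rewrite -(real_normK (num_real z)) ler_pXn2r// nnegrE ?(le_trans _ zB).
  have z20 : 0 <= z ^+ 2 / 2 by rewrite divr_ge0 ?sqr_ge0.
  apply: lerD.
    apply: (@le_trans _ _ (C * (z ^+ 2 / 2))).
      by rewrite ler_wpM2r// (le_trans (ler_norm _)).
    by rewrite ler_wpM2l//; lra.
  by rewrite (le_trans (ler_norm _))// normrM ler_pM.
have iphi : leb.-integrable setT (EFin \o (fun z => M * `|phi z|)).
  have := integrable_norm (compactly_supported_integrable cphi (ex_intro _ B phiB)).
  by move=> /(integrableZl measurableT M).
have cre z : Re (gaussian_exponent (K n) (b n) z) @[n --> \oo] -->
    Re (gaussian_exponent K0 b0 z).
  rewrite Re_gaussian_exponent; under eq_fun do rewrite Re_gaussian_exponent.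
  by apply: cvgD; apply: cvgM => //; exact: cvg_cst.
have cim z : Im (gaussian_exponent (K n) (b n) z) @[n --> \oo] -->
    Im (gaussian_exponent K0 b0 z).
  rewrite Im_gaussian_exponent; under eq_fun do rewrite Im_gaussian_exponent.
  by apply: cvgD; apply: cvgM => //; exact: cvg_cst.
have cexp_re z : expR (Re (gaussian_exponent (K n) (b n) z)) @[n --> \oo] -->
    expR (Re (gaussian_exponent K0 b0 z)).
  exact: (continuous_cvg _ (@continuous_expR R _) (cre z)).
have cos_im z : cos (Im (gaussian_exponent (K n) (b n) z)) @[n --> \oo] -->
    cos (Im (gaussian_exponent K0 b0 z)).
  exact: (continuous_cvg _ (@continuous_cos R _) (cim z)).
have sin_im z : sin (Im (gaussian_exponent (K n) (b n) z)) @[n --> \oo] -->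
    sin (Im (gaussian_exponent K0 b0 z)).
  exact: (continuous_cvg _ (@continuous_sin R _) (cim z)).
have mphi : measurable_fun setT (phi : RR -> R) := continuous_measurable_fun cphi.
apply: cvg_complex.
  apply: Rintegral_dominated_cvg iphi _ _.
  - move=> n; apply: measurable_funM => //.
    exact: continuous_measurable_fun (continuous_gaussian _ _).1.
  - move=> n x; rewrite normrM (le_trans _ (hM n x))// ler_wpM2l//.
    exact: norm_Re_cexp_le.
  - by move=> x; apply: cvgM; [exact: cvg_cst | exact: cvgM].
apply: Rintegral_dominated_cvg iphi _ _.
- move=> n; apply: measurable_funM => //.
  exact: continuous_measurable_fun (continuous_gaussian _ _).2.
- move=> n x; rewrite normrM (le_trans _ (hM n x))// ler_wpM2l//.
  exact: norm_Im_cexp_le.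
- by move=> x; apply: cvgM; [exact: cvg_cst | exact: cvgM].
Qed.

End lebesgue_pairing_facts.

Section density.
Context (R : realType).
Local Notation RR := (measurableTypeR R).
Local Notation leb := (@lebesgue_measure R).
Variable m : {complex_measure set RR -> R[i]}.

Lemma Rintegral_indic_itvoo (p r : R) : p <= r ->
  \int[leb]_x (\1_(`]p, r[%classic) x : R) = r - p.
Proof.
move=> pr; rewrite /Rintegral integral_indic//.
rewrite setIT/= lebesgue_measure_itv/= lte_fin; move: pr; rewrite le_eqVlt => /predU1P[->|->//].
by rewrite ltxx subrr.
Qed.

Lemma lebesgue_pairing_test_cvg (u v : R) (e : R -> R[i]) (phi : nat -> R -> R) :
  continuous (fun t => Re (e t)) -> continuous (fun t => Im (e t)) ->
  (forall k, continuous (phi k)) -> (forall k z, `|phi k z| <= 1) ->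
  (forall k z, z \notin `]u, v[ -> phi k z = 0) ->
  (forall z, phi k z @[k --> \oo] --> (\1_(`]u, v[%classic) z : R)) ->
  (fun k => lebesgue_pairing (phi k) e : R[i]^o) @ \oo -->
    (lebesgue_pairing \1_(`]u, v[%classic) e : R[i]^o).
Proof.
move=> cr ci cphi phi1 phi0 phiE.
apply: (@lebesgue_pairing_cvg _ _ _ \1_(`]u, v[%classic)) => //.
- by move=> n; exact: continuous_measurable_fun.
- move=> n x; rewrite indicE; have [xuv|xuv] := boolP (x \in `]u, v[%classic).
    exact: phi1.
  by rewrite phi0 ?normr0//; apply/negP; move: xuv; rewrite notin_setE.
- by apply: integrable_indic_itvoo => t; apply: cvg_norm; exact: cr.
- by apply: integrable_indic_itvoo => t; apply: cvg_norm; exact: ci.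
Qed.

Section of_test_functions.
Variable e : R -> R[i].
Hypotheses (cr : continuous (fun t => Re (e t))) (ci : continuous (fun t => Im (e t))).
Hypothesis mtest : forall phi phi', test_function phi phi' ->
  cint m phi = lebesgue_pairing phi e.

Let mitv (u v : R) :
  cint m \1_(`]u, v[%classic) = lebesgue_pairing \1_(`]u, v[%classic) e.
Proof.
have [uv|vu] := ltP u v; last first.
  have -> : `]u, v[%classic = set0 by rewrite set_itv_ge// bnd_simp -leNgt.
  rewrite indic0 cint0 /lebesgue_pairing.
  under eq_Rintegral do rewrite mul0r.
  under [X in _ +i* X]eq_Rintegral do rewrite mul0r.
  by rewrite Rintegral_cst// mul0r.
have [phi [phi' [tphi phi1 phi0 phiE]]] := test_function_indic_itvoo uv.
have cphi k := test_function_continuous (tphi k).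
apply: (@complex_cvg_unique _ (fun k => cint m (phi k))).
  by apply: (@cint_cvg _ _ _ _ _ _ 1) => // k; exact: continuous_measurable_fun.
under eq_fun => k do rewrite (mtest (tphi k)).
exact: lebesgue_pairing_test_cvg.
Qed.

Let bounded_integrable (p r M : R) (f : RR -> R) (u : R -> R) :
  measurable_fun setT f -> (forall x, `|f x| <= M) -> continuous u ->
  leb.-integrable setT (EFin \o (fun z => \1_(`]p, r[%classic) z * f z * u z)).
Proof.
move=> mf fM cu.
have cn : continuous (fun z => `|u z|) by move=> t; apply: cvg_norm; exact: cu.
have i1 : leb.-integrable setT (EFin \o (fun z => M * (\1_(`]p, r[%classic) z * `|u z|))).
  by have := integrableZl measurableT M (integrable_indic_itvoo p r cn).
apply: le_integrable i1 => //.
  apply/measurable_EFinP; apply: measurable_funM; last exact: continuous_measurable_fun.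
  by apply: measurable_funM => //; apply: measurable_indic; exact: measurable_itvoo.
move=> x _; rewrite lee_fin !normrM normr_id -mulrA mulrCA mulrCA.
rewrite [leRHS]mulrCA ler_wpM2l// [leLHS]mulrC.
by rewrite mulrC ler_wpM2r// (le_trans (fM x))// ler_norm.
Qed.

(** The density is not yet known to be integrable on the line, so test functions
    determine [m] first on bounded intervals. *)
Lemma density_on_itvoo (p r : R) (f : RR -> R) : bounded_measurable f ->
  cint m (fun z => \1_(`]p, r[%classic) z * f z) =
  lebesgue_pairing (fun z => \1_(`]p, r[%classic) z * f z) e.
Proof.
have bw : bounded_measurable (\1_(`]p, r[%classic) : RR -> R).
  by apply: bounded_measurable_indic; exact: measurable_itvoo.
move=> bf; pattern f; apply: bounded_measurable_itvoo_ind bf => {f}.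
- move=> u v _; have -> : (fun z => \1_(`]p, r[%classic) z * \1_(`]u, v[%classic) z) =
      \1_(`]Num.max p u, Num.min r v[%classic) :> (RR -> R).
    by apply/funext => z; rewrite -setI_itvoo indicI.
  exact: mitv.
- move=> a f g bf bg fE gE.
  have [mf [M fM]] := bf; have [mg [M' gM]] := bg.
  have -> : (fun z => \1_(`]p, r[%classic) z * (a * f z + g z)) =
      (fun z => a * (\1_(`]p, r[%classic) z * f z) + \1_(`]p, r[%classic) z * g z) :> (RR -> R).
    by apply/funext => z; ring.
  rewrite cint_lin; [ | exact: bounded_measurableM..].
  rewrite fE gE /lebesgue_pairing.
  have lin (u : R -> R) : continuous u ->
      \int[leb]_z ((a * (\1_(`]p, r[%classic) z * f z) + \1_(`]p, r[%classic) z * g z) * u z) =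
      a * \int[leb]_z (\1_(`]p, r[%classic) z * f z * u z) +
      \int[leb]_z (\1_(`]p, r[%classic) z * g z * u z).
    move=> cu; have i1 := bounded_integrable p r mf fM cu.
    have i2 := bounded_integrable p r mg gM cu.
    rewrite -RintegralZl// -RintegralD//; last exact: (integrableZl measurableT a i1).
    by apply: eq_Rintegral => z _; ring.
  rewrite (lin _ cr) (lin _ ci); apply/eqP; rewrite eq_complex/=.
  by apply/andP; split; apply/eqP; ring.
- move=> f_ f M mf fM fE ff.
  apply: (@complex_cvg_unique _ (fun k => cint m (fun z => \1_(`]p, r[%classic) z * f_ k z))).
    apply: (@cint_cvg _ _ _ _ _ _ (1 * M)).
    + by move=> k; apply: measurable_funM => //; exact: bw.1.
    + by move=> k x; rewrite normrM ler_pM// norm_indic.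
    + by move=> x; apply: cvgM; [exact: cvg_cst | exact: ff].
  under eq_fun do rewrite fE.
  apply: (@lebesgue_pairing_cvg _ _ _ (fun z => \1_(`]p, r[%classic) z * M)) => //.
  + by move=> k; apply: measurable_funM => //; exact: bw.1.
  + move=> k x; rewrite normrM ger0_norm; first by rewrite ler_wpM2l.
    by rewrite indicE.
  + apply: (@bounded_integrable p r `|M| (fun=> M)) => // t; apply: cvg_norm; exact: cr.
  + apply: (@bounded_integrable p r `|M| (fun=> M)) => // t; apply: cvg_norm; exact: ci.
  + by move=> x; apply: cvgM; [exact: cvg_cst | exact: ff].
Qed.

Let charge_integral_bounded (nu : {charge set RR -> \bar R}) :
  exists C, forall f, bounded_measurable f -> (forall x, `|f x| <= 1) ->
    `|charge_integral nu f| <= C.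
Proof.
exists (\int[charge_pos nu]_x 1 + \int[charge_neg nu]_x 1) => f bf f1.
apply: (le_trans (ler_normB _ _)).
have le1 (mu : {finite_measure set RR -> \bar R}) : `|\int[mu]_x f x| <= \int[mu]_x 1.
  have i := bounded_measurable_integrable mu bf.
  apply: (le_trans (le_normr_Rintegral _ i)) => //.
  apply: le_Rintegral => //; first exact: integrable_norm.
  exact: bounded_measurable_integrable (bounded_measurable_cst _ 1).
by rewrite lerD.
Qed.

(** Testing against the signs of the real and imaginary parts bounds the mass on
    any interval by the total variation of [m]. *)
Lemma density_bounded_mass : exists C, forall p r : R,
  \int[leb]_z (\1_(`]p, r[%classic) z * (`|Re (e z)| + `|Im (e z)|)) <= C.
Proof.
have [C1 hC1] := charge_integral_bounded (charge_Re m).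
have [C2 hC2] := charge_integral_bounded (charge_Im m).
exists (C1 + C2) => p r.
have bw : bounded_measurable (\1_(`]p, r[%classic) : RR -> R).
  by apply: bounded_measurable_indic; exact: measurable_itvoo.
have sgn (u : R -> R) : continuous u -> exists s : RR -> R, [/\ bounded_measurable s,
    forall z, `|s z| <= 1 & forall z, s z * u z = `|u z| ].
  move=> cu; have mu : measurable_fun setT (u : RR -> R) := continuous_measurable_fun cu.
  have mS : measurable (u @^-1` `[0, +oo[ : set RR).
    by rewrite -[X in measurable X]setTI; apply: mu => //; exact: measurable_itv.
  exists (fun z => 2 * \1_(u @^-1` `[0, +oo[) z - 1); split.
  - apply: (@bounded_measurable_lin _ _ _ 2 _ (fun=> - 1)).
      exact: bounded_measurable_indic.
    exact: bounded_measurable_cst.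
  - move=> z; rewrite indicE; case: (_ \in _); rewrite ?mulr0 ?mulr1 ?sub0r ?normrN ?normr1//.
    by rewrite (_ : 2 - 1 = 1) ?normr1//; ring.
  - move=> z; rewrite indicE; have [zS|zS] := boolP (_ \in _).
      move: zS; rewrite inE/= in_itv/= andbT => uz; rewrite ger0_norm//; ring.
    move: zS; rewrite notin_setE/= in_itv/= andbT => /negP; rewrite -ltNge => uz.
    by rewrite ltr0_norm//; ring.
have [s1 [bs1 s11 s1E]] := sgn _ cr; have [s2 [bs2 s21 s2E]] := sgn _ ci.
have nu1 (s : RR -> R) x : (forall z, `|s z| <= 1) -> `|\1_(`]p, r[%classic) x * s x| <= 1.
  by move=> s_le; rewrite normrM -[leRHS]mul1r ler_pM// norm_indic.
have E1 := density_on_itvoo p r bs1.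
have E2 := density_on_itvoo p r bs2.
have B1 := hC1 _ (bounded_measurableM bw bs1) (fun x => nu1 _ x s11).
have B2 := hC2 _ (bounded_measurableM bw bs2) (fun x => nu1 _ x s21).
move: E1 => /(congr1 (fun z => Re z)); rewrite /cint /lebesgue_pairing /= => E1.
move: E2 => /(congr1 (fun z => Im z)); rewrite /cint /lebesgue_pairing /= => E2.
have -> : \int[leb]_z (\1_(`]p, r[%classic) z * (`|Re (e z)| + `|Im (e z)|)) =
    \int[leb]_z (\1_(`]p, r[%classic) z * s1 z * Re (e z)) +
    \int[leb]_z (\1_(`]p, r[%classic) z * s2 z * Im (e z)).
  rewrite -RintegralD//.
  - by apply: eq_Rintegral => z _; rewrite -s1E -s2E; ring.
  - exact: bounded_integrable bs1.1 s11 cr.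
  - exact: bounded_integrable bs2.1 s21 ci.
rewrite -E1 -E2; apply: lerD; [exact: le_trans (ler_norm _) B1 | exact: le_trans (ler_norm _) B2].
Qed.

Lemma density_of_integrable :
  leb.-integrable setT (EFin \o (fun z => `|Re (e z)|)) ->
  leb.-integrable setT (EFin \o (fun z => `|Im (e z)|)) ->
  eq_on_measurable m (density_measure leb e).
Proof.
move=> ir ii A mA.
have bA : bounded_measurable (\1_A : RR -> R) by exact: bounded_measurable_indic.
have -> : density_measure leb e A = lebesgue_pairing \1_A e.
  rewrite /density_measure /cRintegral /lebesgue_pairing.
  by congr (_ +i* _); rewrite Rintegral_mkcond; apply: eq_Rintegral => z _;
    rewrite patchE indicE; case: (_ \in _); rewrite ?mul1r ?mul0r.
rewrite -cint_indic//.
pose w (n : nat) : RR -> R := \1_(`](- n.+1%:R), n.+1%:R[%classic).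
have cw x : w n x * \1_A x @[n --> \oo] --> (\1_A x : R).
  by rewrite -[X in _ --> X]mul1r; apply: cvgM; [exact: cvg_indic_itvoo | exact: cvg_cst].
have mw n : measurable_fun setT (fun z => w n z * \1_A z).
  by apply: measurable_funM; [apply: measurable_indic; exact: measurable_itvoo | exact: bA.1].
have w1 n x : `|w n x * \1_A x| <= 1 by rewrite normrM -[leRHS]mul1r ler_pM// norm_indic.
apply: (@complex_cvg_unique _ (fun n => cint m (fun z => w n z * \1_A z))).
  exact: (@cint_cvg _ _ _ _ _ _ 1).
under eq_fun do rewrite density_on_itvoo//.
apply: (@lebesgue_pairing_cvg _ _ _ (fun=> 1)) => //.
- by under eq_fun do rewrite mul1r.
- by under eq_fun do rewrite mul1r.
Qed.

End of_test_functions.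

End density.

Section gaussian_limit.
Context (R : realType).
Local Notation RR := (measurableTypeR R).
Local Notation leb := (@lebesgue_measure R).

Lemma lebesgue_pairingZ (phi : R -> R) (h : R -> R[i]) (c : R[i]) :
  continuous phi -> compactly_supported phi ->
  continuous (fun t => Re (h t)) -> continuous (fun t => Im (h t)) ->
  lebesgue_pairing phi (fun z => c * h z) = c * lebesgue_pairing phi h.
Proof.
move=> cphi sphi cr ci; have := @lebesgue_pairing_affine R phi h 0 c cphi sphi cr ci.
by rewrite mul0r add0r => <-; congr lebesgue_pairing; apply/funext => z;
  rewrite mul0r add0r.
Qed.

Lemma integrable_itvoo (p r : R) :
  leb.-integrable setT (EFin \o (\1_(`]p, r[%classic) : RR -> R)).
Proof.
have -> : \1_(`]p, r[%classic) = (fun z => \1_(`]p, r[%classic) z * 1) :> (RR -> R).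
  by apply/funext => z; rewrite mulr1.
by apply: (@integrable_indic_itvoo _ _ _ (fun=> 1)) => t; exact: cvg_cst.
Qed.

(** The exponential has real part close to 1 near 0, so bumps converging to the
    indicator of a small interval eventually pair to a nonzero number. *)
Lemma exists_test_gaussian (K b : R[i]) : exists phi phi', test_function phi phi' /\
  lebesgue_pairing phi (fun z => cexp (gaussian_exponent K b z)) != 0.
Proof.
have [cr ci] := continuous_gaussian K b.
set E := fun z => cexp (gaussian_exponent K b z).
have E0 : Re (E 0) = 1.
  by rewrite /E /gaussian_exponent expr0n/= mul0r !mulr0 addr0 /cexp/= expR0 cos0 mulr1.
have h2 : 0 < 2^-1 :> R by rewrite invr_gt0.
have /cvgrPdist_lt/(_ _ h2)[d /= d0 hd] := cr 0.
have dd : - d < d by lra.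
have [phi [phi' [tphi phi1 phi0 phiE]]] := test_function_indic_itvoo dd.
apply: contrapT => none.
have z0 k : lebesgue_pairing (phi k) E = 0.
  by apply/eqP/negPn/negP => nz; apply: none; exists (phi k), (phi' k).
have lim := lebesgue_pairing_test_cvg cr ci (fun k => test_function_continuous (tphi k))
  phi1 phi0 phiE.
have lim0 : lebesgue_pairing \1_(`]- d, d[%classic) E = 0.
  apply: (complex_cvg_unique lim); rewrite -/E; under eq_fun do rewrite z0.
  exact: cvg_cst.
have : \int[leb]_z (\1_(`]- d, d[%classic) z * 2^-1) <=
    \int[leb]_z (\1_(`]- d, d[%classic) z * Re (E z)).
  apply: le_Rintegral => //.
  - by apply: (@integrable_indic_itvoo _ _ _ (fun=> 2^-1)) => t; exact: cvg_cst.
  - exact: integrable_indic_itvoo.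
  - move=> z _; rewrite indicE; have [zd|_] := boolP (_ \in _); last by rewrite !mul0r.
    rewrite !mul1r; have : ball_ (fun x : R => `|x|) 0 d z.
      by move: zd; rewrite inE/= in_itv/= sub0r normrN ltr_norml.
    move=> /hd hdz; have : `|Re (E 0) - Re (E z)| < 2^-1 := hdz.
    rewrite E0 ltr_norml => /andP[_]; lra.
have -> : \int[leb]_z (\1_(`]- d, d[%classic) z * Re (E z)) = 0.
  by move: lim0 => /(congr1 (fun z => Re z)).
rewrite RintegralZr//; last exact: integrable_itvoo.
rewrite Rintegral_indic_itvoo; last exact: ltW.
by rewrite opprK mulrDl -splitr leNgt d0.
Qed.

Variable m : {complex_measure set RR -> R[i]}.
Variables (K b : nat -> R[i]) (N : nat) (K0 b0 : R[i]).
Hypothesis gauss_ode : forall n, (N <= n)%N -> forall z : R,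
  cint m (fun y => dgauss n.+1%:R (z - y)) = (K n * z%:C + b n) * gconv m n.+1%:R z.
Hypothesis cK : (K : nat -> R[i]^o) @ \oo --> (K0 : R[i]^o).
Hypothesis cb : (b : nat -> R[i]^o) @ \oo --> (b0 : R[i]^o).
Hypothesis m_neq0 : ~ forall A, measurable A -> m A = 0.

Let E z := cexp (gaussian_exponent K0 b0 z).

(** The averages are [h 0] times normalised exponentials, which converge against
    test functions; so does their product, to [m].  A test function with nonzero
    limit pairing then forces the scalar factors to converge, too. *)
Let limit_density : exists k : R[i], forall phi phi', test_function phi phi' ->
  cint m phi = lebesgue_pairing phi (fun z => k * E z).
Proof.
have [cr ci] := continuous_gaussian K0 b0.
pose q n : R[i] := (Num.sqrt n.+1%:R)%:C.
pose C : R[i] := (Num.sqrt pi)%:C.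
have C0 : C != 0 by rewrite /C eq_complex/= gt_eqF ?sqrtr_gt0 ?pi_gt0.
pose h0 n := q n * gconv m n.+1%:R 0.
pose L phi n := lebesgue_pairing phi (fun z => cexp (gaussian_exponent (K n) (b n) z)).
have qE phi n : (N <= n)%N -> continuous phi -> compactly_supported phi ->
    q n * lebesgue_pairing phi (gconv m n.+1%:R) = h0 n * L phi n.
  move=> Nn cphi sphi; have s0 : 0 < n.+1%:R :> R by rewrite ltr0n.
  have [dh _] := gconv_derive m s0.
  have ode z : is_cderive z (gconv m n.+1%:R) ((K n * z%:C + b n) * gconv m n.+1%:R z).
    by rewrite -gauss_ode.
  have -> : gconv m n.+1%:R =
      (fun z => gconv m n.+1%:R 0 * cexp (gaussian_exponent (K n) (b n) z)).
    by apply/funext => z; exact: gaussian_of_ode ode z.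
  have [crn cin] := continuous_gaussian (K n) (b n).
  rewrite (lebesgue_pairingZ _ cphi sphi crn cin) /h0 /L -mulrA; congr (_ * (_ * _)).
have nN : \forall n \near \oo, (N <= n)%N by exists N.
have climit phi : continuous phi -> compactly_supported phi ->
    (fun n => h0 n * L phi n : R[i]^o) @ \oo --> (cint m phi * C : R[i]^o).
  move=> cphi sphi.
  have cg : (fun n => q n * lebesgue_pairing phi (gconv m n.+1%:R) : R[i]^o) @ \oo -->
      (cint m phi * C : R[i]^o) by exact: cvg_gconv.
  apply: cvg_trans cg.
  by apply: near_eq_cvg; apply: filterS nN => n Nn /=; rewrite -qE.
have cL phi : continuous phi -> compactly_supported phi ->
    (L phi : nat -> R[i]^o) @ \oo --> (lebesgue_pairing phi E : R[i]^o).
  by move=> cphi sphi; exact: lebesgue_pairing_gaussian_cvg.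
have [f [f' [tf f0]]] := exists_test_gaussian K0 b0.
have cf := test_function_continuous tf; have sf : compactly_supported f by case: tf.
pose kap := cint m f * C * (lebesgue_pairing f E)^-1.
have ch0 : (h0 : nat -> R[i]^o) @ \oo --> (kap : R[i]^o).
  have cV : (fun n => (L f n)^-1 : R[i]^o) @ \oo --> ((lebesgue_pairing f E)^-1 : R[i]^o).
    exact: (cvgV f0 (cL f cf sf)).
  have cq : (fun n => h0 n * L f n * (L f n)^-1 : R[i]^o) @ \oo --> (kap : R[i]^o).
    exact: (cvgM (climit f cf sf) cV).
  apply: cvg_trans cq; apply: near_eq_cvg.
  have nL : \forall n \near \oo, L f n != 0 by exact: (cvgr_neq0 _ (cL f cf sf) f0).
  by apply: filterS nL => n Ln; rewrite mulfK.
exists (kap / C) => phi phi' tphi.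
have cphi := test_function_continuous tphi; have sphi : compactly_supported phi by case: tphi.
rewrite lebesgue_pairingZ//; apply: (mulIf C0).
rewrite mulrAC divfK//.
apply: (complex_cvg_unique (climit phi cphi sphi)).
exact: (cvgM ch0 (cL phi cphi sphi)).
Qed.

(** If [Re K0 >= 0] then the density has modulus at least [e^(Re c)] on the half
    line where [Re b0 * z >= 0], contradicting the finiteness of its mass. *)
Lemma gaussian_of_convergent : exists c : R[i], Re K0 < 0 /\
  eq_on_measurable m (density_measure leb
    (fun x : R => cexp (K0 * (2^-1)%:C * (x ^+ 2)%:C + b0 * x%:C + c))).
Proof.
have [k mk] := limit_density; have [cr ci] := continuous_gaussian K0 b0.
have k0 : k != 0.
  apply/eqP => k0; apply: m_neq0; apply: null_of_test_functions => phi phi' tphi.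
  rewrite (mk _ _ tphi) k0 lebesgue_pairingZ ?mul0r//.
    exact: test_function_continuous tphi.
  by case: tphi.
have [c ck] := cexp_surjective k0; exists c.
pose e z := cexp (gaussian_exponent K0 b0 z + c).
have eE : (fun z => k * E z) = e by apply/funext => z; rewrite /e cexpD ck mulrC.
have [cre cie] : continuous (fun t => Re (e t)) /\ continuous (fun t => Im (e t)).
  apply: is_cderive_continuous => z; apply: is_cderive_cexp.
  exact: is_cderiveD (is_cderive_gaussian_exponent K0 b0 z) (is_cderive_cst z c).
have me phi phi' : test_function phi phi' -> cint m phi = lebesgue_pairing phi e.
  by rewrite -eE; exact: mk.
have ReE z : Re (gaussian_exponent K0 b0 z + c) = Re K0 * (z ^+ 2 / 2) + Re b0 * z + Re c.
  by rewrite ReD Re_gaussian_exponent.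
have K0_lt0 : Re K0 < 0.
  rewrite ltNge; apply/negP => K0_ge0.
  have [C hC] := density_bounded_mass cre cie me.
  pose r := expR (Re c); have r0 : 0 < r by exact: expR_gt0.
  have large (p q : R) : p < q -> (forall z, p < z < q -> 0 <= Re b0 * z) ->
      (q - p) * r <= C.
    move=> pq bz; apply: le_trans (hC p q).
    have -> : (q - p) * r = \int[leb]_z (\1_(`]p, q[%classic) z * r).
      by rewrite RintegralZr ?Rintegral_indic_itvoo ?ltW//; exact: integrable_itvoo.
    apply: le_Rintegral => //.
    - by apply: (@integrable_indic_itvoo _ _ _ (fun=> r)) => t; exact: cvg_cst.
    - apply: integrable_indic_itvoo => t.
      by apply: cvgD; apply: cvg_norm; [exact: cre | exact: cie].
    - move=> z _; rewrite indicE; have [zd|_] := boolP (_ \in _); last by rewrite !mul0r.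
      rewrite !mul1r; apply: le_trans (expR_Re_le_cexp _).
      rewrite ler_expR ReE lerDr addr_ge0//.
        by rewrite mulr_ge0// divr_ge0 ?sqr_ge0.
      by apply: bz; move: zd; rewrite inE/= in_itv.
  (* On an interval of length [M] in that half line the mass is at least
     [M * r], which exceeds the bound [C]. *)
  pose M : R := `|C| / r + 1.
  have M0 : 0 < M by rewrite ltr_wpDl// divr_ge0// ltW.
  have CM : C < M * r.
    by rewrite /M mulrDl mul1r divfK ?gt_eqF//; have := ler_norm C; lra.
  have [b_ge0|b_lt0] := leP 0 (Re b0).
    have := large 0 M M0; rewrite subr0 => /(_ _)/le_lt_trans => h.
    have /h/(_ CM) : forall z, 0 < z < M -> 0 <= Re b0 * z.
      by move=> z /andP[z0 _]; rewrite mulr_ge0// ltW.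
    by rewrite ltxx.
  have NM : - M < 0 by rewrite oppr_lt0.
  have := large (- M) 0 NM; rewrite sub0r opprK => /(_ _)/le_lt_trans => h.
  have /h/(_ CM) : forall z, - M < z < 0 -> 0 <= Re b0 * z.
    by move=> z /andP[_ z0]; rewrite nmulr_rge0// ltW.
  by rewrite ltxx.
split => //.
have int : leb.-integrable setT
    (EFin \o (fun x => expR (Re K0 / 2 * x ^+ 2 + Re b0 * x + Re c))).
  by apply: integrable_expR_quadratic; rewrite pmulr_llt0// invr_gt0.
have eD : (fun x : R => cexp (K0 * (2^-1)%:C * (x ^+ 2)%:C + b0 * x%:C + c)) = e.
  apply/funext => x; rewrite /e /gaussian_exponent.
  have h2 : (2^-1)%:C * (x ^+ 2)%:C = (x ^+ 2 / 2)%:C :> R[i].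
    apply/eqP; rewrite eq_complex/= !mul0r !mulr0 subr0 addr0 eqxx andbT.
    by rewrite mulrC.
  by rewrite -mulrA h2.
rewrite eD; apply: density_of_integrable => //.
- apply: le_integrable int => //.
    apply/measurable_EFinP; apply: continuous_measurable_fun => t.
    by apply: cvg_norm; exact: cre.
  move=> x _; rewrite lee_fin normr_id (ger0_norm (expR_ge0 _)).
  by rewrite (le_trans (norm_Re_cexp_le _))// ler_expR ReE mulrA mulrAC.
- apply: le_integrable int => //.
    apply/measurable_EFinP; apply: continuous_measurable_fun => t.
    by apply: cvg_norm; exact: cie.
  move=> x _; rewrite lee_fin normr_id (ger0_norm (expR_ge0 _)).
  by rewrite (le_trans (norm_Im_cexp_le _))// ler_expR ReE mulrA mulrAC.
Qed.

End gaussian_limit.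

(** * Necessity *)

Section necessity.
Context (R : realType).
Local Notation RR := (measurableTypeR R).
Local Notation leb := (@lebesgue_measure R).
Implicit Types m : {complex_measure set RR -> R[i]}.

Definition concentrated_at m (t : R) := forall A, measurable A -> ~ A t -> m A = 0.

Lemma concentrated_dirac m t : concentrated_at m t ->
  eq_on_measurable m (fun A => m [set t] * (fine (\d_t A))%:C).
Proof.
move=> mt A mA.
have ms : measurable ([set t] : set RR) by exact: measurable_set1.
have [At|nAt] := pselect (A t); last first.
  by rewrite (mt _ mA nAt) diracE memNset// mulr0.
have mD : measurable (A `\ t) by exact: measurableD.
rewrite diracE mem_set//= mulr1 -!cint_indic//.
have -> : \1_A = (fun x => 1 * \1_(A `\ t) x + \1_[set t] x) :> (RR -> R).
  apply/funext => x; rewrite mul1r !indicE; have [->|xt] := eqVneq x t.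
    rewrite (mem_set At) (@memNset _ (A `\ t)); last by move=> [_]; exact.
    by rewrite (@mem_set _ [set t])// add0r.
  rewrite (@memNset _ [set t]); last by move=> /= xt'; rewrite xt' eqxx in xt.
  rewrite addr0; congr (_%:R); congr nat_of_bool.
  apply/idP/idP => /set_mem; last by move=> [Ax _]; exact: mem_set.
  move=> Ax; apply: mem_set; split => //= xt'.
  by rewrite xt' eqxx in xt.
rewrite cint_lin; [ | exact: bounded_measurable_indic..].
by rewrite [X in _ * X]cint_indic// (mt _ mD) ?mulr0 ?add0r// => -[_]; exact.
Qed.

Lemma cint_concentrated m t : concentrated_at m t -> forall f, bounded_measurable f ->
  cint m f = m [set t] * (f t)%:C.
Proof.
move=> mt f bf; pattern f.
apply: (@bounded_measurable_ind _ _ _ measurable _ _ _ _ _ _ _ _ bf).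
- by rewrite sigma_algebra_id//; exact: sigma_algebra_measurable.
- exact: measurableI.
- by rewrite cint_cst1 (concentrated_dirac mt)// diracT.
- by move=> A mA; rewrite cint_indic// (concentrated_dirac mt)// diracE.
- move=> a g h bg bh gE hE; rewrite cint_lin// gE hE rmorphD rmorphM; ring.
- move=> f_ g M mf fM fE fg.
  apply: (@complex_cvg_unique _ (fun n => cint m (f_ n))).
    by apply: cint_cvg fg => //; exact: fM.
  under eq_fun do rewrite fE.
  apply: cvgM; first exact: cvg_cst.
  by apply: (@cvg_complex _ _ (fun=> 0)); [exact: fg | exact: cvg_cst].
Qed.

(** Averages that vanish for arbitrarily large parameters would converge weakly
    to zero along these parameters. *)
Lemma gconv_eventually_neq0 m : ~ (forall A, measurable A -> m A = 0) ->
  exists N, forall n, (N <= n)%N -> exists z, gconv m n.+1%:R z != 0.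
Proof.
move=> mn0.
have [phi [phi' [tphi phi0]]] : exists phi phi', test_function phi phi' /\ cint m phi != 0.
  apply: contrapT => none; apply: mn0; apply: null_of_test_functions => phi phi' tphi.
  by apply/eqP/negPn/negP => nz; apply: none; exists phi, phi'.
have cphi := test_function_continuous tphi; have sphi : compactly_supported phi by case: tphi.
have C0 : (Num.sqrt pi)%:C != 0 :> R[i] by rewrite eq_complex/= gt_eqF ?sqrtr_gt0 ?pi_gt0.
have l0 : cint m phi * (Num.sqrt pi)%:C != 0 by rewrite mulf_neq0.
have cg : (fun n => (Num.sqrt n.+1%:R)%:C * lebesgue_pairing phi (gconv m n.+1%:R) : R[i]^o)
    @ \oo --> (cint m phi * (Num.sqrt pi)%:C : R[i]^o) by exact: cvg_gconv.
have [N _ hN] : \forall n \near \oo,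
    (Num.sqrt n.+1%:R)%:C * lebesgue_pairing phi (gconv m n.+1%:R) != 0 :> R[i].
  exact: (cvgr_neq0 _ cg l0).
exists N => n /hN/= nz; apply: contrapT => none.
have h0 z : gconv m n.+1%:R z = 0.
  by apply/eqP/negPn/negP => hz; apply: none; exists z.
move: nz; rewrite /lebesgue_pairing.
under eq_Rintegral do rewrite h0 mulr0.
under [X in _ +i* X]eq_Rintegral do rewrite h0 mulr0.
by rewrite Rintegral_cst// mul0r mulr0 eqxx.
Qed.

(** The average of [c delta_t] is [c e^(-s (z - t)^2)], with logarithmic
    derivative [- 2 s (z - t)]. *)
Lemma concentrated_slope m t (K b : R[i]) (s : R) : concentrated_at m t ->
  ~ (forall A, measurable A -> m A = 0) -> 0 < s ->
  (forall z : R, cint m (fun y => dgauss s (z - y)) = (K * z%:C + b) * gconv m s z) ->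
  K = (- (2 * s))%:C.
Proof.
move=> mt mn0 s0 ode.
have ct : m [set t] != 0.
  by apply/eqP => c0; apply: mn0 => A mA; rewrite (concentrated_dirac mt)// c0 mul0r.
have bg (g : R -> R) (M z : R) : continuous g -> (forall x, `|g x| <= M) ->
    cint m (fun y => g (z - y)) = m [set t] * (g (z - t))%:C.
  move=> cg gM; rewrite (@cint_concentrated _ _ mt (fun y => g (z - y)))//.
  exact: bounded_measurable_translate cg gM.
have odet z : (- (2 * s) * (z - t))%:C = K * z%:C + b.
  have := ode z; rewrite /gconv (bg (dgauss s) (s + 1)); last 2 first.
  - exact: is_derive1_continuous (is_derive_dgauss s).
  - exact: norm_dgauss.
  rewrite (bg (gauss s) 1); last 2 first.
  - exact: continuous_gauss.
  - exact: norm_gauss.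
  have g0 : (gauss s (z - t))%:C != 0 :> R[i] by rewrite eq_complex/= gt_eqF ?gauss_gt0.
  rewrite /dgauss rmorphM !mulrA [m _ * _]mulrC -!mulrA => /(mulIf _) e.
  by apply: e; rewrite mulf_neq0.
have e0 : (- (2 * s) * (0 - t))%:C = b by rewrite odet rmorph0 mulr0 add0r.
have e1 : (- (2 * s) * (1 - t))%:C = K + b by rewrite odet rmorph1 mulr1.
by rewrite -[K](addrK b) -e1 -e0 -rmorphB; congr (_ %:C); ring.
Qed.

Lemma linear_slope_diverges (K : nat -> R[i]) (N : nat) (K0 : R[i]) :
  (forall n, (N <= n)%N -> K n = (- (2 * n.+1%:R))%:C) ->
  ~ (K : nat -> R[i]^o) @ \oo --> (K0 : R[i]^o).
Proof.
move=> KE cK.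
have /cvg_seq_bounded[C [_ hC]] : cvgn (fun n => Re (K n)) by exact: cvgP (cvg_Re cK).
have CC : C < C + 1 by rewrite ltrDl.
pose n := (N + Num.truncn `|(C + 1)%R|%R)%N.
have : `|Re (K n)| <= C + 1 by exact: (hC _ CC).
rewrite KE ?leq_addr//= normrN ger0_norm ?mulr_ge0//.
have := truncnS_gt `|C + 1|.
have : (Num.truncn `|C + 1|).+1%:R <= n.+1%:R :> R by rewrite ler_nat ltnS leq_addl.
have := ler_norm (C + 1); have := ltr0Sn R n; lra.
Qed.

(** For each large [n] the slope is common to both averages.  If it converges,
    neither measure is carried by a point; if it does not, both are. *)
Lemma product_image_necessary (mu1 mu2 nu1 nu2 : {complex_measure set RR -> R[i]})
    (F : RR * RR -> RR * RR) :
  (forall x1 x2 : R, F (x1, x2) = (x1 + x2, x1 - x2)) ->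
  eq_on_measurable (cpushforward (mu1 \xC mu2) F) (nu1 \xC nu2) ->
  ~ (forall A, measurable A -> mu1 A = 0) -> ~ (forall A, measurable A -> mu2 A = 0) ->
  (exists c1 c2 c3 c4 c5 : R[i],
    [/\ Re c1 < 0,
        eq_on_measurable mu1 (density_measure leb
          (fun x : R => cexp (c1 * (x ^+ 2)%:C + c2 * x%:C + c3))) &
        eq_on_measurable mu2 (density_measure leb
          (fun x : R => cexp (c1 * (x ^+ 2)%:C + c4 * x%:C + c5)))]) \/
  (exists t1 t2, concentrated_at mu1 t1 /\ concentrated_at mu2 t2).
Proof.
move=> hF eqF n1 n2.
have [N1 hN1] := gconv_eventually_neq0 n1.
have [N2 hN2] := gconv_eventually_neq0 n2.
pose N := maxn N1 N2.
have /choice[Kb hKb] n : exists Kb : R[i] * R[i] * R[i], (N <= n)%N -> forall z : R,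
    cint mu1 (fun y => dgauss n.+1%:R (z - y)) =
      (Kb.1.1 * z%:C + Kb.1.2) * gconv mu1 n.+1%:R z /\
    cint mu2 (fun y => dgauss n.+1%:R (z - y)) =
      (Kb.1.1 * z%:C + Kb.2) * gconv mu2 n.+1%:R z.
  have s0 : 0 < n.+1%:R :> R by rewrite ltr0n.
  have [Nn|nN] := leqP N n; last by exists (0, 0, 0).
  have [a ha] := hN1 n (leq_trans (leq_maxl _ _) Nn).
  have [c hc] := hN2 n (leq_trans (leq_maxr _ _) Nn).
  have sp := gconv_splits s0 hF eqF.
  have [d1 dd1] := gconv_derive mu1 s0; have [d2 dd2] := gconv_derive mu2 s0.
  have [cr1 ci1] := is_cderive_continuous d1; have [cr2 ci2] := is_cderive_continuous d2.
  have nz1 := splits_neq0 sp cr2 ci2 ha hc.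
  have nz2 := splits_neq0 (splits_sym sp) cr1 ci1 hc ha.
  have [K [b1 [b2 h]]] := splits_log_affine sp d1 d2 dd1 dd2 nz1 nz2.
  by exists (K, b1, b2) => _ z; exact: h.
pose K n := (Kb n).1.1; pose b1 n := (Kb n).1.2; pose b2 n := (Kb n).2.
have ode1 n (Nn : (N <= n)%N) z := (hKb n Nn z).1.
have ode2 n (Nn : (N <= n)%N) z := (hKb n Nn z).2.
have slope m (b : nat -> R[i]) t : concentrated_at m t ->
    ~ (forall A, measurable A -> m A = 0) ->
    (forall n, (N <= n)%N -> forall z : R, cint m (fun y => dgauss n.+1%:R (z - y)) =
      (K n * z%:C + b n) * gconv m n.+1%:R z) ->
    forall n, (N <= n)%N -> K n = (- (2 * n.+1%:R))%:C.
  move=> mt mn0 ode n Nn; apply: (concentrated_slope mt mn0 _ (ode n Nn)).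
  by rewrite ltr0n.
have [[t1 ct1]|[K1 [c1 [cK1 cb1]]]] := @dirac_or_cvg R mu1 K b1 N ode1;
  have [[t2 ct2]|[K2 [c2 [cK2 cb2]]]] := @dirac_or_cvg R mu2 K b2 N ode2.
- by right; exists t1, t2.
- by case: (linear_slope_diverges (slope _ _ _ ct1 n1 ode1) cK2).
- by case: (linear_slope_diverges (slope _ _ _ ct2 n2 ode2) cK1).
left; have K12 := complex_cvg_unique cK1 cK2.
have [e1 [K_lt0 d1]] := gaussian_of_convergent ode1 cK1 cb1 n1.
have [e2 [_ d2]] := gaussian_of_convergent ode2 cK2 cb2 n2.
exists (K1 * (2^-1)%:C), c1, e1, c2, e2; split => //.
  by rewrite ReM/= mulr0 subr0 pmulr_llt0// invr_gt0.
by rewrite K12.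
Qed.

End necessity.

(** * Sufficiency *)

Section product_uniqueness.
Context d1 d2 (T1 : measurableType d1) (T2 : measurableType d2) (R : realType).

(** Rectangles form a generating pi-system.  This identifies the product measure
    with any complex measure whose values on rectangles can be computed. *)
Lemma product_cmeasure_unique (m1 : {complex_measure set T1 -> R[i]})
    (m2 : {complex_measure set T2 -> R[i]}) (m : {complex_measure set ((T1 * T2)%type) -> R[i]}) :
  (forall A B, measurable A -> measurable B -> m (A `*` B) = m1 A * m2 B) ->
  eq_on_measurable (m1 \xC m2) m.
Proof.
move=> mE; apply: (complex_measure_unique (measurable_prod_measurableType _ _)).
- move=> _ _ [A mA [B mB <-]] [A' mA' [B' mB' <-]].
  rewrite -setXI; exists (A `&` A'); first exact: measurableI.
  by exists (B `&` B') => //; exact: measurableI.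
- move=> _ [A mA [B mB <-]].
  by have := product_cmeasureE m1 m2 mA mB; rewrite -mE.
- have := product_cmeasureE m1 m2 measurableT measurableT.
  by rewrite -mE// setXTT.
Qed.

End product_uniqueness.

Section basic_complex_measures.
Context d (T : measurableType d) (R : realType).

Definition null_cmeasure : {complex_measure set T -> R[i]} :=
  cmeasure_of_charges (@czero _ T R) (@czero _ T R).

Lemma null_cmeasureE A : null_cmeasure A = 0.
Proof. by []. Qed.

Definition dirac_cmeasure (c : R[i]) (t : T) : {complex_measure set T -> R[i]} :=
  cmeasure_of_charges (cscale (Re c) (charge_of_finite_measure (@dirac _ T t R)))
    (cscale (Im c) (charge_of_finite_measure (@dirac _ T t R))).

Lemma dirac_cmeasureE c t A : dirac_cmeasure c t A = c * (fine (\d_t A : \bar R))%:C.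
Proof.
rewrite -[LHS]/(fine ((Re c)%:E * \d_t A) +i* fine ((Im c)%:E * \d_t A)) diracE/=.
by case: c => x y; apply/eqP; rewrite eq_complex/= !mulr0 subr0 add0r !eqxx.
Qed.

Variable mu : {measure set T -> \bar R}.

Definition density_cmeasure (f : T -> R[i])
    (ir : mu.-integrable setT (EFin \o (fun x => Re (f x))))
    (ii : mu.-integrable setT (EFin \o (fun x => Im (f x)))) :
    {complex_measure set T -> R[i]} :=
  cmeasure_of_charges (induced_charge ir) (induced_charge ii).

Lemma density_cmeasureE f ir ii A : @density_cmeasure f ir ii A = density_measure mu f A.
Proof. by []. Qed.

End basic_complex_measures.

Lemma product_cmeasure_null d1 d2 (T1 : measurableType d1) (T2 : measurableType d2)
    (R : realType) (m1 : {complex_measure set T1 -> R[i]})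
    (m2 : {complex_measure set T2 -> R[i]}) :
  eq_on_measurable m1 (fun=> 0) \/ eq_on_measurable m2 (fun=> 0) ->
  eq_on_measurable (m1 \xC m2) (fun=> 0).
Proof.
move=> m0 S mS; rewrite (@product_cmeasure_unique _ _ _ _ _ m1 m2 (null_cmeasure _ _))//.
move=> A B mA mB; rewrite null_cmeasureE.
by case: m0 => ->//; rewrite ?mul0r ?mulr0.
Qed.

Lemma product_cmeasure_dirac d1 d2 (T1 : measurableType d1) (T2 : measurableType d2)
    (R : realType) (m1 : {complex_measure set T1 -> R[i]})
    (m2 : {complex_measure set T2 -> R[i]}) (c1 c2 : R[i]) (t1 : T1) (t2 : T2) :
  eq_on_measurable m1 (fun A => c1 * (fine (\d_t1 A : \bar R))%:C) ->
  eq_on_measurable m2 (fun A => c2 * (fine (\d_t2 A : \bar R))%:C) ->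
  eq_on_measurable (m1 \xC m2) (fun A => c1 * c2 * (fine (\d_(t1, t2) A : \bar R))%:C).
Proof.
move=> m1E m2E S mS; rewrite -dirac_cmeasureE.
apply: product_cmeasure_unique => // A B mA mB.
rewrite dirac_cmeasureE m1E// m2E// !diracE /= in_setX/=.
by do 2 case: (_ \in _); rewrite /= ?mulr0 ?mul0r ?mulr1 ?mul0r.
Qed.

Section product_density.
Context d1 d2 (T1 : measurableType d1) (T2 : measurableType d2) (R : realType).
Variables (mu1 : {sigma_finite_measure set T1 -> \bar R})
          (mu2 : {sigma_finite_measure set T2 -> \bar R}).

Section tensor.
Variables (p : T1 -> R) (q : T2 -> R).
Hypotheses (ip : mu1.-integrable setT (EFin \o p)) (iq : mu2.-integrable setT (EFin \o q)).

Lemma integrable_tensor :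
  (mu1 \x mu2)%E.-integrable setT (EFin \o (fun z => p z.1 * q z.2)).
Proof.
have mp : measurable_fun setT p by exact/measurable_EFinP/(measurable_int _ ip).
have mq : measurable_fun setT q by exact/measurable_EFinP/(measurable_int _ iq).
apply/integrable12ltyP.
  apply/measurable_EFinP; apply: measurable_funM.
    exact: (measurableT_comp mp measurable_fst).
  exact: (measurableT_comp mq measurable_snd).
have /integrableP[_ ip'] := ip; have /integrableP[_ iq'] := iq.
have fq : (\int[mu2]_y `|(EFin \o q) y|)%E \is a fin_num.
  by rewrite ge0_fin_numE// integral_ge0.
under eq_integral => x _.
  under eq_integral => y _ do rewrite /= normrM EFinM.
  rewrite ge0_integralZl//; last first.
    by apply/measurable_EFinP; exact: measurableT_comp.
  over.
rewrite /= ge0_integralZr//; last 2 first.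
- by apply/measurable_EFinP; exact: measurableT_comp.
- by rewrite integral_ge0.
have fp : (\int[mu1]_x `|(EFin \o p) x|)%E \is a fin_num.
  by rewrite ge0_fin_numE// integral_ge0.
by rewrite -(fineK fp) -(fineK fq) -EFinM ltry.
Qed.

Lemma Rintegral_tensor :
  \int[(mu1 \x mu2)%E]_z (p z.1 * q z.2) = \int[mu1]_x p x * \int[mu2]_y q y.
Proof.
rewrite /Rintegral -(integral12_prod_meas1 integrable_tensor) /fubini_F /=.
have fq := integrable_fin_num measurableT iq.
have fp := integrable_fin_num measurableT ip.
under eq_integral => x _.
  under eq_integral => y _ do rewrite EFinM.
  rewrite integralZl//.
  over.
have [c cE] : exists c, (\int[mu2]_y (q y)%:E = c%:E)%E.
  by exists (fine (\int[mu2]_y (q y)%:E)); rewrite fineK.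
by rewrite cE integralZr// fineM.
Qed.

End tensor.

Variables (f1 : T1 -> R[i]) (f2 : T2 -> R[i]).
Hypotheses (ir1 : mu1.-integrable setT (EFin \o (fun x => Re (f1 x))))
           (ii1 : mu1.-integrable setT (EFin \o (fun x => Im (f1 x))))
           (ir2 : mu2.-integrable setT (EFin \o (fun x => Re (f2 x))))
           (ii2 : mu2.-integrable setT (EFin \o (fun x => Im (f2 x)))).

Let f (z : T1 * T2) := f1 z.1 * f2 z.2.

Lemma integrable_Re_tensor :
  (mu1 \x mu2)%E.-integrable setT (EFin \o (fun z => Re (f z))).
Proof.
have -> : EFin \o (fun z => Re (f z)) =
    (fun z => (Re (f1 z.1) * Re (f2 z.2))%:E - (Im (f1 z.1) * Im (f2 z.2))%:E)%E.
  by apply/funext => z; rewrite /= /f ReM EFinB.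
by apply: integrableB => //; [exact: integrable_tensor ir1 ir2 | exact: integrable_tensor ii1 ii2].
Qed.

Lemma integrable_Im_tensor :
  (mu1 \x mu2)%E.-integrable setT (EFin \o (fun z => Im (f z))).
Proof.
have -> : EFin \o (fun z => Im (f z)) =
    (fun z => (Re (f1 z.1) * Im (f2 z.2))%:E + (Im (f1 z.1) * Re (f2 z.2))%:E)%E.
  by apply/funext => z; rewrite /= /f ImM EFinD.
by apply: integrableD => //; [exact: integrable_tensor ir1 ii2 | exact: integrable_tensor ii1 ir2].
Qed.

Lemma product_cmeasure_density (m1 : {complex_measure set T1 -> R[i]})
    (m2 : {complex_measure set T2 -> R[i]}) :
  eq_on_measurable m1 (density_measure mu1 f1) ->
  eq_on_measurable m2 (density_measure mu2 f2) ->
  eq_on_measurable (m1 \xC m2) (density_measure (mu1 \x mu2)%E f).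
Proof.
move=> m1E m2E S mS.
rewrite -(density_cmeasureE integrable_Re_tensor integrable_Im_tensor).
apply: product_cmeasure_unique => // A B mA mB.
rewrite density_cmeasureE m1E// m2E// /density_measure /cRintegral.
have restr d (T : measurableType d) (mu : {measure set T -> \bar R}) (D : set T) (u : T -> R) :
    measurable D -> mu.-integrable setT (EFin \o u) ->
    \int[mu]_(x in D) u x = \int[mu]_x (\1_D x * u x) /\
    mu.-integrable setT (EFin \o (fun x => \1_D x * u x)).
  move=> mD iu.
  have E : (fun x => \1_D x * u x) = u \_ D.
    by apply/funext => x; rewrite patchE indicE; case: (_ \in _); rewrite ?mul1r ?mul0r.
  rewrite Rintegral_mkcond E; split => //.
  rewrite -restrict_EFin; apply: (iffLR (integrable_mkcond _ _)) => //.
  exact: integrableS iu.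
have mAB : measurable (A `*` B) by exact: measurableX.
have [-> _] := restr _ _ _ _ _ mAB integrable_Re_tensor.
have [-> _] := restr _ _ _ _ _ mAB integrable_Im_tensor.
have [-> iA1] := restr _ _ _ _ _ mA ir1; have [-> iA2] := restr _ _ _ _ _ mA ii1.
have [-> iB1] := restr _ _ _ _ _ mB ir2; have [-> iB2] := restr _ _ _ _ _ mB ii2.
have indX z : \1_(A `*` B) z = \1_A z.1 * \1_B z.2 :> R.
  by case: z => x y; rewrite !indicE in_setX -natrM mulnb.
apply/eqP; rewrite eq_complex/= -!Rintegral_tensor//; apply/andP; split; apply/eqP.
  rewrite -RintegralB//; [|exact: integrable_tensor iA1 iB1|exact: integrable_tensor iA2 iB2].
  by apply: eq_Rintegral => z _; rewrite indX /f ReM; ring.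
rewrite -RintegralD//; [|exact: integrable_tensor iA1 iB2|exact: integrable_tensor iA2 iB1].
by apply: eq_Rintegral => z _; rewrite indX /f ImM; ring.
Qed.

End product_density.

Section sum_difference.
Context (R : realType).
Local Notation RR := (measurableTypeR R).
Local Notation leb := (@lebesgue_measure R).
Local Notation leb2 := (leb \x leb)%E.

Definition sum_difference (p : RR * RR) : RR * RR := (p.1 + p.2, p.1 - p.2).

Lemma measurable_sum_difference : measurable_fun setT sum_difference.
Proof. by apply: measurable_fun_pair; [exact: measurable_funD | exact: measurable_funB]. Qed.

(** For fixed [y], translate [x] to [u = x + y]; for fixed [u], the map
    [y |-> u - 2 y] has slope of absolute value 2. *)
Lemma ge0_integral_sum_difference (g : RR * RR -> \bar R) :
  measurable_fun setT g -> (forall p, 0 <= g p)%E ->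
  (\int[leb2]_p g (sum_difference p) = 2^-1%:E * \int[leb2]_p g p)%E.
Proof.
move=> mg g0.
have mgF : measurable_fun setT (g \o sum_difference).
  exact: (measurableT_comp mg measurable_sum_difference).
have pair_measurable (a b : RR -> RR) : measurable_fun setT a -> measurable_fun setT b ->
    measurable_fun setT (fun x => g (a x, b x)).
  move=> ma mb; apply: (measurableT_comp mg); exact: measurable_fun_pair.
rewrite (fubini_tonelli2 (g \o sum_difference))//; last by move=> p; exact: g0.
rewrite /fubini_G /sum_difference /=.
have inner (y : R) : (\int[leb]_x g ((x + y)%R, (x - y)%R) = \int[leb]_u g (u, (u - 2 * y)%R))%E.
  have := @ge0_integral_affine R y 1 (fun u => g (u, u - 2 * y)) (oner_neq0 _) _ _.
  rewrite normr1 invr1 mul1e => <-.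
  - by apply: eq_integral => x _; congr (g (_, _)); ring.
  - by apply: pair_measurable => //; apply: measurable_funB => //.
  - by move=> x; exact: g0.
under eq_integral do rewrite inner.
rewrite -(fubini_tonelli (fun p : RR * RR => g (p.1, p.1 - 2 * p.2)))/=; last 2 first.
- have m1 : measurable_fun setT (fun p : RR * RR => (p.1, p.1 - 2 * p.2) : RR * RR).
    apply: measurable_fun_pair; first exact: measurable_fst.
    apply: measurable_funB; first exact: measurable_fst.
    apply: measurable_funM; first exact: measurable_cst.
    exact: measurable_snd.
  exact: (measurableT_comp mg m1).
- by move=> p; exact: g0.
have inner2 (u : R) : (\int[leb]_y g (u, (u - 2 * y)%R) = 2^-1%:E * \int[leb]_v g (u, v))%E.
  have n2 : - 2 != 0 :> R by rewrite oppr_eq0 pnatr_eq0.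
  have := @ge0_integral_affine R u (- 2) (fun v => g (u, v)) n2 _ _.
  rewrite normrN normr_nat => <-.
  - by apply: eq_integral => y _; congr (g (_, _)); ring.
  - exact: pair_measurable.
  - by move=> x; exact: g0.
under eq_integral do rewrite inner2.
rewrite ge0_integralZl//; last 2 first.
- by apply: (measurable_fun_fubini_tonelli_F g).
- by move=> u _; apply: integral_ge0 => v _; exact: g0.
by rewrite (fubini_tonelli1 g).
Qed.

Lemma integral_sum_difference (u : RR * RR -> R) :
  leb2.-integrable setT (EFin \o u) ->
  \int[leb2]_p u (sum_difference p) = 2^-1 * \int[leb2]_p u p.
Proof.
move=> iu; have mu := measurable_int _ iu.
rewrite /Rintegral integralE [in RHS]integralE.
have -> : (\int[leb2]_p ((fun p => (u (sum_difference p))%:E)^\+ p) =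
    2^-1%:E * \int[leb2]_p ((fun p => (u p)%:E)^\+ p))%E.
  rewrite -ge0_integral_sum_difference//; last exact: measurable_funepos.
  by apply: eq_integral => x _; rewrite -[in LHS]/((EFin \o u) \o sum_difference) funepos_comp.
have -> : (\int[leb2]_p ((fun p => (u (sum_difference p))%:E)^\- p) =
    2^-1%:E * \int[leb2]_p ((fun p => (u p)%:E)^\- p))%E.
  rewrite -ge0_integral_sum_difference//; last exact: measurable_funeneg.
  by apply: eq_integral => x _; rewrite -[in LHS]/((EFin \o u) \o sum_difference) funeneg_comp.
have ifp := integrable_fin_num measurableT (integrable_funepos measurableT iu).
have ifn := integrable_fin_num measurableT (integrable_funeneg measurableT iu).
by rewrite -(fineK ifp) -(fineK ifn) -!EFinM -!EFinB /= mulrBr.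
Qed.

End sum_difference.

Section gaussian_factors.
Context (R : realType).
Local Notation RR := (measurableTypeR R).
Local Notation leb := (@lebesgue_measure R).
Local Notation leb2 := (leb \x leb)%E.

Definition gaussian (a b c : R[i]) (x : R) : R[i] :=
  cexp (a * (x ^+ 2)%:C + b * x%:C + c).

Lemma Re_quadratic (a b c : R[i]) (x : R) :
  Re (a * (x ^+ 2)%:C + b * x%:C + c) = Re a * x ^+ 2 + Re b * x + Re c.
Proof. by rewrite !ReD !ReM/= !mulr0 !subr0. Qed.

Lemma is_cderive_gaussian (a b c : R[i]) (x : R) :
  is_cderive x (gaussian a b c) ((a * (2 * x)%:C + b) * gaussian a b c x).
Proof.
have d2 : is_derive x (1 : R) (fun t : R => t ^+ 2) (2 * x).
  apply: is_derive1_eq (is_derive1M (is_derive1_id x) (is_derive1_id x)) _.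
  by ring.
apply: is_cderive_cexp; apply: is_cderive_eq.
  apply: is_cderiveD; last exact: is_cderive_cst.
  exact: is_cderiveD (is_cderiveZ a (is_cderive_real d2))
    (is_cderiveZ b (is_cderive_real (is_derive1_id x))).
by rewrite mulr1 addr0.
Qed.

Lemma integrable_gaussian (a b c : R[i]) : Re a < 0 ->
  leb.-integrable setT (EFin \o (fun x => Re (gaussian a b c x))) /\
  leb.-integrable setT (EFin \o (fun x => Im (gaussian a b c x))).
Proof.
move=> a0; have int := integrable_expR_quadratic (Re b) (Re c) a0.
have [cr ci] := is_cderive_continuous (is_cderive_gaussian a b c).
split; apply: le_integrable int => //.
- by apply/measurable_EFinP; exact: continuous_measurable_fun.
- move=> x _; rewrite lee_fin (ger0_norm (expR_ge0 _)) -Re_quadratic.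
  exact: norm_Re_cexp_le.
- by apply/measurable_EFinP; exact: continuous_measurable_fun.
- move=> x _; rewrite lee_fin (ger0_norm (expR_ge0 _)) -Re_quadratic.
  exact: norm_Im_cexp_le.
Qed.

(** The density of the image involves the Jacobian factor 1/2, absorbed in the
    constant [h]. *)
Lemma gaussian_sum_difference (a b1 b2 c1 c2 h : R[i]) (p : RR * RR) :
  cexp h = (2^-1)%:C ->
  gaussian a b1 c1 p.1 * gaussian a b2 c2 p.2 =
  2%:C * (gaussian (a * (2^-1)%:C) ((b1 + b2) * (2^-1)%:C) (c1 + h) (sum_difference p).1 *
          gaussian (a * (2^-1)%:C) ((b1 - b2) * (2^-1)%:C) c2 (sum_difference p).2).
Proof.
move=> hE; case: p => x y; rewrite /sum_difference /gaussian /=.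
have half : 2%:C * (2^-1)%:C = 1 :> R[i].
  by apply/eqP; rewrite eq_complex/= !mul0r !mulr0 subr0 addr0 divff ?eqxx// pnatr_eq0.
have cancel_half (u v : R[i]) : 2%:C * (u * (2^-1)%:C * v) = u * v.
  by rewrite -[RHS]mul1r -half; ring.
rewrite addrA [X in _ = _ * (X * _)]cexpD hE cancel_half.
rewrite -!cexpD; congr cexp; apply/eqP; rewrite eq_complex.
case: a => a a'; case: b1 => b1 b1'; case: b2 => b2 b2'; case: c1 => c1 c1'.
by case: c2 => c2 c2' /=; apply/andP; split; apply/eqP; field.
Qed.

Lemma Rintegral_preimage_sum_difference (v w : RR * RR -> R) (A : set (RR * RR)) :
  measurable A -> leb2.-integrable setT (EFin \o w) ->
  (forall p, v p = 2 * w (sum_difference p)) ->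
  \int[leb2]_(p in @sum_difference R @^-1` A) v p = \int[leb2]_(q in A) w q.
Proof.
move=> mA iw vE; pose u q := 2 * (w \_ A) q.
have iwA : leb2.-integrable setT (EFin \o (w \_ A)).
  rewrite -restrict_EFin; apply: (iffLR (integrable_mkcond _ _)) => //.
  exact: integrableS iw.
have iu : leb2.-integrable setT (EFin \o u) by have := integrableZl measurableT 2 iwA.
rewrite Rintegral_mkcond [RHS]Rintegral_mkcond.
transitivity (\int[leb2]_p u (sum_difference p)).
  apply: eq_Rintegral => p _; rewrite /u !patchE.
  have -> : (p \in @sum_difference R @^-1` A) = (sum_difference p \in A).
    by apply/idP/idP => /set_mem ?; exact: mem_set.
  by case: (_ \in _); rewrite ?mulr0// vE.
by rewrite integral_sum_difference// RintegralZl// mulrA mulVf ?mul1r// pnatr_eq0.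
Qed.

End gaussian_factors.

Theorem corollary2p6 (R : realType)
    (mu1 mu2 : {complex_measure set (measurableTypeR R) -> R[i]})
    (F : measurableTypeR R * measurableTypeR R ->
         measurableTypeR R * measurableTypeR R)
    (hF : forall x1 x2 : R, F (x1, x2) = (x1 + x2, x1 - x2)) :
  (exists nu1 nu2 : {complex_measure set (measurableTypeR R) -> R[i]},
     eq_on_measurable (cpushforward (mu1 \xC mu2) F) (nu1 \xC nu2))
  <->
  [\/ eq_on_measurable mu1 (fun=> 0),
      eq_on_measurable mu2 (fun=> 0),
      (exists c1 c2 c3 c4 c5 : R[i],
        [/\ complex.Re c1 < 0,
            eq_on_measurable mu1 (density_measure lebesgue_measure
              (fun x : R => cexp (c1 * (x ^+ 2)%:C + c2 * x%:C + c3))) &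
            eq_on_measurable mu2 (density_measure lebesgue_measure
              (fun x : R => cexp (c1 * (x ^+ 2)%:C + c4 * x%:C + c5)))]) |
      (exists (c1 c2 : R[i]) (t1 t2 : R),
        eq_on_measurable mu1 (fun A => c1 * (fine (\d_t1 A))%:C) /\
        eq_on_measurable mu2 (fun A => c2 * (fine (\d_t2 A))%:C))].
Proof.
have FE : F = @sum_difference R by apply/funext => -[x y]; rewrite hF.
have mF : measurable_fun setT F by rewrite FE; exact: measurable_sum_difference.
have mpre A : measurable A -> measurable (F @^-1` A).
  by move=> mA; rewrite -[X in measurable X]setTI; exact: mF.
split.
  move=> [nu1 [nu2 eqF]].
  have [z1|n1] := pselect (forall A, measurable A -> mu1 A = 0); first by apply: Or41.
  have [z2|n2] := pselect (forall A, measurable A -> mu2 A = 0); first by apply: Or42.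
  have [gauss_case|[t1 [t2 [m1 m2]]]] := product_image_necessary hF eqF n1 n2.
    exact: Or43.
  apply: Or44; exists (mu1 [set t1]), (mu2 [set t2]), t1, t2.
  by split; exact: concentrated_dirac.
have null : eq_on_measurable mu1 (fun=> 0) \/ eq_on_measurable mu2 (fun=> 0) ->
    exists nu1 nu2 : {complex_measure set (measurableTypeR R) -> R[i]},
    eq_on_measurable (cpushforward (mu1 \xC mu2) F) (nu1 \xC nu2).
  move=> m0; exists (null_cmeasure _ R), (null_cmeasure _ R) => A mA.
  rewrite /cpushforward (product_cmeasure_null m0 (mpre _ mA)).
  by rewrite (product_cmeasure_null _ mA)//; left => B _; exact: null_cmeasureE.
case=> [z1|z2|[a [b1 [c1 [b2 [c2 [a0 m1E m2E]]]]]]|[c1 [c2 [t1 [t2 [m1E m2E]]]]]].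
- by apply: null; left.
- by apply: null; right.
- have h2 : (2^-1)%:C != 0 :> R[i] by rewrite eq_complex/= invr_eq0 pnatr_eq0.
  (* The Jacobian of the map is 2 in absolute value; [e^h = 1/2] puts its
     inverse in an exponent. *)
  have [h hE] := cexp_surjective h2.
  pose a' := a * (2^-1)%:C.
  have a'0 : complex.Re a' < 0 by rewrite ReM/= mulr0 subr0 pmulr_llt0// invr_gt0.
  pose g1 := gaussian a' ((b1 + b2) * (2^-1)%:C) (c1 + h).
  pose g2 := gaussian a' ((b1 - b2) * (2^-1)%:C) c2.
  have [ir1 ii1] := integrable_gaussian ((b1 + b2) * (2^-1)%:C) (c1 + h) a'0.
  have [ir2 ii2] := integrable_gaussian ((b1 - b2) * (2^-1)%:C) c2 a'0.
  have [jr1 ji1] := integrable_gaussian b1 c1 a0.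
  have [jr2 ji2] := integrable_gaussian b2 c2 a0.
  exists (density_cmeasure ir1 ii1), (density_cmeasure ir2 ii2) => A mA.
  rewrite /cpushforward (product_cmeasure_density jr1 ji1 jr2 ji2 m1E m2E (mpre _ mA)).
  have E := @product_cmeasure_density _ _ _ _ _ _ _ _ _ ir1 ii1 ir2 ii2
    (density_cmeasure ir1 ii1) (density_cmeasure ir2 ii2) (fun _ _ => erefl)
    (fun _ _ => erefl) A mA.
  apply: etrans (esym E); rewrite /density_measure /cRintegral FE.
  have fE p := gaussian_sum_difference a b1 b2 c1 c2 p hE.
  congr (_ +i* _); apply: Rintegral_preimage_sum_difference => //.
  + exact: integrable_Re_tensor.
  + by move=> p; rewrite fE ReM/= mul0r subr0.
  + exact: integrable_Im_tensor.
  + by move=> p; rewrite fE ImM/= mul0r addr0.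
- exists (dirac_cmeasure c1 (t1 + t2 : measurableTypeR R)),
    (dirac_cmeasure c2 (t1 - t2 : measurableTypeR R)) => A mA.
  rewrite /cpushforward (product_cmeasure_dirac m1E m2E (mpre _ mA)).
  have E := @product_cmeasure_dirac _ _ _ _ _ (dirac_cmeasure c1 (t1 + t2 : measurableTypeR R))
    (dirac_cmeasure c2 (t1 - t2 : measurableTypeR R)) c1 c2 (t1 + t2) (t1 - t2)
    (fun B _ => dirac_cmeasureE c1 _ B) (fun B _ => dirac_cmeasureE c2 _ B) A mA.
  apply: etrans (esym E).
  by rewrite !diracE -hF.
Qed.
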